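(* Let $n\in\mathbb{N}$, let $s,t\geqslant 0$ and $0<\max(s,t)<\frac n2$. Then for every $\varepsilon$ satisfying $$0<\varepsilon<\frac{n}{\max(s,t)}-2$$ there exists a positive number $$\delta(\varepsilon)\in\Bigl(0;\ \frac n2-\max(s,t)\Bigr)$$ such that for $\alpha=s+t+\delta(\varepsilon)$ the distribution $\mathbf{f}_\alpha$ satisfies $$\mathbf{f}_\alpha\in H^{-\min(s,t)}_{\frac{n}{\max(s,t)}-\varepsilon,\ unif}(\mathbb{R}^n)\setminus M[s,-t].$$
   Context: $D(\mathbb{R}^n)$ is the space of smooth compactly supported test functions, $D'(\mathbb{R}^n)$ its dual space of distributions, $S'(\mathbb{R}^n)$ the space of tempered distributions, $\mathcal{F}$ the Fourier transform on $S'(\mathbb{R}^n)$. Bessel potential spaces: for $s\in\mathbb{R}$ let $\varphi_s(x)=(1+|x|^2)^{s/2}$ and $J_s(u)=\mathcal{F}^{-1}(\varphi_s\cdot\mathcal{F}(u))$ for $u\in S'(\mathbb{R}^n)$. For $p\geqslant1$, $H^s_p(\mathbb{R}^n)$ is the set of $u\in S'(\mathbb{R}^n)$ such that $J_s(u)$ is the regular distribution generated by a function in $L_p(\mathbb{R}^n)$, with norm $\|u\|_{H^s_p}=\|J_s(u)\|_{L_p}$. Local and uniformly localized spaces: $H^s_{p,\,loc}(\mathbb{R}^n)=\{u\in D'(\mathbb{R}^n): f\cdot u\in H^s_p(\mathbb{R}^n)\ \forall f\in D(\mathbb{R}^n)\}$. Fix $\eta\in D(\mathbb{R}^n)$ with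 $0\leqslant\eta\leqslant1$, $\eta(x)=1$ for $|x|\leqslant1$, $\eta(x)=0$ for $|x|\geqslant2$, and put $\eta_{(z)}(x)=\eta(x-z)$. Then $H^s_{p,\,unif}(\mathbb{R}^n)=\{u\in H^s_{p,\,loc}(\mathbb{R}^n): \sup_{z\in\mathbb{R}^n}\|\eta_{(z)}\cdot u\|_{H^s_p(\mathbb{R}^n)}<+\infty\}$, this supremum being the norm; different choices of $\eta$ give the same space with equivalent norms. Multipliers: for $s,t\geqslant0$, $M[s,-t]=M[H^s_2(\mathbb{R}^n)\to H^{-t}_2(\mathbb{R}^n)]$ is the set of $\mu\in H^{-t}_{2,\,loc}(\mathbb{R}^n)$ for which there is $C>0$ with $\|f\cdot\mu\|_{H^{-t}_2(\mathbb{R}^n)}\leqslant C\|f\|_{H^s_2(\mathbb{R}^n)}$ for all $f\in D(\mathbb{R}^n)$. Equivalently, it is the set of $\mu\in D'(\mathbb{R}^n)$ for which there is $C>0$ with $|\mu(f\cdot g)|\leqslant C\|f\|_{H^s_2}\|g\|_{H^t_2}$ for all $f,g\in D(\mathbb{R}^n)$. For $\alpha>0$, $f_\alpha(x)=|x|^{-\alpha}$ for $x\neq0$, $f_\alpha(0)=0$, and $\mathbf{f}_\alpha$ is the regular functional $\varphi\mapsto\int_{\mathbb{R}^n}f_\alpha(x)\varphi(x)\,dx$ (a tempered distribution when $0<\alpha<n$). *)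

(* Defs.v *)
From HB Require Import structures.
From mathcomp Require Import all_boot all_order all_algebra.
From mathcomp Require Import all_classical all_reals all_analysis.
From mathcomp Require Import complex.

Set Implicit Arguments.
Unset Strict Implicit.
Unset Printing Implicit Defensive.

Import Order.TTheory GRing.Theory Num.Theory.
Import numFieldNormedType.Exports.
Import ComplexField.Normc.

Local Open Scope classical_set_scope.
Local Open Scope ring_scope.
Local Open Scope complex_scope.

(* R^n is 'rV[R]_n; its topology is the one the library gives to matrices, and
   its sigma-algebra is the one generated by the coordinates, i.e. the Borel
   one. *)
Definition rV_display : measure_display.
Proof. exact: default_measure_display. Qed.

Section measurable_rV.
Context (R : realType) (n : nat).

Let coord : 'I_n -> 'rV[R]_n -> R := fun i x => x ord0 i.

Let rV_set0 : g_sigma_preimage coord set0.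
Proof. exact: sigma_algebra0. Qed.

Let rV_setC A : g_sigma_preimage coord A -> g_sigma_preimage coord (~` A).
Proof. exact: sigma_algebraC. Qed.

Let rV_bigcup (F : _^nat) : (forall i, g_sigma_preimage coord (F i)) ->
  g_sigma_preimage coord (\bigcup_i (F i)).
Proof. exact: sigma_algebra_bigcup. Qed.

HB.instance Definition _ :=
  @isMeasurable.Build rV_display 'rV[R]_n
    (g_sigma_preimage coord) rV_set0 rV_setC rV_bigcup.

Lemma measurable_coord (i : 'I_n) :
  measurable_fun [set: 'rV[R]_n] (fun x : 'rV[R]_n => x ord0 i).
Proof.
move=> _ Y mY; rewrite setTI; apply: sub_sigma_algebra => /=.
rewrite -bigcup_seq/=; exists i => /=; first by rewrite mem_index_enum.
by exists Y => //; rewrite setTI.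
Qed.

Lemma measurable_rVP d (T : measurableType d) (f : T -> 'rV[R]_n) :
  (forall i, measurable_fun [set: T] (fun t => f t ord0 i)) ->
  measurable_fun [set: T] f.
Proof.
move=> mf _ A mA; rewrite setTI.
suff: g_sigma_preimage (fun i t => coord i (f t)) `<=` (@measurable _ T).
  move=> /(_ (f @^-1` A)); apply.
  rewrite (g_sigma_preimage_comp coord f).
  by exists A => //; rewrite setTI.
apply: smallest_sub; first exact: sigma_algebra_measurable.
rewrite -bigcup_seq/= => B [i _] [C mC <-].
exact: mf.
Qed.

End measurable_rV.

Section lebesgue_measure_rV.
Context (R : realType).
Local Open Scope ereal_scope.

Definition rV_cons n (z : R * 'rV[R]_n) : 'rV[R]_n.+1 := row_mx (z.1)%:M z.2.

Definition rV_uncons n (x : 'rV[R]_n.+1) : R * 'rV[R]_n :=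
  (x ord0 ord0, \row_(i < n) x ord0 (lift ord0 i)).

Lemma rV_consK n : cancel (@rV_cons n) (@rV_uncons n).
Proof.
move=> [a x]; rewrite /rV_uncons /rV_cons; congr pair.
  have -> : ord0 = lshift n (ord0 : 'I_1) by exact: val_inj.
  by rewrite (@row_mxEl _ _ 1 n) mxE eqxx.
apply/rowP => i; rewrite mxE.
have -> : lift ord0 i = rshift 1 i by exact: val_inj.
by rewrite (@row_mxEr _ _ 1 n).
Qed.

Lemma measurable_rV_cons n : measurable_fun [set: R * 'rV[R]_n] (@rV_cons n).
Proof.
apply: measurable_rVP => i.
have [j ->|j ->] := split_ordP (i : 'I_(1 + n)).
- apply: (eq_measurable_fun fst) => [z _|//].
  by rewrite /rV_cons (@row_mxEl _ _ 1 n) !mxE !ord1 eqxx mulr1n.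
- apply: (eq_measurable_fun (fun z : R * 'rV[R]_n => z.2 ord0 j)) => [z _|].
    by rewrite /rV_cons (@row_mxEr _ _ 1 n).
  apply: (@measurableT_comp _ _ _ _ _ _ (fun x : 'rV[R]_n => x ord0 j)) => //.
  exact: measurable_coord.
Qed.

Lemma measurable_rV_uncons n :
  measurable_fun [set: 'rV[R]_n.+1] (@rV_uncons n).
Proof.
apply: measurable_fun_pair; first exact: measurable_coord.
apply: measurable_rVP => i; apply: (eq_measurable_fun
  (fun x : 'rV[R]_n.+1 => x ord0 (lift ord0 i))) => [x _|].
  by rewrite mxE.
exact: measurable_coord.
Qed.

Section step.
Context (n : nat) (mu : {sigma_finite_measure set 'rV[R]_n -> \bar R}).

Definition lebesgue_rV_step : set 'rV[R]_n.+1 -> \bar R :=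
  pushforward (@lebesgue_measure R \x mu) (@rV_cons n).

Let pm : {measure set 'rV[R]_n.+1 -> \bar R} :=
  @measure_function_pushforward__canonical__measure_function_Measure
    _ _ _ _ _ (@lebesgue_measure R \x mu) _ (@measurable_rV_cons n).

Let step0 : lebesgue_rV_step set0 = 0. Proof. exact: (measure0 pm). Qed.

Let step_ge0 A : 0 <= lebesgue_rV_step A. Proof. exact: (measure_ge0 pm). Qed.

Let step_sigma_additive : semi_sigma_additive lebesgue_rV_step.
Proof. exact: (@measure_semi_sigma_additive _ _ _ pm). Qed.

HB.instance Definition _ := isMeasure.Build _ _ _ lebesgue_rV_step
  step0 step_ge0 step_sigma_additive.

Let step_sigma_finite : sigma_finite [set: 'rV[R]_n.+1] lebesgue_rV_step.
Proof.
have /sigma_finiteP[F [FT ndF Ffin]] := sigma_finiteT (@lebesgue_measure R).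
have /sigma_finiteP[G [GT ndG Gfin]] := sigma_finiteT mu.
exists (fun k => @rV_uncons n @^-1` (F k `*` G k)).
  rewrite predeqE => x; split=> // _.
  have [i _ Fi] : (\bigcup_i F i) (rV_uncons x).1 by rewrite -FT.
  have [j _ Gj] : (\bigcup_i G i) (rV_uncons x).2 by rewrite -GT.
  exists (maxn i j) => //; split.
  - by move: Fi; exact/subsetPset/ndF/leq_maxl.
  - by move: Gj; exact/subsetPset/ndG/leq_maxr.
move=> k; have [mF Foo] := Ffin k; have [mG Goo] := Gfin k; split.
  by rewrite -[X in measurable X]setTI; apply: measurable_rV_uncons => //;
    exact: measurableX.
rewrite /lebesgue_rV_step /pushforward -comp_preimage.
rewrite (_ : _ \o _ = id) ?preimage_id; last first.
  by apply/funext => z /=; rewrite rV_consK.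
by rewrite product_measure1E// lte_mul_pinfty// ge0_fin_numE.
Qed.

HB.instance Definition _ := Measure_isSigmaFinite.Build _ _ _
  lebesgue_rV_step step_sigma_finite.

End step.

Fixpoint lebesgue_rV n : {sigma_finite_measure set 'rV[R]_n -> \bar R} :=
  if n is m.+1 then lebesgue_rV_step (lebesgue_rV m)
  else dirac (0%R : 'rV[R]_0).

Lemma lebesgue_rV_box n (A : 'I_n -> set R) :
  (forall i, measurable (A i)) ->
  lebesgue_rV n [set x | forall i, A i (x ord0 i)] =
  \prod_(i < n) @lebesgue_measure R (A i).
Proof.
elim: n A => [|n IH] A mA.
  rewrite big_ord0 /= diracE mem_set//.
  by case.
set B := [set x : 'rV[R]_n | forall i, A (lift ord0 i) (x ord0 i)].
have mB : measurable B.
  have -> : B = \big[setI/setT]_(i < n)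
      ((fun x : 'rV[R]_n => x ord0 i) @^-1` A (lift ord0 i)).
    rewrite -bigcap_seq predeqE => x; split => [xA i _|xA i]; first exact: xA.
    by apply: xA; rewrite /= mem_index_enum.
  elim/big_ind: _ => [|X Y mX mY|i _]; first exact: measurableT.
    exact: measurableI.
  rewrite -[X in measurable X]setTI; exact: measurable_coord.
rewrite big_ord_recl -IH => [|i]; last exact: mA.
rewrite -(product_measure1E (@lebesgue_measure R) (lebesgue_rV n) (mA ord0) mB).
rewrite /= /lebesgue_rV_step /pushforward; congr (product_measure1 _ _ _).
rewrite predeqE => z.
have [z1 z2] : rV_cons z ord0 ord0 = z.1 /\
    forall i, rV_cons z ord0 (lift ord0 i) = z.2 ord0 i.
  split=> [|i]; first by rewrite -[z in RHS]rV_consK.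
  by rewrite -[z in RHS]rV_consK [RHS]mxE.
split=> [H|[Hz1 Hz2] i].
  by split=> [|i]; [rewrite -z1; exact: H|rewrite -z2; exact: H].
by have [j ->|->] := unliftP ord0 i; [rewrite z2; exact: Hz2|rewrite z1].
Qed.

End lebesgue_measure_rV.

Section bessel_potential_spaces.
Context (R : realType) (n : nat).
Local Notation E := 'rV[R]_n.
Local Notation C := R[i].
Local Notation mu := (lebesgue_rV R n).
Implicit Types (f g phi : E -> C) (x xi : E) (s p : R).

Definition dotprod x xi : R := \sum_(i < n) x ord0 i * xi ord0 i.

Definition euclid_norm x : R := Num.sqrt (dotprod x x).

Definition cintegral f : C :=
  (\int[mu]_x complex.Re (f x)) +i* (\int[mu]_x complex.Im (f x)).

(* Iterated partial derivatives, indexed by the list of the coordinates with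
   respect to which one differentiates instead of a multi-index. *)
Definition pderiv (a : seq 'I_n) (h : E -> R) : E -> R :=
  foldr (fun i k => 'D_(delta_mx ord0 i) k) h a.

Definition smooth (h : E -> R) : Prop :=
  forall a : seq 'I_n, continuous (pderiv a h) /\
    forall i x, derivable (pderiv a h) x (delta_mx ord0 i).

(* Complex-valued functions are differentiated through their real and imaginary
   parts. *)
Definition csmooth f : Prop :=
  smooth (fun x => complex.Re (f x)) /\ smooth (fun x => complex.Im (f x)).

Definition cpderiv (a : seq 'I_n) f x : C :=
  pderiv a (fun y => complex.Re (f y)) x +i*
  pderiv a (fun y => complex.Im (f y)) x.

Definition test_function : set (E -> C) :=
  [set phi | csmooth phi /\ compact (closure [set x | phi x != 0])].

(* For k = 0 and functions supported in a fixed compact set these are the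
   seminorms defining the topology of D; for arbitrary k they are those of the
   Schwartz space.  Continuity of a functional is stated as domination by one of
   them, the family being directed. *)
Definition seminorm (k m : nat) phi : \bar R :=
  ereal_sup [set r | exists a x, (size a <= m)%N /\
    r = ((1 + euclid_norm x) ^+ k * normc (cpderiv a phi x))%:E].

Definition schwartz : set (E -> C) :=
  [set phi | csmooth phi /\ forall k m, (seminorm k m phi < +oo)%E].

(* Functionals are total on [E -> C]; only their values on test functions
   (for D') or on Schwartz functions (for S') are meaningful, and every
   condition below is restricted to those. *)
Definition functional : Type := (E -> C) -> C.
Implicit Type u : functional.

Definition linear_on (A : set (E -> C)) u : Prop :=
  forall (c : C) f g, A f -> A g ->
    u (fun x => c * f x + g x) = c * u f + u g.

Definition distributions : set functional :=
  [set u | linear_on test_function u /\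
    forall K : set E, compact K -> exists (c : R) (m : nat),
      forall phi, test_function phi -> (forall x, ~ K x -> phi x = 0) ->
        ((normc (u phi))%:E <= c%:E * seminorm 0%N m phi)%E].

Definition tempered_distributions : set functional :=
  [set u | linear_on schwartz u /\
    exists (c : R) (k m : nat), forall phi, schwartz phi ->
      ((normc (u phi))%:E <= c%:E * seminorm k m phi)%E].

Definition regular_functional f : functional :=
  fun phi => cintegral (fun x => f x * phi x).

(* For a test function f and a distribution u this is defined on Schwartz
   functions as well, since then f * phi is a test function: it is the
   canonical tempered extension of the compactly supported f * u. *)
Definition fmul f u : functional := fun phi => u (fun x => f x * phi x).

Definition expi (r : R) : C := cos r +i* sin r.

(* The unitary normalisation, for which (1 + |x|^2)^(s/2) is the symbol of
   (1 - Laplacian)^(s/2).  It is extended to functionals by duality. *)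
Definition fourier phi : E -> C := fun xi =>
  ((2 * pi) `^ (- (n%:R / 2)))%:C *
  cintegral (fun x => expi (- dotprod x xi) * phi x).

Definition inv_fourier phi : E -> C := fun x =>
  ((2 * pi) `^ (- (n%:R / 2)))%:C *
  cintegral (fun xi => expi (dotprod x xi) * phi xi).

Definition fourier_functional u : functional := fun phi => u (fourier phi).

Definition inv_fourier_functional u : functional :=
  fun phi => u (inv_fourier phi).

Definition bessel_weight s : E -> C :=
  fun x => ((1 + euclid_norm x ^+ 2) `^ (s / 2))%:C.

Definition bessel_potential s u : functional :=
  inv_fourier_functional (fmul (bessel_weight s) (fourier_functional u)).

Definition Lp_norm p f : \bar R := Lnorm mu p%:E (fun x => (normc (f x))%:E).

Definition Lp p : set (E -> C) :=
  [set f | [/\ measurable_fun [set: E] (fun x => complex.Re (f x)),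
               measurable_fun [set: E] (fun x => complex.Im (f x)) &
               (Lp_norm p f < +oo)%E]].

Definition bessel_density s p u : set (E -> C) :=
  [set g | Lp p g /\
    forall phi, schwartz phi ->
      bessel_potential s u phi = regular_functional g phi].

Definition bessel_space s p : set functional :=
  [set u | tempered_distributions u /\ exists g, bessel_density s p u g].

(* Any two elements of [bessel_density s p u] agree almost everywhere, so the
   infimum is the L_p norm of any one of them; it is +oo if there is none. *)
Definition bessel_norm s p u : \bar R :=
  ereal_inf [set Lp_norm p g | g in bessel_density s p u].

Definition bessel_loc s p : set functional :=
  [set u | distributions u /\
    forall f, test_function f -> bessel_space s p (fmul f u)].

Definition cutoff (eta : E -> R) : Prop :=
  [/\ test_function (fun x => (eta x)%:C),
      forall x, 0 <= eta x <= 1,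
      forall x, euclid_norm x <= 1 -> eta x = 1 &
      forall x, 2 <= euclid_norm x -> eta x = 0].

Definition cutoff_at (eta : E -> R) (z : E) : E -> C :=
  fun x => (eta (x - z))%:C.

Definition bessel_unif (eta : E -> R) s p : set functional :=
  [set u | bessel_loc s p u /\
    (ereal_sup (range (fun z => bessel_norm s p (fmul (cutoff_at eta z) u)))
      < +oo)%E].

Definition multiplier s t : set functional :=
  [set u | bessel_loc (- t) 2 u /\
    exists2 c : R, 0 < c & forall f, test_function f ->
      (bessel_norm (- t) 2 (fmul f u) <=
       c%:E * bessel_norm s 2 (regular_functional f))%E].

Definition inverse_power (alpha : R) : E -> C :=
  fun x => (if x == 0 then 0 else euclid_norm x `^ (- alpha))%:C.

End bessel_potential_spaces.

(* Main.v *)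
(** Put m = min(s, t), M = max(s, t), p = n / M - epsilon and
    delta = (n / p - M) / 2, so that alpha = m + M + delta satisfies
    (alpha - m) p < n.

    Membership.  Writing (1 + |xi|^2)^(-m/2) as a Gamma average of the Gaussians
    exp(-tau |xi|^2) and transporting it through the Fourier transform gives
    J_{-m} u = G * u, where G is the same average of the heat kernels.  The heat
    kernel is at most C tau^(-n l/2) prod_i |v_i|^(l-1), hence so is G, for every
    l < m / n; and |x|^(-alpha) <= prod_i |x_i|^(-alpha/n).  The convolution of
    G with a localized f_alpha is thus dominated by a product of one-dimensional
    Riesz potentials of size |y_i|^(l - alpha/n), whose p-th powers are integrable
    uniformly in the localization once l is close to m / n.

    Failure of the multiplier estimate.  Test it with f = eta(k .) and pair the
    result with eta(k .) again: by Plancherel and Cauchy-Schwarz the pairing is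
    O(k^(s-n)), while the heat kernel representation of J_{-t} bounds it below by
    c k^(alpha-t-n), and alpha > s + t. *)

From HB Require Import structures.
From mathcomp Require Import all_boot all_order all_algebra.
From mathcomp Require Import all_classical all_reals all_analysis.
From mathcomp Require Import measurable_realfun.
From mathcomp Require Import complex.
From mathcomp Require Import ring lra.
Require Import Defs.

Set Implicit Arguments.
Unset Strict Implicit.
Unset Printing Implicit Defensive.

Import Order.TTheory GRing.Theory Num.Theory.
Import numFieldNormedType.Exports.
Import ComplexField.Normc.

Local Open Scope classical_set_scope.
Local Open Scope ring_scope.

(** * Lebesgue measure on row vectors *)

Section rV_measure.
Context (R : realType).
Local Open Scope ereal_scope.
Local Notation leb := (@lebesgue_measure R).

(** A density of J_{-m} u is tested against Schwartz functions, so the Bessel potential is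
    transposed onto the test function: what has to be computed is [fourier (bessel_weight (- m) *
    inv_fourier phi)], an absolutely convergent integral. Gaussians are the family whose transforms
    are computed explicitly, and damping by them also yields inversion and the Plancherel
    inequality. The measure on row vectors is an iterated product, so integrals are estimated by
    factoring the integrand over the coordinates. This dictates product majorants instead of radial
    ones, and cubes instead of balls. Nothing is lost in the exponents: with a = alpha / n in each
    coordinate and l close to m / n, the one-dimensional condition (a - l) p < 1 tends to (alpha -
    m) p < n. The price is a singularity along the coordinate hyperplanes, hence the
    almost-everywhere statements. In the negative part every factor of the pairing is nonnegative,
    so the lower bound may discard everything except a cube of side of order 1/k and heat times of
    order 1/k^2. *)

Lemma ge0_integral_lebesgue_affine (c z : R) (f : R -> \bar R) : c != 0%R ->
  measurable_fun [set: R] f -> (forall x, 0 <= f x) ->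
  \int[leb]_x f (c * x + z)%R = (`|c|^-1)%:E * \int[leb]_x f x.
Proof.
move=> c0 mf f0.
pose T : measurableTypeR R -> measurableTypeR R := fun x => (c * x + z)%R.
have mT : measurable_fun setT T.
  by apply: measurable_funD => //; apply: measurable_funM.
pose pm : {measure set (measurableTypeR R) -> \bar R} :=
  @measure_function_pushforward__canonical__measure_function_Measure
    _ _ _ _ _ leb _ mT.
have c_ge0 : (0 <= `|c|)%R by [].
pose m' : {measure set (measurableTypeR R) -> \bar R} := mscale (NngNum c_ge0) pm.
(* Agreement on half-open intervals identifies the two measures, by uniqueness of Lebesgue
   measure. *)
have E : forall X : set R, ocitv X -> leb X = m' X.
  move=> X [[a b] _ <-].
  have -> : m' [set` `]a, b]] = `|c|%:E * leb (T @^-1` [set` `]a, b]]) by [].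
  have [cp|cn] := ltP 0%R c.
    have -> : T @^-1` [set` `]a, b]] = [set` `](a - z) / c, (b - z) / c]]%R.
      apply/seteqP; split => x /=; rewrite !in_itv /= /T.
        by rewrite ltr_pdivrMr// ler_pdivlMr// ltrBlDr lerBrDr mulrC.
      by rewrite ltr_pdivrMr// ler_pdivlMr// ltrBlDr lerBrDr [(x * c)%R]mulrC.
    rewrite !lebesgue_measure_itv/= !lte_fin ltr_pM2r ?invr_gt0// ltrD2r.
    case: ifPn => _; last by rewrite mule0.
    rewrite -!EFinD -EFinM gtr0_norm//; congr EFin.
    by field; rewrite gt_eqF.
  have {}cn : (c < 0)%R by rewrite lt_neqAle c0.
  (* A negative slope exchanges the open and the closed end; the length is unaffected. *)
  have -> : T @^-1` [set` `]a, b]] = [set` `[(b - z) / c, (a - z) / c[]%R.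
    apply/seteqP; split => x /=; rewrite !in_itv /= /T.
      by rewrite ltr_ndivlMr// ler_ndivrMr// ltrBlDr lerBrDr mulrC andbC.
    by rewrite ltr_ndivlMr// ler_ndivrMr// ltrBlDr lerBrDr [(x * c)%R]mulrC andbC.
  rewrite !lebesgue_measure_itv/= !lte_fin ltr_nM2r ?invr_lt0// ltrD2r.
  case: ifPn => _; last by rewrite mule0.
  rewrite -!EFinD -EFinM ltr0_norm//; congr EFin.
  by field; rewrite lt_eqF.
have -> : \int[leb]_x f x = \int[m']_x f x.
  by apply: eq_measure_integral => A mA _; exact: (lebesgue_measure_unique E).
rewrite /m' ge0_integral_mscale//= ge0_integral_pushforward//=.
rewrite muleA -EFinM mulVf ?normr_eq0// mul1e.
by rewrite preimage_setT.
Qed.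
Local Notation mu n := (lebesgue_rV R n).

Lemma ge0_integral_rV0 (f : 'rV[R]_0 -> \bar R) : measurable_fun setT f ->
  (forall x, 0 <= f x) -> \int[mu 0]_x f x = f 0%R.
Proof. by move=> mf f0; rewrite /= integral_dirac// diracT mul1e. Qed.

Lemma ge0_integral_rVS n (f : 'rV[R]_n.+1 -> \bar R) : measurable_fun setT f ->
  (forall x, 0 <= f x) ->
  \int[mu n.+1]_x f x = \int[leb]_a \int[mu n]_y f (rV_cons (a, y)).
Proof.
move=> mf f0.
have -> : \int[mu n.+1]_x f x = \int[leb \x mu n]_z f (rV_cons z).
  have f0' : {in setT, forall y, 0 <= f y} by move=> y _.
  exact: (@ge0_integral_pushforward _ _ (measurableTypeR R * 'rV[R]_n)%type
    'rV[R]_n.+1 R (@rV_cons R n) (@measurable_rV_cons R n) (leb \x mu n)%E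
    setT f measurableT mf f0').
rewrite fubini_tonelli1//.
exact: (measurableT_comp mf (@measurable_rV_cons R n)).
Qed.

Lemma rV_cons_head n (z : R * 'rV[R]_n) : rV_cons z ord0 ord0 = z.1.
Proof. by rewrite -[z in RHS]rV_consK. Qed.

Lemma rV_cons_tail n (z : R * 'rV[R]_n) i :
  rV_cons z ord0 (lift ord0 i) = z.2 ord0 i.
Proof. by rewrite -[z in RHS]rV_consK [RHS]mxE. Qed.

Lemma measurable_rV_affine n (c : R) (z : 'rV[R]_n) :
  measurable_fun setT (fun x : 'rV[R]_n => (c *: x + z)%R).
Proof.
apply: measurable_rVP => i.
apply: (eq_measurable_fun (fun x : 'rV[R]_n => (c * x ord0 i + z ord0 i)%R)).
  by move=> x _; rewrite !mxE.
by apply: measurable_funD => //; apply: measurable_funM => //; exact: measurable_coord.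
Qed.

(** The affine map acts on head and tail separately, so induction on the dimension collects one
    factor [|c|^-1] per coordinate. Translations, reflections and dilations are all instances. *)
Lemma ge0_integral_rV_affine n (c : R) (z : 'rV[R]_n) (f : 'rV[R]_n -> \bar R) :
  c != 0%R -> measurable_fun setT f -> (forall x, 0 <= f x) ->
  \int[mu n]_x f (c *: x + z)%R = ((`|c|^-1) ^+ n)%:E * \int[mu n]_x f x.
Proof.
move=> c0; elim: n z f => [|n IH] z f mf f0.
  rewrite !ge0_integral_rV0//; last exact: (measurableT_comp mf (@measurable_rV_affine _ _ _)).
  by rewrite expr0 mul1e [(_ + z)%R]thinmx0.
have mfz := measurableT_comp mf (@measurable_rV_affine n.+1 c z).
rewrite !ge0_integral_rVS//.
pose z1 := z ord0 ord0; pose z2 := \row_(i < n) z ord0 (lift ord0 i).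
have E a y : (c *: rV_cons (a, y) + z)%R = rV_cons (c * a + z1, c *: y + z2)%R.
  apply/rowP => i; have [j ->|->] := unliftP ord0 i.
    by rewrite mxE [in LHS]mxE !rV_cons_tail/= !mxE.
  by rewrite mxE [in LHS]mxE !rV_cons_head.
under eq_integral => a _ do under eq_integral => y _ do rewrite E.
have mF : measurable_fun setT (fun p : R * 'rV[R]_n => f (rV_cons p)).
  exact: (measurableT_comp mf (@measurable_rV_cons R n)).
have mFa a : measurable_fun setT (fun y : 'rV[R]_n => f (rV_cons (a, y))).
  exact: (measurableT_comp mF (@pair1_measurable _ _ _ _ a)).
under eq_integral => a _ do rewrite (IH z2 (fun y => f (rV_cons (c * a + z1, y)%R)))//.
have mG : measurable_fun [set: R] (fun a => \int[mu n]_y f (rV_cons (a, y))).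
  exact: (@measurable_fun_fubini_tonelli_F _ _ _ _ _ (mu n) _ mF).
have G0 a : 0 <= \int[mu n]_y f (rV_cons (a, y)) by apply: integral_ge0.
pose G a := \int[mu n]_y f (rV_cons (a, y)).
rewrite (@ge0_integral_lebesgue_affine c z1 (fun a => (`|c|^-1 ^+ n)%:E * G a))//.
- rewrite (@ge0_integralZl _ _ _ leb setT measurableT G mG)//.
  - by rewrite muleA -EFinM exprS.
  - by move=> x _; exact: G0.
- exact: (@measurable_funeM _ _ R _ _ _ mG).
- by move=> x; apply: mule_ge0; [rewrite lee_fin exprn_ge0// invr_ge0|exact: G0].
Qed.
(** By Tonelli the tail integral is a constant for the head. This identity brings n-dimensional
    estimates down to the real line, which is why later bounds are sought in product form. *)
Lemma ge0_integral_rV_prod n (h : 'I_n -> R -> R) :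
  (forall i, measurable_fun [set: R] (h i)) -> (forall i r, (0 <= h i r)%R) ->
  \int[mu n]_x (\prod_(i < n) h i (x ord0 i))%:E =
  \prod_(i < n) \int[leb]_r (h i r)%:E.
Proof.
elim: n h => [|n IH] h mh h0.
  rewrite (_ : (fun x : 'rV[R]_0 => _) = cst 1); last first.
    by apply/funext => x; rewrite big_ord0.
  by rewrite ge0_integral_rV0// big_ord0.
have mH m (g : 'I_m -> R -> R) : (forall i, measurable_fun [set: R] (g i)) ->
    measurable_fun setT (fun x : 'rV[R]_m => (\prod_(i < m) g i (x ord0 i))%:E).
  move=> mg; apply/measurable_EFinP; apply: measurable_prod => i _.
  exact: (measurableT_comp (mg i) (@measurable_coord R m i)).
rewrite ge0_integral_rVS//; first last.
- by move=> x; rewrite lee_fin prodr_ge0.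
- exact: mH.
rewrite big_ord_recl -IH//.
set K := \int[mu n]_x _.
have K0 : 0 <= K by apply: integral_ge0 => x _; rewrite lee_fin prodr_ge0.
pose g : R -> \bar R := EFin \o h ord0.
have mg : measurable_fun [set: R] g by apply/measurable_EFinP; exact: mh.
transitivity (\int[leb]_a (K * g a)).
  apply: eq_integral => a _.
  under eq_integral => y _.
    rewrite big_ord_recl rV_cons_head.
    under eq_bigr do rewrite rV_cons_tail.
    rewrite EFinM; over.
  rewrite /= (@ge0_integralZl _ _ _ (mu n) setT measurableT _ (mH _ (fun i => h (lift ord0 i)) _))//.
  - by rewrite muleC.
  - by move=> x _; rewrite lee_fin prodr_ge0.
  - by rewrite lee_fin.
rewrite (@ge0_integralZl _ _ _ leb setT measurableT g mg)//.
- by rewrite muleC.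
- by move=> x _; rewrite lee_fin.
Qed.

(** The sigma-algebra is defined from the coordinates rather than from the topology, so an open set
    is exhausted by countably many cubes with rational centre and radius 1/(k+1). *)
Lemma open_measurable_rV n (U : set 'rV[R]_n) : open U -> measurable U.
Proof.
move=> oU.
pose q2R (q : 'rV[rat]_n) : 'rV[R]_n := map_mx ratr q.
pose B (p : 'rV[rat]_n * nat) : set 'rV[R]_n :=
  [set y | forall i, (`|y ord0 i - q2R p.1 ord0 i| < p.2.+1%:R^-1)%R].
have mB p : measurable (B p).
  have -> : B p = \big[setI/setT]_(i < n)
      (setT `&` (fun x : 'rV[R]_n => x ord0 i) @^-1` [set r | (`|r - q2R p.1 ord0 i| < p.2.+1%:R^-1)%R]).
    rewrite -bigcap_seq predeqE => x; split => [xA i _|xA i]; first by split => //; exact: xA.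
    by apply: (xA i _).2; rewrite /= mem_index_enum.
  elim/big_ind: _ => [|X Y mX mY|i _]; first exact: measurableT.
    exact: measurableI.
  apply: measurable_coord => //.
  rewrite (_ : [set r | _] = ball (q2R p.1 ord0 i) p.2.+1%:R^-1)%R.
    exact: measurable_ball.
  by apply/seteqP; split => r /=; rewrite /ball/= distrC.
have -> : U = \bigcup_(p in [set p | B p `<=` U]) B p.
  apply/seteqP; split => [x Ux|x [p /= pU] /pU//].
  have /nbhs_ballP[e /= e0 eU] : nbhs x U by exact: open_nbhs_nbhs.
  (* Half the radius, because the given point and the points of the cube each deviate from the
     rational centre by up to 1/(k+1). *)
  have [k] : exists k : nat, (0 + k.+1%:R^-1 < e / 2)%R.
    by apply: ltr_add_invr; rewrite divr_gt0.
  rewrite add0r => ke.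
  have k0 : (0 < k.+1%:R^-1 :> R)%R by rewrite invr_gt0.
  have qP i : exists q : rat, (`|x ord0 i - ratr q| < k.+1%:R^-1)%R.
    move: k0; move: (_^-1)%R => d d0.
    have xd : (x ord0 i - d < x ord0 i + d)%R by lra.
    have [q] := rat_in_itvoo xd.
    rewrite in_itv /= => /andP[h1 h2]; exists q; rewrite ltr_norml.
    by apply/andP; split; lra.
  have [g gP] := choice qP.
  exists (\row_i g i, k) => /=; last by move=> i; rewrite !mxE; exact: gP.
  move=> y /= Hy; apply: eU; rewrite /ball /= /mx_ball; split => // i j; rewrite ord1.
  rewrite /ball/=; have := Hy j; have := gP j; rewrite !mxE /=.
  move: ke; move: (k.+1%:R^-1)%R => d de.
  rewrite !ltr_norml => /andP[h1 h2] /andP[h3 h4]; apply/andP; split; lra.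
rewrite bigcup_mkcond; apply: countable_bigcupT_measurable => [|p]; first exact: countableP.
by case: ifP.
Qed.

Lemma continuous_measurable_rV n (f : 'rV[R]_n -> R) :
  continuous f -> measurable_fun setT f.
Proof.
move=> cf; apply: (measurability _ (RGenOInfty.measurableE R)).
move=> /= _ [_ [a ->]] <-; rewrite setTI; apply: open_measurable_rV.
by move/continuousP: cf; apply; exact: interval_open.
Qed.

End rV_measure.

(** * Complex-valued integrals *)

Section complex_norm.
Context (R : realType).
Implicit Types z w : R[i].

Lemma cReM z w : complex.Re (z * w) =
  complex.Re z * complex.Re w - complex.Im z * complex.Im w.
Proof. by case: z; case: w. Qed.

Lemma cImM z w : complex.Im (z * w) =
  complex.Re z * complex.Im w + complex.Im z * complex.Re w.
Proof. by case: z; case: w. Qed.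

Lemma cReD z w : complex.Re (z + w) = complex.Re z + complex.Re w.
Proof. by case: z; case: w. Qed.

Lemma cImD z w : complex.Im (z + w) = complex.Im z + complex.Im w.
Proof. by case: z; case: w. Qed.

Lemma complexP z w : complex.Re z = complex.Re w -> complex.Im z = complex.Im w -> z = w.
Proof. by case: z; case: w => a b c d /= -> ->. Qed.

Lemma normcE2 z : normc z = Num.sqrt (complex.Re z ^+ 2 + complex.Im z ^+ 2).
Proof. by case: z. Qed.

Lemma normc_ge0 z : 0 <= normc z.
Proof. by rewrite normcE2 sqrtr_ge0. Qed.

Lemma sqr_normcE z : normc z ^+ 2 = complex.Re z ^+ 2 + complex.Im z ^+ 2.
Proof. by rewrite normcE2 sqr_sqrtr// addr_ge0// sqr_ge0. Qed.

Lemma Re_le_normc z : `|complex.Re z| <= normc z.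
Proof. by rewrite normcE2 -sqrtr_sqr ler_wsqrtr// lerDl sqr_ge0. Qed.

Lemma Im_le_normc z : `|complex.Im z| <= normc z.
Proof. by rewrite normcE2 -sqrtr_sqr ler_wsqrtr// lerDr sqr_ge0. Qed.

Lemma normc_le_ReIm z : normc z <= `|complex.Re z| + `|complex.Im z|.
Proof.
rewrite -(@ler_pXn2r _ 2)// ?nnegrE ?normc_ge0 ?addr_ge0// sqr_normcE.
by rewrite sqrrD !real_normK ?num_real// lerD2r lerDl mulrn_wge0// mulr_ge0.
Qed.

Lemma normc_real (x : R) : normc (x%:C)%C = `|x|.
Proof. by rewrite normcE2 /= expr0n/= addr0 sqrtr_sqr. Qed.

Lemma normc_conj z : normc (z^*)%C = normc z.
Proof. by rewrite !normcE2; case: z => a b /=; rewrite sqrrN. Qed.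

Lemma mulc_conj z : z * (z^*)%C = ((normc z ^+ 2)%:C)%C.
Proof.
rewrite sqr_normcE; case: z => a b /=; apply: complexP => /=.
  by rewrite mulrN opprK -!expr2.
by rewrite mulrN mulrC addrC subrr.
Qed.

End complex_norm.

Section complex_integral.
Context d (T : measurableType d) (R : realType) (m : {measure set T -> \bar R}).
Local Open Scope ereal_scope.
Implicit Types f g : T -> R[i].

Definition cmeasurable f :=
  measurable_fun [set: T] (fun x => complex.Re (f x)) /\
  measurable_fun [set: T] (fun x => complex.Im (f x)).

Definition cintegrable f :=
  cmeasurable f /\ \int[m]_x (normc (f x))%:E < +oo.

(** Unfolds to [cintegral] when the measure is [lebesgue_rV]; the measure is general because the
    line and product spaces occur as well. *)
Definition cint f : R[i] :=
  Complex (Rintegral m setT (fun x => complex.Re (f x)))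
          (Rintegral m setT (fun x => complex.Im (f x))).

Lemma cmeasurableM f g : cmeasurable f -> cmeasurable g ->
  cmeasurable (fun x => f x * g x)%R.
Proof.
move=> [f1 f2] [g1 g2]; split.
  by under eq_fun do rewrite cReM; apply: measurable_funB; exact: measurable_funM.
by under eq_fun do rewrite cImM; apply: measurable_funD; exact: measurable_funM.
Qed.

Lemma cmeasurable_real (f : T -> R) : measurable_fun setT f ->
  cmeasurable (fun x => ((f x)%:C)%C).
Proof. by move=> mf; split => //=; exact: measurable_cst. Qed.

Lemma cmeasurable_cst (c : R[i]) : cmeasurable (fun=> c).
Proof. by split; exact: measurable_cst. Qed.

Lemma cmeasurable_conj f : cmeasurable f -> cmeasurable (fun x => ((f x)^*)%C).
Proof.
move=> [f1 f2]; split.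
  by rewrite (_ : (fun x => _) = fun x => complex.Re (f x)) //; apply/funext => x; case: (f x).
rewrite (_ : (fun x => _) = fun x => - complex.Im (f x))%R; last by apply/funext => x; case: (f x).
exact: measurableT_comp.
Qed.

Lemma cmeasurable_normc f : cmeasurable f ->
  measurable_fun setT (fun x => normc (f x)).
Proof.
move=> [f1 f2]; under eq_fun do rewrite normcE2.
apply: measurableT_comp; first exact: continuous_measurable_fun (@sqrt_continuous R).
by apply: measurable_funD; exact: measurable_funX.
Qed.

Lemma cintegrableP f : cintegrable f <->
  m.-integrable setT (fun x => (complex.Re (f x))%:E) /\
  m.-integrable setT (fun x => (complex.Im (f x))%:E).
Proof.
split.
  move=> [[f1 f2] fi]; have mn := cmeasurable_normc (conj f1 f2).
  have ni : m.-integrable setT (fun x => (normc (f x))%:E).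
    apply/integrableP; split; first exact/measurable_EFinP.
    rewrite (_ : \int[m]_x _ = \int[m]_x (normc (f x))%:E)//.
    by apply: eq_integral => x _; rewrite /= ger0_norm// normc_ge0.
  split; apply: (le_integrable _ _ _ ni) => //; try exact/measurable_EFinP.
    by move=> x _; rewrite /= lee_fin (ger0_norm (normc_ge0 _)) Re_le_normc.
  by move=> x _; rewrite /= lee_fin (ger0_norm (normc_ge0 _)) Im_le_normc.
move=> [/integrableP[f1 f1i] /integrableP[f2 f2i]].
move/measurable_EFinP : (f1) => f1'; move/measurable_EFinP : (f2) => f2'.
split; first by split.
apply: (@le_lt_trans _ _ (\int[m]_x (`|(complex.Re (f x))%:E| + `|(complex.Im (f x))%:E|))).
  apply: ge0_le_integral => //.
  - by move=> x _; rewrite lee_fin normc_ge0.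
  - exact/measurable_EFinP/cmeasurable_normc.
  - by apply: emeasurable_funD; exact: measurableT_comp.
  - by move=> x _; rewrite -EFinD lee_fin normc_le_ReIm.
rewrite ge0_integralD//; try exact: measurableT_comp.
by rewrite lte_add_pinfty.
Qed.

Lemma le_cintegrable f (h : T -> R) : cmeasurable f -> measurable_fun setT h ->
  (forall x, (normc (f x) <= h x)%R) -> \int[m]_x (h x)%:E < +oo -> cintegrable f.
Proof.
move=> mf mh fh hi; split => //; apply: le_lt_trans hi.
apply: ge0_le_integral => //.
- by move=> x _; rewrite lee_fin normc_ge0.
- exact/measurable_EFinP/cmeasurable_normc.
- exact/measurable_EFinP.
- by move=> x _; rewrite lee_fin.
Qed.

Lemma cintegrable_bounded f g (k : R) : cmeasurable f ->
  (forall x, (normc (f x) <= k)%R) -> cintegrable g ->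
  cintegrable (fun x => f x * g x)%R.
Proof.
move=> mf fk [mg gi].
have k0 (x : T) : (0 <= k)%R := le_trans (normc_ge0 _) (fk x).
apply: (@le_cintegrable _ (fun x => `|k| * normc (g x))%R).
- exact: cmeasurableM.
- by apply: measurable_funM => //; exact: cmeasurable_normc.
- move=> x; rewrite normcM; apply: ler_wpM2r; first exact: normc_ge0.
  by rewrite ger0_norm ?fk// (k0 x).
- under eq_integral do rewrite EFinM.
  rewrite ge0_integralZl//.
  + by rewrite lte_mul_pinfty// lee_fin.
  + exact/measurable_EFinP/cmeasurable_normc.
  + by move=> x _; rewrite lee_fin normc_ge0.
Qed.

Lemma cintegrableZ (c : R[i]) f : cintegrable f -> cintegrable (fun x => c * f x)%R.
Proof. by apply: cintegrable_bounded; [exact: cmeasurable_cst|move=> x; exact: lexx]. Qed.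

Lemma eq_cint f g : f =1 g -> cint f = cint g.
Proof. by move=> /funext ->. Qed.

Lemma cintD f g : cintegrable f -> cintegrable g ->
  cint (fun x => f x + g x)%R = (cint f + cint g)%R.
Proof.
move=> /cintegrableP[f1 f2] /cintegrableP[g1 g2]; apply: complexP => /=.
  by under eq_Rintegral do rewrite cReD; exact: RintegralD.
by under eq_Rintegral do rewrite cImD; exact: RintegralD.
Qed.

Lemma cintZ (c : R[i]) f : cintegrable f -> cint (fun x => c * f x)%R = (c * cint f)%R.
Proof.
move=> /cintegrableP[f1 f2].
have iZ (a : R) (h : T -> R) : m.-integrable setT (EFin \o h) ->
    m.-integrable setT (EFin \o (fun x => a * h x)%R).
  by move=> ih; exact: (integrableZl measurableT a ih).
apply: complexP => /=.
  under eq_Rintegral do rewrite cReM.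
  rewrite RintegralB ?RintegralZl//=; [by rewrite cReM|exact: iZ|exact: iZ].
under eq_Rintegral do rewrite cImM.
rewrite RintegralD ?RintegralZl//=; [by rewrite cImM|exact: iZ|exact: iZ].
Qed.

Lemma cint_real (h : T -> R) : cint (fun x => ((h x)%:C)%C) = ((Rintegral m setT h)%:C)%C.
Proof.
apply: complexP => //=; rewrite /Rintegral (_ : (fun _ => _) = cst 0) ?integral0//.
Qed.

Lemma le_normc_cint f : cintegrable f ->
  (normc (cint f))%:E <= \int[m]_x (normc (f x))%:E.
Proof.
move=> fi; have [f1 f2] := (cintegrableP f).1 fi.
have [mf fb] := fi.
have ni : m.-integrable setT (fun x => (normc (f x))%:E).
  apply/integrableP; split; first exact/measurable_EFinP/cmeasurable_normc.
  rewrite (_ : \int[m]_x _ = \int[m]_x (normc (f x))%:E)//.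
  by apply: eq_integral => x _; rewrite /= ger0_norm// normc_ge0.
set z := cint f; pose N := Rintegral m setT (fun x => normc (f x)).
have NE : (N%:E = \int[m]_x (normc (f x))%:E).
  by rewrite /N /Rintegral fineK// (integrable_fin_num _ ni).
rewrite -NE lee_fin.
have [->|z0] := eqVneq (normc z) 0%R.
  by apply: Rintegral_ge0 => x _; exact: normc_ge0.
have zp : (0 < normc z)%R by rewrite lt_neqAle eq_sym z0 normc_ge0.
have iZ (a : R) (h : T -> R) : m.-integrable setT (EFin \o h) ->
    m.-integrable setT (EFin \o (fun x => a * h x)%R).
  by move=> ih; exact: (integrableZl measurableT a ih).
(* rotate so that the integral becomes a nonnegative real *)
rewrite -(ler_pM2l zp) -expr2 sqr_normcE.
have -> : (complex.Re z ^+ 2 + complex.Im z ^+ 2)%R = Rintegral m setT (fun x =>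
    complex.Re z * complex.Re (f x) + complex.Im z * complex.Im (f x))%R.
  by rewrite RintegralD//; [rewrite !RintegralZl|exact: iZ|exact: iZ].
rewrite -RintegralZl//; apply: le_Rintegral => //.
- exact: (integrableD measurableT (iZ _ _ f1) (iZ _ _ f2)).
- exact: iZ.
- move=> x _; apply: (le_trans (ler_norm _)).
  rewrite -(@ler_pXn2r _ 2)// ?nnegrE ?mulr_ge0 ?normc_ge0//.
  rewrite real_normK ?num_real// exprMn !sqr_normcE -subr_ge0.
  set a := complex.Re z; set b := complex.Im z; set p := complex.Re _; set q := complex.Im _.
  (* Lagrange's identity in the plane: the defect in the Cauchy-Schwarz inequality is a square. *)
  have -> : ((a ^+ 2 + b ^+ 2) * (p ^+ 2 + q ^+ 2) - (a * p + b * q) ^+ 2 =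
             (a * q - b * p) ^+ 2)%R by ring.
  exact: sqr_ge0.
Qed.

End complex_integral.

(** * Fubini's theorem for real and complex integrals *)

Section Rintegral_fubini.
Context d1 d2 (T1 : measurableType d1) (T2 : measurableType d2) (R : realType).
Context (m1 : {sigma_finite_measure set T1 -> \bar R}).
Context (m2 : {sigma_finite_measure set T2 -> \bar R}).
Local Open Scope ereal_scope.

Section real_valued.
Variable g : T1 * T2 -> R.
Hypothesis ig : (m1 \x m2).-integrable setT (EFin \o g).

Lemma measurable_Rintegral_fubini1 :
  measurable_fun setT (fun x => Rintegral m2 setT (fun y => g (x, y))).
Proof.
apply: (measurableT_comp (@fine_measurable R setT measurableT)) => //.
exact: (measurable_fubini_F ig).
Qed.

Lemma measurable_Rintegral_fubini2 :
  measurable_fun setT (fun y => Rintegral m1 setT (fun x => g (x, y))).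
Proof.
apply: (measurableT_comp (@fine_measurable R setT measurableT)) => //.
exact: (measurable_fubini_G ig).
Qed.

Lemma Rintegral_fubini1 :
  Rintegral m1 setT (fun x => Rintegral m2 setT (fun y => g (x, y))) =
  Rintegral (m1 \x m2) setT g.
Proof.
rewrite /Rintegral -(integral12_prod_meas1 ig); congr fine.
apply: ae_eq_integral => //.
- exact/measurable_EFinP/measurable_Rintegral_fubini1.
- exact: (measurable_fubini_F ig).
(* [fine] changes nothing where the section is integrable, hence almost everywhere. *)
- apply: filterS (ae_integrable1 ig) => x ix _.
  by rewrite fineK// (integrable_fin_num _ ix).
Qed.

Lemma Rintegral_fubini2 :
  Rintegral m2 setT (fun y => Rintegral m1 setT (fun x => g (x, y))) =
  Rintegral (m1 \x m2) setT g.
Proof.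
rewrite /Rintegral -(integral21_prod_meas1 ig); congr fine.
apply: ae_eq_integral => //.
- exact/measurable_EFinP/measurable_Rintegral_fubini2.
- exact: (measurable_fubini_G ig).
- apply: filterS (ae_integrable2 ig) => y iy _.
  by rewrite fineK// (integrable_fin_num _ iy).
Qed.

End real_valued.

Variable f : T1 * T2 -> R[i].
Hypothesis mf : cmeasurable f.
Hypothesis fi : \int[m1]_x \int[m2]_y (normc (f (x, y)))%:E < +oo.

Let nf0 z : 0 <= (normc (f z))%:E. Proof. by rewrite lee_fin normc_ge0. Qed.

Let mnf : measurable_fun setT (fun z => (normc (f z))%:E).
Proof. exact/measurable_EFinP/cmeasurable_normc. Qed.

Lemma cintegrable_prod : cintegrable (m1 \x m2)%E f.
Proof. by split => //; rewrite fubini_tonelli1. Qed.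

Let f12 := (cintegrableP (m1 \x m2)%E f).1 cintegrable_prod.

Lemma cint_fubini : cint m1 (fun x => cint m2 (fun y => f (x, y))) =
  cint m2 (fun y => cint m1 (fun x => f (x, y))).
Proof.
have [f1 f2] := f12.
apply: complexP => /=.
  by rewrite (Rintegral_fubini1 f1) (Rintegral_fubini2 f1).
by rewrite (Rintegral_fubini1 f2) (Rintegral_fubini2 f2).
Qed.

Lemma cmeasurable_cint1 : cmeasurable (fun x => cint m2 (fun y => f (x, y))).
Proof.
have [f1 f2] := f12; split; [exact: (measurable_Rintegral_fubini1 f1)|].
exact: (measurable_Rintegral_fubini1 f2).
Qed.

Lemma cmeasurable_cint2 : cmeasurable (fun y => cint m1 (fun x => f (x, y))).
Proof.
have [f1 f2] := f12; split; [exact: (measurable_Rintegral_fubini2 f1)|].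
exact: (measurable_Rintegral_fubini2 f2).
Qed.

End Rintegral_fubini.

(** * Dominated convergence for complex-valued functions *)

Section complex_dominated_convergence.
Context d (T : measurableType d) (R : realType) (m : {measure set T -> \bar R}).
Local Open Scope ereal_scope.

(** Componentwise, so that limits pass directly to the real dominated convergence theorem. *)
Definition ccvg (u : nat -> R[i]) (z : R[i]) : Prop :=
  complex.Re (u k) @[k --> \oo] --> complex.Re z /\
  complex.Im (u k) @[k --> \oo] --> complex.Im z.

Lemma ccvg_unique u z w : ccvg u z -> ccvg u w -> z = w.
Proof.
move=> [u1 u2] [v1 v2].
by apply: complexP; [exact: (cvg_unique _ u1 v1)|exact: (cvg_unique _ u2 v2)].
Qed.

Lemma ccvg_cst z : ccvg (fun=> z) z.
Proof. by split; exact: cvg_cst. Qed.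

Lemma ccvgM u v z w : ccvg u z -> ccvg v w -> ccvg (fun k => u k * v k)%R (z * w)%R.
Proof.
move=> [u1 u2] [v1 v2]; split.
  rewrite cReM; under eq_fun do rewrite cReM.
  by apply: cvgB; exact: cvgM.
rewrite cImM; under eq_fun do rewrite cImM.
by apply: cvgD; exact: cvgM.
Qed.

Lemma Rintegral_dominated_cvg (f_ : nat -> T -> R) (f g : T -> R) :
  (forall k, measurable_fun setT (f_ k)) -> measurable_fun setT f ->
  measurable_fun setT g -> \int[m]_x (g x)%:E < +oo ->
  (forall x, f_ k x @[k --> \oo] --> f x) ->
  (forall k x, (`|f_ k x| <= g x)%R) ->
  Rintegral m setT (f_ k) @[k --> \oo] --> Rintegral m setT f.
Proof.
move=> mf_ mf mg gi f_f fg.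
have g0 x : (0 <= g x)%R by apply: le_trans (fg 0%N x).
have ig : m.-integrable setT (EFin \o g).
  apply/integrableP; split; first exact/measurable_EFinP.
  rewrite (_ : \int[m]_x _ = \int[m]_x (g x)%:E)//.
  by apply: eq_integral => x _; rewrite /= ger0_norm.
have [||||fint _ h] := @dominated_convergence _ T R m setT measurableT
  (fun k => EFin \o f_ k) (EFin \o f) (EFin \o g) _ _ _ ig _.
- by move=> k; exact/measurable_EFinP.
- exact/measurable_EFinP.
- by apply: aeW => x _; apply: cvg_EFin; [exact: nearW|exact: f_f].
- by apply: aeW => x k _; rewrite lee_fin; exact: fg.
apply: fine_cvg; rewrite /Rintegral fineK//.
exact: (integrable_fin_num measurableT fint).
Qed.

Lemma cint_dominated_cvg (f_ : nat -> T -> R[i]) (f : T -> R[i]) (g : T -> R) :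
  (forall k, cmeasurable (f_ k)) -> cmeasurable f ->
  measurable_fun setT g -> \int[m]_x (g x)%:E < +oo ->
  (forall x, ccvg (f_ ^~ x) (f x)) ->
  (forall k x, (normc (f_ k x) <= g x)%R) ->
  ccvg (fun k => cint m (f_ k)) (cint m f).
Proof.
move=> mf_ [mf1 mf2] mg gi f_f fg; split.
  apply: (@Rintegral_dominated_cvg (fun k x => complex.Re (f_ k x)) _ g) => //.
  - by move=> k; have [] := mf_ k.
  - by move=> x; have [] := f_f x.
  - by move=> k x; apply: le_trans (fg k x); exact: Re_le_normc.
apply: (@Rintegral_dominated_cvg (fun k x => complex.Im (f_ k x)) _ g) => //.
- by move=> k; have [] := mf_ k.
- by move=> x; have [] := f_f x.
- by move=> k x; apply: le_trans (fg k x); exact: Im_le_normc.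
Qed.

End complex_dominated_convergence.

(** * Complex integrals over row vectors *)

Section rV_complex_integral.
Context (R : realType).
Local Open Scope ereal_scope.
Local Notation leb := (@lebesgue_measure R).
Local Notation mu n := (lebesgue_rV R n).

Lemma Rintegral_rV_affine n (c : R) (z : 'rV[R]_n) (h : 'rV[R]_n -> R) :
  c != 0%R -> (mu n).-integrable setT (EFin \o h) ->
  Rintegral (mu n) setT (fun x => h (c *: x + z)%R) =
  (`|c|^-1 ^+ n * Rintegral (mu n) setT h)%R.
Proof.
move=> c0 ih; have mh := measurable_int _ ih.
rewrite /Rintegral integralE [in RHS]integralE.
have pE : (EFin \o (fun x => h (c *: x + z)%R))^\+ = fun x => (EFin \o h)^\+ (c *: x + z)%R.
  by apply/funext => x; rewrite !funeposE.
have nE : (EFin \o (fun x => h (c *: x + z)%R))^\- = fun x => (EFin \o h)^\- (c *: x + z)%R.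
  by apply/funext => x; rewrite !funenegE.
rewrite pE nE (_ : \int[mu n]_x (_^\+ (_ + _)%R) = (`|c|^-1 ^+ n)%:E * \int[mu n]_x (EFin \o h)^\+ x); last first.
  by rewrite -(ge0_integral_rV_affine z c0)//; exact: measurable_funepos.
rewrite (_ : \int[mu n]_x (_^\- (_ + _)%R) = (`|c|^-1 ^+ n)%:E * \int[mu n]_x (EFin \o h)^\- x); last first.
  by rewrite -(ge0_integral_rV_affine z c0)//; exact: measurable_funeneg.
have p1 := integrable_pos_fin_num measurableT ih.
have p2 := integrable_neg_fin_num measurableT ih.
by rewrite -(fineK p1) -(fineK p2) -!EFinM -!EFinB /= mulrBr.
Qed.

Lemma measurable_comp_rV_affine d (U : measurableType d) n (c : R) (z : 'rV[R]_n) (f : 'rV[R]_n -> U) :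
  measurable_fun setT f -> measurable_fun setT (fun x : 'rV[R]_n => f (c *: x + z)%R).
Proof. by move=> mf; exact: (measurableT_comp mf (@measurable_rV_affine R n c z)). Qed.

Lemma cmeasurable_rV_affine n (c : R) (z : 'rV[R]_n) (f : 'rV[R]_n -> R[i]) :
  cmeasurable f -> cmeasurable (fun x : 'rV[R]_n => f (c *: x + z)%R).
Proof.
move=> [f1 f2]; split; [exact: (measurable_comp_rV_affine _ _ f1)|].
exact: (measurable_comp_rV_affine _ _ f2).
Qed.

Lemma cintegrable_rV_affine n (c : R) (z : 'rV[R]_n) (f : 'rV[R]_n -> R[i]) :
  c != 0%R -> cintegrable (mu n) f -> cintegrable (mu n) (fun x : 'rV[R]_n => f (c *: x + z)%R).
Proof.
move=> c0 [mf fi]; split; first exact: cmeasurable_rV_affine.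
rewrite (ge0_integral_rV_affine z c0 (f := fun x => (normc (f x))%:E)).
- by rewrite lte_mul_pinfty// lee_fin exprn_ge0.
- exact/measurable_EFinP/cmeasurable_normc.
- by move=> x; rewrite lee_fin normc_ge0.
Qed.

Lemma cint_rV_affine n (c : R) (z : 'rV[R]_n) (f : 'rV[R]_n -> R[i]) :
  c != 0%R -> cintegrable (mu n) f ->
  cint (mu n) (fun x : 'rV[R]_n => f (c *: x + z)%R) = ((`|c|^-1 ^+ n)%:C%C * cint (mu n) f)%R.
Proof.
move=> c0 /cintegrableP[f1 f2]; apply: complexP => /=.
  by rewrite (Rintegral_rV_affine z c0 f1) mul0r subr0.
by rewrite (Rintegral_rV_affine z c0 f2) mul0r addr0.
Qed.

Lemma cint_rVS n (f : 'rV[R]_n.+1 -> R[i]) : cintegrable (mu n.+1) f ->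
  cint (mu n.+1) f = cint leb (fun a => cint (mu n) (fun y => f (rV_cons (a, y)))).
Proof.
move=> fi.
have mcons (g : 'rV[R]_n.+1 -> \bar R) : measurable_fun setT g ->
    measurable_fun [set: measurableTypeR R * 'rV[R]_n] (fun p => g (rV_cons p)).
  by move=> mg; exact: (measurableT_comp mg (@measurable_rV_cons R n)).
have E (g : 'rV[R]_n.+1 -> R) : (mu n.+1).-integrable setT (EFin \o g) ->
    Rintegral (mu n.+1) setT g =
    Rintegral leb setT (fun a => Rintegral (mu n) setT (fun y => g (rV_cons (a, y)))).
  move=> ig; have mg := (measurable_EFinP _ _).1 (measurable_int _ ig).
  have ig' : (leb \x mu n).-integrable setT (EFin \o (fun p => g (rV_cons p))).
    apply/integrable12ltyP; first exact: (mcons _ (measurable_int _ ig)).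
    rewrite -(ge0_integral_rVS (f := fun x => `|(g x)%:E|))//; first by case/integrableP: ig.
    by apply: measurableT_comp => //; exact/measurable_EFinP.
  rewrite (Rintegral_fubini1 ig') /Rintegral; congr fine.
  rewrite /= /lebesgue_rV_step.
  exact: (@integral_pushforward _ _ (measurableTypeR R * 'rV[R]_n)%type
    'rV[R]_n.+1 R (@rV_cons R n) (@measurable_rV_cons R n) (leb \x mu n)%E
    setT (EFin \o g) (measurable_int _ ig) ig' measurableT).
have [f1 f2] := (cintegrableP _ _).1 fi.
by apply: complexP => /=; rewrite E.
Qed.

Lemma cmeasurable_prod d (T : measurableType d) (I : Type) (s : seq I) (h : I -> T -> R[i]) :
  (forall i, cmeasurable (h i)) -> cmeasurable (fun x => \prod_(i <- s) h i x)%R.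
Proof.
move=> mh; elim: s => [|i s IH].
  by under eq_fun do rewrite big_nil; exact: cmeasurable_cst.
by under eq_fun do rewrite big_cons; exact: cmeasurableM.
Qed.

Lemma normc_prod (I : Type) (s : seq I) (h : I -> R[i]) :
  normc (\prod_(i <- s) h i)%R = (\prod_(i <- s) normc (h i))%R.
Proof. by elim/big_rec2: _ => [|i x y _ <-]; rewrite ?normc1// normcM. Qed.

Lemma lty_prode (I : Type) (s : seq I) (e : I -> \bar R) :
  (forall i, 0 <= e i) -> (forall i, e i < +oo) -> \prod_(i <- s) e i < +oo.
Proof.
move=> e0 ey; suff : \prod_(i <- s) e i \is a fin_num by rewrite ltey_eq => ->.
elim/big_rec: _ => // i x _ xf; rewrite fin_numM//.
by rewrite ge0_fin_numE.
Qed.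

Lemma cmeasurable_coord n (i : 'I_n) (h : R -> R[i]) : @cmeasurable _ R R h ->
  cmeasurable (fun x : 'rV[R]_n => h (x ord0 i)).
Proof.
move=> [h1 h2]; split; [exact: (measurableT_comp h1 (@measurable_coord R n i))|].
exact: (measurableT_comp h2 (@measurable_coord R n i)).
Qed.

Lemma cintegrable_rV_prod n (h : 'I_n -> R -> R[i]) :
  (forall i, cintegrable leb (h i)) ->
  cintegrable (mu n) (fun x => \prod_(i < n) h i (x ord0 i))%R.
Proof.
move=> ih; split.
  by apply: cmeasurable_prod => i; apply: cmeasurable_coord; have [] := ih i.
under eq_integral do rewrite normc_prod.
rewrite (ge0_integral_rV_prod (h := fun i r => normc (h i r))).
- apply: lty_prode => i; last by have [] := ih i.
  by apply: integral_ge0 => r _; rewrite lee_fin normc_ge0.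
- by move=> i; have [mi _] := ih i; exact: (cmeasurable_normc mi).
- by move=> i r; exact: normc_ge0.
Qed.

Lemma cint_rV_prod n (h : 'I_n -> R -> R[i]) :
  (forall i, cintegrable leb (h i)) ->
  cint (mu n) (fun x => \prod_(i < n) h i (x ord0 i))%R = (\prod_(i < n) cint leb (h i))%R.
Proof.
elim: n h => [|n IH] h ih.
  rewrite big_ord0; under eq_cint do rewrite big_ord0.
  apply: complexP => /=.
    by rewrite /Rintegral (@ge0_integral_rV0 R (cst 1)).
  by rewrite /Rintegral integral0.
rewrite cint_rVS; last exact: cintegrable_rV_prod.
rewrite big_ord_recl -IH => [|i]; last exact: ih.
set K := cint (mu n) _.
transitivity (cint leb (fun a => K * h ord0 a)%R); last by rewrite cintZ// mulrC.
apply: eq_cint => a.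
have iP : cintegrable (mu n) (fun y => \prod_(i < n) h (lift ord0 i) (y ord0 i))%R.
  by apply: (cintegrable_rV_prod (h := fun i => h (lift ord0 i))) => i; exact: ih.
rewrite mulrC -(cintZ _ iP); apply: eq_cint => y.
rewrite big_ord_recl rV_cons_head.
by under eq_bigr do rewrite rV_cons_tail.
Qed.

End rV_complex_integral.

(** * Tensor products and partial integrals *)

Section tensor.
Context d1 d2 (T1 : measurableType d1) (T2 : measurableType d2) (R : realType).
Context (m1 : {sigma_finite_measure set T1 -> \bar R}).
Context (m2 : {sigma_finite_measure set T2 -> \bar R}).
Local Open Scope ereal_scope.

Lemma ge0_integral_tensor (f1 : T1 -> R) (f2 : T2 -> R) :
  measurable_fun setT f1 -> measurable_fun setT f2 ->
  (forall x, (0 <= f1 x)%R) -> (forall y, (0 <= f2 y)%R) ->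
  \int[m1]_x \int[m2]_y (f1 x * f2 y)%:E = \int[m1]_x (f1 x)%:E * \int[m2]_y (f2 y)%:E.
Proof.
move=> mf1 mf2 f10 f20.
under eq_integral => x _.
  under eq_integral do rewrite EFinM.
  rewrite ge0_integralZl//; first over.
  - exact/measurable_EFinP.
  - by move=> y _; rewrite lee_fin.
  - by rewrite lee_fin.
rewrite /= ge0_integralZr//.
- exact/measurable_EFinP.
- by move=> x _; rewrite lee_fin.
- by apply: integral_ge0 => y _; rewrite lee_fin.
Qed.

Lemma cintegrable_cint1 (f : T1 * T2 -> R[i]) : cmeasurable f ->
  \int[m1]_x \int[m2]_y (normc (f (x, y)))%:E < +oo ->
  cintegrable m1 (fun x => cint m2 (fun y => f (x, y))).
Proof.
move=> mf fi; have ip := cintegrable_prod mf fi.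
have [f1 f2] := (cintegrableP (m1 \x m2)%E f).1 ip.
have H (g : T1 * T2 -> R) : (m1 \x m2).-integrable setT (EFin \o g) ->
    m1.-integrable setT (fun x => (Rintegral m2 setT (fun y => g (x, y)))%:E).
  move=> ig; have /integrableP[mg _] := ig.
  have ag := (integrable12ltyP m1 m2 mg).1 ig.
  apply/integrableP; split; first exact/measurable_EFinP/(measurable_Rintegral_fubini1 ig).
  apply: le_lt_trans ag; apply: ge0_le_integral => //.
  - apply: measurableT_comp => //.
    exact/measurable_EFinP/(measurable_Rintegral_fubini1 ig).
  - apply: (@measurable_fun_fubini_tonelli_F _ _ _ _ _ m2 (fun z => `|(EFin \o g) z|)).
      exact: measurableT_comp.
    by move=> z; exact: abse_ge0.
  - move=> x _; have mgx : measurable_fun setT (fun y => (g (x, y))%:E).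
      exact: (measurableT_comp mg (@pair1_measurable _ _ _ _ x)).
    apply: (@le_trans _ _ `|\int[m2]_y (g (x, y))%:E|); last exact: le_abse_integral.
    (* [fine] sends infinite values to 0, so it never increases the absolute value. *)
    rewrite /Rintegral; move: (\int[m2]_y _) => [r| |] /=; rewrite ?normr0 ?leey //.
by apply/cintegrableP; split; [exact: (H (fun z => complex.Re (f z)))|exact: (H (fun z => complex.Im (f z)))].
Qed.

End tensor.

(** * Gaussian integrals *)

Section invariance.
Context d (T : measurableType d) (R : realType) (m : {measure set T -> \bar R}).

(* For f r the translate of a product by r this is integration by parts. *)
Lemma Rintegral_derive_invariant (f : R -> T -> R) (G : T -> R) :
  (forall r, m.-integrable setT (EFin \o f r)) ->
  (forall r x, derivable (f ^~ x) r 1) ->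
  m.-integrable setT (EFin \o G) ->
  (forall r x, `|r| < 1 -> `|derive1 (f ^~ x) r| <= G x) ->
  (forall r, Rintegral m setT (f r) = Rintegral m setT (f 0)) ->
  Rintegral m setT (fun x => derive1 (f ^~ x) 0) = 0.
Proof.
move=> fi df iG fG fE.
have fG' r : [set` `](-1:R), 1[] r -> forall x, `|derive1 (f ^~ x) r| <= G x.
  by rewrite /= in_itv /= -ltr_norml => r1 x; exact: fG.
have G0 x : 0 <= G x.
  by apply: le_trans (fG 0 x _) => //; rewrite normr0.
have := @differentiation_under_integral R _ T m f setT measurableT 0 (-1) 1.
rewrite /= in_itv/= ltrN10 ltr01 => /(_ isT (fun r _ => fi r) (fun r x _ _ => df r x) G G0 iG).
move=> /(_ (fun r x h _ => fG' r h x)).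
rewrite (_ : (fun _ => _) = cst (Rintegral m setT (f 0))); last exact/funext.
by rewrite derive1_cst => <-.
Qed.

(** Positive and negative parts transfer the scaling rule from nonnegative to integrable functions.
    It is applied to a reflection and to translations. *)
Lemma Rintegral_scaled_comp (phi : T -> T) (k : R) (h : T -> R) :
  (forall f : T -> \bar R, measurable_fun setT f -> (forall x, 0 <= f x)%E ->
    (\int[m]_x f (phi x) = k%:E * \int[m]_x f x)%E) ->
  m.-integrable setT (EFin \o h) ->
  Rintegral m setT (fun x => h (phi x)) = k * Rintegral m setT h.
Proof.
move=> Hphi ih; have mh := measurable_int _ ih.
rewrite /Rintegral integralE [in RHS]integralE.
have pE : ((EFin \o (fun x => h (phi x)))^\+ = fun x => (EFin \o h)^\+ (phi x))%E.
  by apply/funext => x; rewrite !funeposE.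
have nE : ((EFin \o (fun x => h (phi x)))^\- = fun x => (EFin \o h)^\- (phi x))%E.
  by apply/funext => x; rewrite !funenegE.
rewrite pE nE Hphi//; last exact: measurable_funepos.
rewrite [X in (_ - X)%E]Hphi//; last exact: measurable_funeneg.
have p1 := integrable_pos_fin_num measurableT ih.
have p2 := integrable_neg_fin_num measurableT ih.
by rewrite -(fineK p1) -(fineK p2) -!EFinM -!EFinB /= mulrBr.
Qed.

End invariance.

Section gaussian.
Context (R : realType).
Local Notation leb := (@lebesgue_measure R).
Implicit Types tau t r s v : R.

Definition gaussian (t r : R) : R := expR (- (t * r ^+ 2)).

Lemma gaussian_ge0 t r : 0 <= gaussian t r. Proof. exact: expR_ge0. Qed.

Lemma measurable_gaussian t : measurable_fun [set: R] (gaussian t).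
Proof.
apply: measurableT_comp => //; apply: measurableT_comp => //.
by apply: measurable_funM => //; exact: measurable_funX.
Qed.

Lemma integral_gaussian tau : 0 < tau ->
  (\int[leb]_r (gaussian tau r)%:E = (Num.sqrt (pi / tau))%:E)%E.
Proof.
move=> tau0; have s0 : Num.sqrt tau != 0 by rewrite gt_eqF// sqrtr_gt0.
transitivity (\int[leb]_r (gauss_fun (Num.sqrt tau * r + 0))%:E)%E.
  apply: eq_integral => r _; congr (expR _)%:E.
  by rewrite addr0 exprMn sqr_sqrtr// ltW.
rewrite (@ge0_integral_lebesgue_affine _ _ 0 (fun r => (gauss_fun r)%:E))//; first last.
- by move=> x; rewrite lee_fin gauss_fun_ge0.
- by apply/measurable_EFinP; exact: measurable_gauss_fun.
rewrite integralT_gauss -EFinM; congr EFin.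
by rewrite ger0_norm ?sqrtr_ge0// mulrC sqrtrM ?pi_ge0// sqrtrV// ltW.
Qed.

Lemma integrable_gaussian tau : 0 < tau -> leb.-integrable setT (EFin \o gaussian tau).
Proof.
move=> tau0; apply/integrableP; split; first by apply/measurable_EFinP; exact: measurable_gaussian.
rewrite (_ : (\int[leb]_x _ = \int[leb]_r (gaussian tau r)%:E)%E).
  by rewrite integral_gaussian // ltry.
by apply: eq_integral => r _ /=; rewrite ger0_norm// gaussian_ge0.
Qed.

(** Completing the square: halving the decay rate absorbs every shift of size below 1. This is the
    uniform majorant needed to differentiate under the integral. *)
Lemma gaussian_shift tau r s : 0 < tau -> `|s| < 1 ->
  gaussian tau (r + s) <= expR tau * gaussian (tau / 2) r.
Proof.
move=> tau0 s1; rewrite /gaussian -expRD ler_expR.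
have s2 : s ^+ 2 <= 1.
  by rewrite -(expr1n _ 2) -(real_normK (num_real s)) lerXn2r ?nnegrE// ltW.
rewrite -subr_ge0.
have -> : tau + - (tau / 2 * r ^+ 2) - (- (tau * (r + s) ^+ 2)) =
  tau / 2 * (r + 2 * s) ^+ 2 + tau * (1 - s ^+ 2) by field.
have t0 := ltW tau0; apply: addr_ge0; apply: mulr_ge0 => //.
- exact: divr_ge0.
- exact: sqr_ge0.
- by rewrite subr_ge0.
Qed.

Lemma gaussian_le tau t r : t <= tau -> gaussian tau r <= gaussian t r.
Proof. by move=> h; rewrite ler_expR lerN2 ler_wpM2r// sqr_ge0. Qed.

(** One half of the Gaussian pays for the linear factor, through |r| <= 1 + r^2 and 1 + u <= exp
    u. *)
Lemma gaussian_moment tau r : 0 < tau ->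
  `|r| * gaussian tau r <= (1 + 2 / tau) * gaussian (tau / 2) r.
Proof.
move=> tau0; have t0 := ltW tau0.
have -> : gaussian tau r = gaussian (tau / 2) r * gaussian (tau / 2) r.
  by rewrite /gaussian -expRD; congr expR; field.
rewrite mulrA ler_wpM2r ?gaussian_ge0//.
rewrite /gaussian expRN ler_pdivrMr ?expR_gt0//.
apply: (@le_trans _ _ ((1 + 2 / tau) * (1 + tau / 2 * r ^+ 2))); last first.
  rewrite ler_wpM2l ?addr_ge0 ?divr_ge0//.
  by have := expR_ge1Dx (tau / 2 * r ^+ 2).
have -> : (1 + 2 / tau) * (1 + tau / 2 * r ^+ 2) = 1 + r ^+ 2 + (2 / tau + tau / 2 * r ^+ 2).
  by field; rewrite gt_eqF.
have h : `|r| <= 1 + r ^+ 2.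
  rewrite -(real_normK (num_real r)); have := sqr_ge0 (`|r| - 1); have := normr_ge0 r; nra.
rewrite (le_trans h)// lerDl; apply: addr_ge0; first exact: divr_ge0.
by apply: mulr_ge0; [exact: divr_ge0|exact: sqr_ge0].
Qed.

Lemma is_derive_gaussian tau r : is_derive r (1:R) (gaussian tau) (- (2 * tau * r) * gaussian tau r).
Proof.
rewrite /gaussian.
apply: is_derive_eq.
by rewrite /GRing.scale /=; ring.
Qed.

Lemma measurable_cosM v : measurable_fun [set: R] (fun r => cos (v * r)).
Proof.
apply: measurableT_comp; first exact: continuous_measurable_fun (@continuous_cos R).
exact: measurable_funM.
Qed.

Lemma measurable_sinM v : measurable_fun [set: R] (fun r => sin (v * r)).
Proof.
apply: measurableT_comp; first exact: continuous_measurable_fun (@continuous_sin R).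
exact: measurable_funM.
Qed.

Lemma le_integrable_gaussian tau (k : R) (h : R -> R) : 0 < tau ->
  measurable_fun [set: R] h -> (forall r, `|h r| <= k * gaussian tau r) ->
  leb.-integrable setT (EFin \o h).
Proof.
move=> tau0 mh hk.
apply: (le_integrable measurableT _ _ (integrableZl measurableT k (integrable_gaussian tau0))).
  by apply/measurable_EFinP; exact: mh.
move=> r _ /=; rewrite lee_fin (le_trans (hk r))// ler_norm//.
Qed.

Lemma integral_gaussian_sin tau v : 0 < tau ->
  Rintegral leb setT (fun r => gaussian tau r * sin (v * r)) = 0.
Proof.
move=> tau0; set h := fun r => _.
have ih : leb.-integrable setT (EFin \o h).
  apply: (@le_integrable_gaussian tau 1) => // [|r].
    by apply: measurable_funM; [exact: measurable_gaussian|exact: measurable_sinM].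
  by rewrite mul1r normrM ger0_norm ?gaussian_ge0// ler_piMr ?gaussian_ge0// ler_norml sin_le1 sin_geN1.
have := @Rintegral_scaled_comp _ _ _ leb (fun r => (-1) * r + 0) 1 h _ ih.
rewrite mul1r => H.
have opp0 (x : R) : x = - x -> x = 0 by move=> ?; lra.
apply: opp0.
rewrite -[LHS]H; last first.
  move=> f mf f0; rewrite (@ge0_integral_lebesgue_affine _ (-1) 0 f)// ?oppr_eq0 ?oner_eq0//.
  by rewrite normrN normr1 invr1.
rewrite -[in RHS]mulN1r -RintegralZl//; apply: eq_Rintegral => r _.
by rewrite /h addr0 !mulN1r mulrN sinN /gaussian sqrrN mulrN.
Qed.

Lemma is_derive_shift (F : R -> R) (r s dF : R) :
  is_derive (r + s) (1:R) F dF -> is_derive s (1:R) (fun x => F (r + x)) dF.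
Proof.
move=> h; have h2 : is_derive s (1:R) (cst r + id) (0 + 1) by exact: is_deriveD.
by have := @is_derive1_comp _ F (cst r + id) s _ _ h h2; rewrite add0r mulr1.
Qed.

Lemma is_derive_gaussian_sin tau v r : is_derive r (1:R)
  (fun r => gaussian tau r * sin (v * r))
  (v * (gaussian tau r * cos (v * r)) - 2 * tau * (r * (gaussian tau r * sin (v * r)))).
Proof.
have h1 := is_derive_gaussian tau r.
have h2 : is_derive r (1:R) (fun r : R => sin (v * r)) (v * cos (v * r)).
  by apply: is_derive_eq; rewrite /GRing.scale /=; ring.
by apply: is_derive_eq; rewrite /GRing.scale /=; ring.
Qed.

Lemma is_derive_gaussian_cos_freq tau v r : is_derive v (1:R)
  (fun v => gaussian tau r * cos (v * r)) (- (r * (gaussian tau r * sin (v * r)))).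
Proof.
have h2 : is_derive v (1:R) (fun v : R => cos (v * r)) (- sin (v * r) * r).
  by apply: is_derive_eq; rewrite /GRing.scale /=; ring.
by apply: is_derive_eq; rewrite /GRing.scale /=; ring.
Qed.

Lemma measurable_gaussian_sin tau v :
  measurable_fun [set: R] (fun r => gaussian tau r * sin (v * r)).
Proof. by apply: measurable_funM; [exact: measurable_gaussian|exact: measurable_sinM]. Qed.

Lemma measurable_gaussian_cos tau v :
  measurable_fun [set: R] (fun r => gaussian tau r * cos (v * r)).
Proof. by apply: measurable_funM; [exact: measurable_gaussian|exact: measurable_cosM]. Qed.

Lemma gaussian_sin_le tau v r : `|gaussian tau r * sin (v * r)| <= gaussian tau r.
Proof. by rewrite normrM ger0_norm ?gaussian_ge0// ler_piMr ?gaussian_ge0// ler_norml sin_le1 sin_geN1. Qed.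

Lemma gaussian_cos_le tau v r : `|gaussian tau r * cos (v * r)| <= gaussian tau r.
Proof. by rewrite normrM ger0_norm ?gaussian_ge0// ler_piMr ?gaussian_ge0// ler_norml cos_le1 cos_geN1. Qed.

Lemma moment_sin_le tau v r : 0 < tau ->
  `|r * (gaussian tau r * sin (v * r))| <= (1 + 2 / tau) * gaussian (tau / 2) r.
Proof.
move=> tau0; rewrite normrM (le_trans _ (gaussian_moment r tau0))// ler_wpM2l//.
exact: gaussian_sin_le.
Qed.

Lemma integrable_moment_sin tau v : 0 < tau ->
  leb.-integrable setT (EFin \o (fun r => r * (gaussian tau r * sin (v * r)))).
Proof.
move=> tau0; apply: (@le_integrable_gaussian (tau / 2) (1 + 2 / tau)).
- by rewrite divr_gt0.
- by apply: measurable_funM => //; exact: measurable_gaussian_sin.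
- by move=> r; exact: moment_sin_le.
Qed.

Lemma integrable_gaussian_cos tau v : 0 < tau ->
  leb.-integrable setT (EFin \o (fun r => gaussian tau r * cos (v * r))).
Proof.
move=> tau0; apply: (@le_integrable_gaussian tau 1) => // [|r].
  exact: measurable_gaussian_cos.
by rewrite mul1r gaussian_cos_le.
Qed.

Lemma integrable_gaussian_sin tau v : 0 < tau ->
  leb.-integrable setT (EFin \o (fun r => gaussian tau r * sin (v * r))).
Proof.
move=> tau0; apply: (@le_integrable_gaussian tau 1) => // [|r].
  exact: measurable_gaussian_sin.
by rewrite mul1r gaussian_sin_le.
Qed.

Lemma Rintegral_shift (h : R -> R) (s : R) : leb.-integrable setT (EFin \o h) ->
  Rintegral leb setT (fun r => h (r + s)) = Rintegral leb setT h.
Proof.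
move=> ih.
have := @Rintegral_scaled_comp _ _ _ leb (fun r => 1 * r + s) 1 h _ ih.
rewrite mul1r => <-; first by apply: eq_Rintegral => r _; rewrite mul1r.
move=> f mf f0; rewrite (@ge0_integral_lebesgue_affine _ 1 s f)// ?oner_eq0//.
by rewrite normr1 invr1.
Qed.

Lemma integrable_shift (h : R -> R) (s : R) : leb.-integrable setT (EFin \o h) ->
  leb.-integrable setT (EFin \o (fun r => h (r + s))).
Proof.
move=> /integrableP[mh hi].
have mh' : measurable_fun [set: R] h by apply/measurable_EFinP; exact: mh.
apply/integrableP; split.
  apply/measurable_EFinP; apply: (measurableT_comp mh').
  exact: measurable_funD.
apply: le_lt_trans hi; rewrite le_eqVlt; apply/orP; left; apply/eqP.
transitivity (\int[leb]_r (fun x : R => `|(h x)%:E|) (1 * r + s)%R)%E.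
  by apply: eq_integral => r _; rewrite mul1r.
rewrite (@ge0_integral_lebesgue_affine _ 1 s (fun x : R => `|(h x)%:E|)%E)// ?oner_eq0//.
  by rewrite normr1 invr1 mul1e.
by apply/measurable_EFinP; apply: measurableT_comp.
Qed.

(** Integration by parts without boundary terms: the translates of the integrand have constant
    integral, so the integral of its derivative vanishes. *)
Lemma gaussian_moment_sin_parts tau v : 0 < tau ->
  2 * tau * Rintegral leb setT (fun r => r * (gaussian tau r * sin (v * r))) =
  v * Rintegral leb setT (fun r => gaussian tau r * cos (v * r)).
Proof.
move=> tau0; have t0 := ltW tau0.
pose F r : R := gaussian tau r * sin (v * r).
pose dF r : R := v * (gaussian tau r * cos (v * r)) - 2 * tau * (r * (gaussian tau r * sin (v * r))).
have dFE s r : derive1 (fun s => F (r + s)) s = dF (r + s).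
  by rewrite derive1E; apply: derive_val; apply: is_derive_shift; exact: is_derive_gaussian_sin.
pose K : R := `|v| + 2 * tau * (1 + 2 / tau).
have K0 : 0 <= K.
  apply: addr_ge0 => //; apply: mulr_ge0; first exact: mulr_ge0.
  by rewrite addr_ge0// divr_ge0.
have dFle x : `|dF x| <= K * gaussian (tau / 2) x.
  apply: (le_trans (ler_normB _ _)); rewrite /K (mulrDl `|v|); apply: lerD.
    rewrite normrM ler_wpM2l// (le_trans (gaussian_cos_le _ _ _))//.
    by apply: gaussian_le; rewrite ler_pdivrMr//; lra.
  have t2 : 0 <= 2 * tau by exact: mulr_ge0.
  rewrite normrM (ger0_norm t2) -(mulrA (2 * tau)); apply: ler_wpM2l => //.
  exact: moment_sin_le.
have tau2 : 0 < tau / 2 by rewrite divr_gt0.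
have tau4 : 0 < tau / 2 / 2 by rewrite divr_gt0.
have iF : leb.-integrable setT (EFin \o F) := integrable_gaussian_sin v tau0.
have h : Rintegral leb setT (fun r => derive1 (fun s => F (r + s)) 0) = 0.
  apply: (@Rintegral_derive_invariant _ _ _ leb (fun s r => F (r + s))
     (fun r => K * expR (tau / 2) * gaussian (tau / 2 / 2) r)).
  - by move=> r; exact: integrable_shift.
  - by move=> s r; apply: ex_derive; apply: is_derive_shift; exact: is_derive_gaussian_sin.
  - exact: (integrableZl measurableT _ (integrable_gaussian tau4)).
  - move=> s r s1; rewrite dFE (le_trans (dFle _))// -mulrA ler_wpM2l//.
    exact: gaussian_shift.
  - by move=> s; rewrite !Rintegral_shift.
move: h; under eq_Rintegral do rewrite dFE addr0.
have i1 := integrable_gaussian_cos v tau0; have i2 := integrable_moment_sin v tau0.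
rewrite RintegralB//; first last.
- exact: (integrableZl measurableT _ i2).
- exact: (integrableZl measurableT _ i1).
rewrite !RintegralZl// => /eqP; rewrite subr_eq0 => /eqP ->//.
Qed.

(** Differentiating under the integral produces minus the first sine moment, which integration by
    parts turns back into the cosine integral: a linear differential equation in the frequency. *)
Lemma is_derive_integral_gaussian_cos tau v : 0 < tau -> is_derive v (1:R)
  (fun v => Rintegral leb setT (fun r => gaussian tau r * cos (v * r)))
  (- (v / (2 * tau)) * Rintegral leb setT (fun r => gaussian tau r * cos (v * r))).
Proof.
move=> tau0; have t0 := ltW tau0.
have tau2 : 0 < tau / 2 by rewrite divr_gt0.
pose f (v r : R) : R := gaussian tau r * cos (v * r).
have dfE x r : partial1of2 f x r = - (r * (gaussian tau r * sin (x * r))).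
  by rewrite partial1of2E; apply: derive_val; exact: is_derive_gaussian_cos_freq.
pose G r : R := (1 + 2 / tau) * gaussian (tau / 2) r.
have vI : v \in `]v - 1, v + 1[ by rewrite in_itv /= ltrBlDr ltrDl ltr01.
have H1 x : [set` `]v - 1, v + 1[] x -> leb.-integrable setT (EFin \o f x).
  by move=> _; exact: integrable_gaussian_cos.
have H2 x r : [set` `]v - 1, v + 1[] x -> [set: R] r -> derivable (f ^~ r) x 1.
  by move=> _ _; apply: ex_derive; exact: is_derive_gaussian_cos_freq.
have G0 r : 0 <= G r.
  by rewrite mulr_ge0 ?gaussian_ge0// addr_ge0// divr_ge0.
have iG : leb.-integrable setT (EFin \o G) := integrableZl measurableT _ (integrable_gaussian tau2).
have H3 x r : [set` `]v - 1, v + 1[] x -> [set: R] r -> `|partial1of2 f x r| <= G r.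
  by move=> _ _; rewrite dfE normrN; exact: moment_sin_le.
apply: DeriveDef.
  exact: (derivable_under_integral measurableT vI H1 H2 G0 iG H3).
rewrite -derive1E (differentiation_under_integral measurableT vI H1 H2 G0 iG H3).
under eq_Rintegral do rewrite dfE -mulN1r.
rewrite RintegralZl//; last exact: integrable_moment_sin.
rewrite mulN1r mulNr; congr (- _).
apply: (@mulfI _ (2 * tau)); first by rewrite mulf_neq0// gt_eqF.
rewrite gaussian_moment_sin_parts//; field; exact: lt0r_neq0.
Qed.

(** Dividing by the expected Gaussian gives a function with zero derivative; its value at frequency
    0 is the Gaussian integral. *)
Lemma integral_gaussian_cos tau v : 0 < tau ->
  Rintegral leb setT (fun r => gaussian tau r * cos (v * r)) =
  Num.sqrt (pi / tau) * expR (- (v ^+ 2 / (4 * tau))).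
Proof.
move=> tau0.
pose I (v : R) := Rintegral leb setT (fun r => gaussian tau r * cos (v * r)).
pose J (v : R) : R := I v * expR (v ^+ 2 / (4 * tau)).
have dJ x : is_derive x (1:R) J 0.
  have h1 : is_derive x (1:R) I (- (x / (2 * tau)) * I x) := is_derive_integral_gaussian_cos x tau0.
  have h2 : is_derive x (1:R) (fun x : R => expR (x ^+ 2 / (4 * tau)))
      (x / (2 * tau) * expR (x ^+ 2 / (4 * tau))).
    by apply: is_derive_eq; rewrite /GRing.scale /=; field; exact: lt0r_neq0.
  by apply: is_derive_eq; rewrite /GRing.scale /=; ring.
have := is_derive_0_is_cst v 0 dJ; rewrite /J expr0n /= mul0r expR0 mulr1 => h.
have I0 : I 0 = Num.sqrt (pi / tau).
  rewrite /I; under eq_Rintegral do rewrite mul0r cos0 mulr1.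
  by rewrite /Rintegral integral_gaussian.
by rewrite -/(I v) -I0 -h -mulrA -expRD subrr expR0 mulr1.
Qed.

Definition cgaussian tau r : R[i] := ((gaussian tau r)%:C)%C.

Lemma cintegrable_gaussian_expi tau v : 0 < tau ->
  cintegrable leb (fun r => expi (v * r) * cgaussian tau r).
Proof.
move=> tau0; apply/cintegrableP; split.
  rewrite (_ : (fun x => _) = EFin \o (fun r => gaussian tau r * cos (v * r))).
    exact: integrable_gaussian_cos.
  by apply/funext => r /=; rewrite mulr0 subr0 mulrC.
rewrite (_ : (fun x => _) = EFin \o (fun r => gaussian tau r * sin (v * r))).
  exact: integrable_gaussian_sin.
by apply/funext => r /=; rewrite mulr0 add0r mulrC.
Qed.

Lemma cint_gaussian_expi tau v : 0 < tau ->
  cint leb (fun r => expi (v * r) * cgaussian tau r) =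
  ((Num.sqrt (pi / tau) * expR (- (v ^+ 2 / (4 * tau))))%:C)%C.
Proof.
move=> tau0; apply: complexP => /=.
  rewrite -integral_gaussian_cos//; apply: eq_Rintegral => r _.
  by rewrite mulr0 subr0 mulrC.
rewrite -[RHS](integral_gaussian_sin v tau0); apply: eq_Rintegral => r _.
by rewrite mulr0 add0r mulrC.
Qed.

End gaussian.

(** * Fourier transform and heat kernel *)

Section fourier.
Context (R : realType) (n : nat).
Local Notation E := 'rV[R]_n.
Local Notation mu := (lebesgue_rV R n).
Local Notation cst_ft := ((2 * pi) `^ (- (n%:R / 2)) : R).
Implicit Types (x y v xi : E) (sg r : R).

Lemma normc_expi r : normc (expi r) = 1.
Proof. by rewrite normcE2 /= cos2Dsin2 sqrtr1. Qed.

Lemma expi0 : expi (0 : R) = 1.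
Proof. by rewrite /expi cos0 sin0. Qed.

Lemma expiD r s : expi (r + s) = expi r * expi s.
Proof. by apply: complexP => /=; rewrite ?cosD ?sinD// addrC; congr (_ + _); rewrite mulrC. Qed.

Lemma conj_expi r : ((expi r)^*)%C = expi (- r).
Proof. by rewrite /expi cosN sinN. Qed.

Lemma expi_sum (I : Type) (s : seq I) (h : I -> R) :
  expi (\sum_(i <- s) h i) = \prod_(i <- s) expi (h i).
Proof. by elim/big_rec2: _ => [|i a b _ <-]; rewrite ?expi0// expiD. Qed.

Lemma dotprodC x y : dotprod x y = dotprod y x.
Proof. by apply: eq_bigr => i _; rewrite mulrC. Qed.

Lemma dotprodDl x y v : dotprod (x + y) v = dotprod x v + dotprod y v.
Proof. by rewrite /dotprod -big_split; apply: eq_bigr => i _; rewrite mxE mulrDl. Qed.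

Lemma dotprodZl r x v : dotprod (r *: x) v = r * dotprod x v.
Proof. by rewrite /dotprod mulr_sumr; apply: eq_bigr => i _; rewrite mxE mulrA. Qed.

Lemma dotprodBl x y v : dotprod (x - y) v = dotprod x v - dotprod y v.
Proof. by rewrite dotprodDl -scaleN1r dotprodZl mulN1r. Qed.

Lemma dotprod_ge0 x : 0 <= dotprod x x.
Proof. by apply: sumr_ge0 => i _; rewrite -expr2 sqr_ge0. Qed.

Lemma sqr_euclid_norm x : euclid_norm x ^+ 2 = dotprod x x.
Proof. by rewrite sqr_sqrtr// dotprod_ge0. Qed.

Lemma measurable_dotprod d (T : measurableType d) (f g : T -> E) :
  measurable_fun setT f -> measurable_fun setT g ->
  measurable_fun setT (fun t => dotprod (f t) (g t)).
Proof.
move=> mf mg; rewrite /dotprod; apply: measurable_sum => i.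
apply: measurable_funM; first exact: (measurableT_comp (@measurable_coord R n i) mf).
exact: (measurableT_comp (@measurable_coord R n i) mg).
Qed.

Lemma cmeasurable_expi d (T : measurableType d) (h : T -> R) :
  measurable_fun setT h -> cmeasurable (fun t => expi (h t)).
Proof.
move=> mh; split => /=.
  exact: (measurableT_comp (continuous_measurable_fun (@continuous_cos R)) mh).
exact: (measurableT_comp (continuous_measurable_fun (@continuous_sin R)) mh).
Qed.

Lemma cmeasurable_comp d1 d2 (T1 : measurableType d1) (T2 : measurableType d2)
  (f : T2 -> R[i]) (g : T1 -> T2) : cmeasurable f -> measurable_fun setT g ->
  cmeasurable (fun t => f (g t)).
Proof. by move=> [f1 f2] mg; split; [exact: (measurableT_comp f1 mg)|exact: (measurableT_comp f2 mg)]. Qed.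

Lemma measurable_subrV d (T : measurableType d) (f g : T -> E) :
  measurable_fun setT f -> measurable_fun setT g ->
  measurable_fun setT (fun t => f t - g t).
Proof.
move=> mf mg; apply: measurable_rVP => i.
apply: (eq_measurable_fun (fun t => f t ord0 i - g t ord0 i)).
  by move=> t _; rewrite !mxE.
by apply: measurable_funB; [exact: (measurableT_comp (@measurable_coord R n i) mf)|
  exact: (measurableT_comp (@measurable_coord R n i) mg)].
Qed.

Definition gaussn (t : R) x : R := gaussian t (euclid_norm x).

Lemma gaussnE t x : gaussn t x = \prod_(i < n) gaussian t (x ord0 i).
Proof.
rewrite /gaussn /gaussian sqr_euclid_norm /dotprod mulr_sumr -sumrN.
by rewrite expR_sum; apply: eq_bigr => i _; rewrite expr2.
Qed.

Lemma gaussn_ge0 t x : 0 <= gaussn t x. Proof. exact: expR_ge0. Qed.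

Lemma gaussn_le1 t x : 0 <= t -> gaussn t x <= 1.
Proof. by move=> t0; rewrite -expR0 ler_expR oppr_le0 mulr_ge0// sqr_ge0. Qed.

Lemma measurable_gaussn t : measurable_fun setT (gaussn t).
Proof.
rewrite (_ : gaussn t = fun x => \prod_(i < n) gaussian t (x ord0 i)).
  apply: measurable_prod => i _.
  exact: (measurableT_comp (@measurable_gaussian R t) (@measurable_coord R n i)).
by apply/funext => x; exact: gaussnE.
Qed.

Lemma integral_gaussn (t : R) : 0 < t ->
  (\int[mu]_x (gaussn t x)%:E = (Num.sqrt (pi / t) ^+ n)%:E)%E.
Proof.
move=> t0; under eq_integral do rewrite gaussnE.
rewrite (ge0_integral_rV_prod (h := fun=> gaussian t)).
- rewrite (eq_bigr (fun=> (Num.sqrt (pi / t))%:E)); last by move=> i _; rewrite integral_gaussian.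
  by rewrite prodEFin prodr_const card_ord.
- by move=> i; exact: measurable_gaussian.
- by move=> i r; exact: gaussian_ge0.
Qed.

Lemma cint_gaussn_expi (t : R) v : 0 < t ->
  cint mu (fun xi => expi (dotprod v xi) * ((gaussn t xi)%:C)%C) =
  ((Num.sqrt (pi / t) ^+ n * gaussn (4 * t)^-1 v)%:C)%C.
Proof.
move=> t0.
transitivity (cint mu (fun xi => \prod_(i < n) (expi (v ord0 i * xi ord0 i) * cgaussian t (xi ord0 i)))).
  apply: eq_cint => xi; rewrite big_split /= -expi_sum; congr (_ * _).
  by rewrite gaussnE rmorph_prod.
rewrite (cint_rV_prod (h := fun i r => expi (v ord0 i * r) * cgaussian t r)); last first.
  by move=> i; exact: cintegrable_gaussian_expi.
under eq_bigr do rewrite cint_gaussian_expi//.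
rewrite -rmorph_prod big_split /= prodr_const card_ord gaussnE; congr ((_ * _)%:C)%C.
by apply: eq_bigr => i _; rewrite /gaussian [(4 * t)^-1 * _]mulrC.
Qed.

Definition heat (t : R) x : R := ((Num.sqrt (4 * pi * t))^-1) ^+ n * gaussn (4 * t)^-1 x.

Lemma heat_ge0 t x : 0 <= heat t x.
Proof. by rewrite mulr_ge0 ?gaussn_ge0// exprn_ge0// invr_ge0 sqrtr_ge0. Qed.

Lemma measurable_heat t : measurable_fun setT (heat t).
Proof. by apply: measurable_funM => //; exact: measurable_gaussn. Qed.

Lemma integral_heat (t : R) : 0 < t -> (\int[mu]_x (heat t x)%:E = 1)%E.
Proof.
move=> t0; have p0 := pi_gt0 R.
under eq_integral do rewrite EFinM.
rewrite ge0_integralZl//; first last.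
- by move=> x _; rewrite lee_fin gaussn_ge0.
- by apply/measurable_EFinP; exact: measurable_gaussn.
rewrite integral_gaussn ?invr_gt0 ?mulr_gt0// -EFinM -exprMn invrK.
rewrite (_ : pi * _ = 4 * pi * t); last by ring.
by rewrite mulVf ?expr1n// gt_eqF// sqrtr_gt0 !mulr_gt0.
Qed.

(** Sign -1 is [fourier] and sign 1 is [inv_fourier]. The common form proves each fact once; the
    hypothesis [sg * sg = 1] makes [- sg] the sign of the inverse transform. *)
Definition ft sg (phi : E -> R[i]) : E -> R[i] := fun xi =>
  (cst_ft%:C)%C * cint mu (fun x => expi (sg * dotprod x xi) * phi x).

Lemma fourierE phi : fourier phi = ft (-1) phi.
Proof.
apply/funext => xi; rewrite /fourier /ft; congr (_ * _).
by apply: eq_cint => x; rewrite mulN1r.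
Qed.

Lemma inv_fourierE phi : inv_fourier phi = ft 1 phi.
Proof.
apply/funext => xi; rewrite /inv_fourier /ft; congr (_ * _).
by apply: eq_cint => x; rewrite mul1r dotprodC.
Qed.

Lemma cst_ft_ge0 : 0 <= cst_ft. Proof. exact: powR_ge0. Qed.

Lemma cst_ft_sqr : cst_ft * cst_ft = ((2 * pi)^-1) ^+ n.
Proof.
have h0 : 0 < 2 * pi :> R by rewrite mulr_gt0// pi_gt0.
rewrite -powRD; last by rewrite (gt_eqF h0) implybT.
rewrite (_ : - (n%:R / 2) + - (n%:R / 2) = - n%:R :> R); last by field.
by rewrite powR_invn ?ltW// exprVn.
Qed.

Lemma ftE_le sg phi xi : cintegrable mu phi ->
  ((normc (ft sg phi xi))%:E <= cst_ft%:E * \int[mu]_x (normc (phi x))%:E)%E.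
Proof.
move=> iphi; rewrite /ft normcM normc_real (ger0_norm cst_ft_ge0) EFinM.
rewrite lee_wpmul2l ?lee_fin ?cst_ft_ge0//.
set psi := fun x => _.
have ipsi : cintegrable mu psi.
  apply: (cintegrable_bounded (k := 1)) => //; last by move=> x; rewrite normc_expi.
  apply: cmeasurable_expi; apply: measurable_funM => //.
  by apply: measurable_dotprod.
apply: (le_trans (le_normc_cint ipsi)); rewrite le_eqVlt; apply/orP; left; apply/eqP.
by apply: eq_integral => x _; rewrite /psi normcM normc_expi mul1r.
Qed.

Section tensor_expi.
Variables (sg : R) (f g : E -> R[i]).
Hypotheses (intf : cintegrable mu f) (intg : cintegrable mu g).

Let F (z : E * E) : R[i] := f z.1 * (expi (sg * dotprod z.2 z.1) * g z.2).

Lemma cmeasurable_tensor_expi : cmeasurable F.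
Proof.
apply: cmeasurableM.
  by apply: cmeasurable_comp => //; have [] := intf.
apply: cmeasurableM; last by apply: cmeasurable_comp => //; have [] := intg.
apply: cmeasurable_expi; apply: measurable_funM => //.
exact: measurable_dotprod.
Qed.

Lemma tensor_expi_lty : (\int[mu]_x \int[mu]_y (normc (F (x, y)))%:E < +oo)%E.
Proof.
have [mf fi] := intf; have [mg gi] := intg.
rewrite (eq_integral (fun x => \int[mu]_y (normc (f x) * normc (g y))%:E))%E; last first.
  move=> x _; apply: eq_integral => y _.
  by rewrite /F !normcM normc_expi mul1r.
rewrite ge0_integral_tensor//; try exact: cmeasurable_normc; try by move=> ?; exact: normc_ge0.
rewrite lte_mul_pinfty//.
  by apply: integral_ge0 => x _; rewrite lee_fin normc_ge0.
by rewrite ge0_fin_numE//; apply: integral_ge0 => x _; rewrite lee_fin normc_ge0.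
Qed.

End tensor_expi.

Lemma cintegrable_expiM sg v phi : cintegrable mu phi ->
  cintegrable mu (fun x => expi (sg * dotprod x v) * phi x).
Proof.
apply: (cintegrable_bounded (k := 1)); last by move=> x; rewrite normc_expi.
apply: cmeasurable_expi; apply: measurable_funM => //.
by apply: measurable_dotprod.
Qed.

(** Fubini with the symmetric kernel [expi]. Every transposition of a transform from one factor of a
    pairing to the other is an instance of this. *)
Lemma ft_mul sg f g : cintegrable mu f -> cintegrable mu g ->
  cint mu (fun x => f x * ft sg g x) = cint mu (fun x => ft sg f x * g x).
Proof.
move=> intf intg.
have mF := cmeasurable_tensor_expi sg intf intg; have Fi := tensor_expi_lty sg intf intg.
have mG := cmeasurable_tensor_expi sg intg intf; have Gi := tensor_expi_lty sg intg intf.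
transitivity (cst_ft%:C%C * cint mu (fun x => cint mu (fun y => f x * (expi (sg * dotprod y x) * g y)))).
  rewrite -(cintZ _ (cintegrable_cint1 mF Fi)); apply: eq_cint => x /=.
  rewrite (cintZ _ (cintegrable_expiM _ _ intg)) /ft.
  by rewrite mulrCA.
rewrite (cint_fubini mF Fi) /=.
transitivity (cst_ft%:C%C * cint mu (fun y => cint mu (fun x => g y * (expi (sg * dotprod x y) * f x)))).
  apply: (congr1 (fun z => cst_ft%:C%C * z)); apply: eq_cint => y; apply: eq_cint => x.
  by rewrite dotprodC mulrCA [in RHS]mulrCA [f x * _]mulrC.
rewrite -(cintZ _ (cintegrable_cint1 mG Gi)); apply: eq_cint => y /=.
by rewrite (cintZ _ (cintegrable_expiM _ _ intf)) /ft mulrCA mulrC.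
Qed.

Lemma Re_conj (z : R[i]) : complex.Re (z^*)%C = complex.Re z.
Proof. by case: z. Qed.

Lemma Im_conj (z : R[i]) : complex.Im (z^*)%C = - complex.Im z.
Proof. by case: z. Qed.

Lemma conjcM (z w : R[i]) : ((z * w)^*)%C = (z^*)%C * (w^*)%C.
Proof. by case: z; case: w => a b c d; apply: complexP => /=; ring. Qed.

Lemma cint_conj d (T : measurableType d) (m : {measure set T -> \bar R}) (f : T -> R[i]) :
  cintegrable m f -> cint m (fun u => ((f u)^*)%C) = ((cint m f)^*)%C.
Proof.
move=> /cintegrableP[f1 f2]; apply: complexP; rewrite ?Re_conj ?Im_conj /=.
  by apply: eq_Rintegral => x _; rewrite Re_conj.
rewrite -mulN1r -RintegralZl//; apply: eq_Rintegral => x _.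
by rewrite Im_conj mulN1r.
Qed.

Lemma ft_conj sg phi xi : cintegrable mu phi ->
  ft (- sg) (fun x => ((phi x)^*)%C) xi = ((ft sg phi xi)^*)%C.
Proof.
move=> iphi; rewrite /ft [in RHS]conjcM -(cint_conj (cintegrable_expiM _ _ iphi)).
congr (_ * _); first by apply: complexP => /=; rewrite ?oppr0.
by apply: eq_cint => x; rewrite [in RHS]conjcM conj_expi mulNr.
Qed.

Lemma cintegrable_gaussn (t : R) : 0 < t -> cintegrable mu (fun x => ((gaussn t x)%:C)%C).
Proof.
move=> t0; split; first by apply: cmeasurable_real; exact: measurable_gaussn.
under eq_integral do rewrite normc_real ger0_norm ?gaussn_ge0//.
by rewrite integral_gaussn// ltry.
Qed.

Lemma cintegrable_gaussnM t (f : E -> R[i]) (k : R) : 0 < t -> cmeasurable f ->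
  (forall x, normc (f x) <= k) -> cintegrable mu (fun x => ((gaussn t x)%:C)%C * f x).
Proof.
move=> t0 mf fk.
have ig := cintegrable_gaussn t0.
under eq_fun do rewrite mulrC.
exact: (cintegrable_bounded (k := k)).
Qed.

Lemma cmeasurable_ft sg phi : cintegrable mu phi -> cmeasurable (ft sg phi).
Proof.
move=> iphi; apply: cmeasurableM; first exact: cmeasurable_cst.
have ig := cintegrable_gaussn (@ltr01 R).
have mF := cmeasurable_tensor_expi sg ig iphi; have Fi := tensor_expi_lty sg ig iphi.
(* divide the Fubini integrand by a positive Gaussian weight *)
have h := cmeasurable_cint1 mF Fi.
have m2 : cmeasurable (fun x : E => (((gaussn 1 x)^-1)%:C)%C).
  apply: cmeasurable_real; rewrite (_ : (fun x => _) = gaussn (-1)); first exact: measurable_gaussn.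
  by apply/funext => x; rewrite /gaussn /gaussian -expRN mul1r mulN1r.
have := cmeasurableM m2 h; congr cmeasurable; apply/funext => x /=.
rewrite (cintZ _ (cintegrable_expiM _ _ iphi)) mulrA -rmorphM mulVf ?mul1r//.
by rewrite gt_eqF// expR_gt0.
Qed.

Lemma ft_bounded sg phi : cintegrable mu phi -> exists k, forall xi, normc (ft sg phi xi) <= k.
Proof.
move=> iphi; have [mphi phiy] := iphi.
pose I := (\int[mu]_x (normc (phi x))%:E)%E.
have If : I \is a fin_num.
  by rewrite ge0_fin_numE//; apply: integral_ge0 => x _; rewrite lee_fin normc_ge0.
exists (cst_ft * fine I) => xi; rewrite -lee_fin EFinM fineK//.
exact: ftE_le.
Qed.

Lemma gaussnN t x : gaussn t (- x) = gaussn t x.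
Proof.
rewrite /gaussn /euclid_norm; congr (gaussian t (Num.sqrt _)).
by apply: eq_bigr => i _; rewrite !mxE mulrNN.
Qed.

Lemma heatN t x : heat t (- x) = heat t x.
Proof. by rewrite /heat gaussnN. Qed.

Lemma heat_cst (t : R) : 0 < t ->
  cst_ft * (cst_ft * Num.sqrt (pi / t) ^+ n) = ((Num.sqrt (4 * pi * t))^-1) ^+ n.
Proof.
move=> t0; have p0 := pi_gt0 R.
rewrite mulrA cst_ft_sqr -exprMn; congr (_ ^+ n).
have p2 : 0 < 2 * pi :> R by rewrite mulr_gt0.
rewrite -[(2 * pi)^-1]ger0_norm ?invr_ge0 ?ltW// -sqrtr_sqr -sqrtrM ?sqr_ge0//.
rewrite -sqrtrV ?mulr_ge0 ?ltW//; congr Num.sqrt.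
by move: (pi : R) p0 {p2} => p p0; field; rewrite (lt0r_neq0 p0) (lt0r_neq0 t0).
Qed.

(** Transposing the transform from [phi] onto the Gaussian times a character produces a translated
    heat kernel. Gaussian damping between two transforms is therefore convolution with the heat
    kernel, the common source of inversion, Plancherel and the Bessel kernel. *)
Lemma ft_heat sg (t : R) phi x : sg * sg = 1 -> 0 < t -> cintegrable mu phi ->
  ft (- sg) (fun xi => ((gaussn t xi)%:C)%C * ft sg phi xi) x =
  cint mu (fun y => ((heat t (x - y))%:C)%C * phi y).
Proof.
move=> sg1 t0 iphi.
pose f xi := ((gaussn t xi)%:C)%C * expi (- sg * dotprod xi x).
have mexp : cmeasurable (fun xi : E => expi (- sg * dotprod xi x)).
  by apply: cmeasurable_expi; apply: measurable_funM => //; apply: measurable_dotprod.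
have jf : cintegrable mu f.
  by apply: (@cintegrable_gaussnM _ _ 1) => // xi; rewrite normc_expi.
transitivity (cst_ft%:C%C * cint mu (fun xi => f xi * ft sg phi xi)).
  rewrite [LHS]/ft; apply: (congr1 (fun z => cst_ft%:C%C * z)); apply: eq_cint => xi.
  by rewrite /f mulrA [expi _ * _]mulrC.
rewrite (ft_mul _ jf iphi).
have ftf y : ft sg f y = ((cst_ft * (Num.sqrt (pi / t) ^+ n * gaussn (4 * t)^-1 (x - y)))%:C)%C.
  rewrite /ft [RHS]rmorphM; apply: (congr1 (fun z => cst_ft%:C%C * z)).
  transitivity (cint mu (fun xi => expi (dotprod (sg *: (y - x)) xi) * ((gaussn t xi)%:C)%C)).
    apply: eq_cint => xi; rewrite /f mulrCA mulrC -expiD; congr (expi _ * _).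
    by rewrite dotprodZl dotprodBl [dotprod xi x]dotprodC [dotprod xi y]dotprodC; ring.
  rewrite cint_gaussn_expi//; congr ((_ * _)%:C)%C.
  (* The sign only reflects the argument of the Gaussian, which is even. *)
  have : sg = 1 \/ sg = -1.
    have : (sg - 1) * (sg + 1) = 0 by rewrite -subr_sqr expr1n expr2 sg1 subrr.
    move/eqP; rewrite mulf_eq0 subr_eq0 addr_eq0 => /orP[] /eqP ->; tauto.
  by move=> [->|->]; [rewrite scale1r -gaussnN opprB|rewrite scaleN1r opprB].
have jg : cintegrable mu (fun y => ft sg f y * phi y).
  have [k kP] := ft_bounded sg jf.
  by apply: (cintegrable_bounded (k := k)) => //; exact: cmeasurable_ft.
rewrite -(cintZ _ jg); apply: eq_cint => y.
rewrite ftf mulrA -rmorphM; congr (_%:C%C * _).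
by rewrite /heat -heat_cst// !mulrA.
Qed.

(** Monotone convergence: a bound uniform in k survives when the weights increase to 1. The weights
    are Gaussians for Plancherel and truncations for the integrals of powers. *)
Lemma ge0_integral_le_approx d (T : measurableType d) (m : {measure set T -> \bar R})
  (f : T -> R) (w : nat -> T -> R) (B : \bar R) :
  measurable_fun setT f -> (forall z, 0 <= f z) ->
  (forall k, measurable_fun setT (w k)) -> (forall k z, 0 <= w k z) ->
  (forall z, nondecreasing_seq (w ^~ z)) -> (forall z, w k z @[k --> \oo] --> (1:R)) ->
  (forall k, (\int[m]_z (w k z * f z)%:E <= B)%E) -> (\int[m]_z (f z)%:E <= B)%E.
Proof.
move=> mf f0 mw w0 wnd w1 wB.
have := @monotone_convergence _ _ R m setT measurableT (fun k z => (w k z * f z)%:E).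
have -> : (fun z => limn (fun k => (w k z * f z)%:E)) = (fun z => (f z)%:E).
  apply/funext => z; apply/cvg_lim => //; apply: cvg_EFin; first exact: nearW.
  by rewrite -[X in _ --> X]mul1r; apply: cvgMl; exact: w1.
move=> H; rewrite H; first last.
- by move=> z _ i j ij; rewrite lee_fin ler_wpM2r// wnd.
- by move=> k z _; rewrite lee_fin mulr_ge0.
- by move=> k; apply/measurable_EFinP; exact: measurable_funM.
apply: lime_le; last exact: nearW.
apply: ereal_nondecreasing_is_cvgn => i j ij; apply: ge0_le_integral => //.
- by move=> z _; rewrite lee_fin mulr_ge0.
- by apply/measurable_EFinP; exact: measurable_funM.
- by apply/measurable_EFinP; exact: measurable_funM.
- by move=> z _; rewrite lee_fin ler_wpM2r// wnd.
Qed.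

Lemma integral_heat_shift (t : R) x : 0 < t -> (\int[mu]_y (heat t (x - y))%:E = 1)%E.
Proof.
move=> t0; rewrite -(integral_heat t0).
transitivity (\int[mu]_y (fun y => (heat t y)%:E) ((-1) *: y + x)%R)%E.
  by apply: eq_integral => y _; rewrite scaleN1r addrC.
rewrite (@ge0_integral_rV_affine _ _ (-1) x (fun y => (heat t y)%:E)) ?oppr_eq0 ?oner_eq0//.
- by rewrite normrN normr1 invr1 expr1n mul1e.
- by apply/measurable_EFinP; exact: measurable_heat.
- by move=> y; rewrite lee_fin heat_ge0.
Qed.

Lemma integral_heat_shift2 (t : R) y : 0 < t -> (\int[mu]_x (heat t (x - y))%:E = 1)%E.
Proof.
move=> t0; rewrite -(integral_heat_shift y t0); apply: eq_integral => x _.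
by rewrite -heatN opprB.
Qed.

Lemma measurable_heat_prod (t : R) :
  measurable_fun setT (fun z : E * E => heat t (z.1 - z.2)).
Proof. by apply: (measurableT_comp (measurable_heat t)); exact: measurable_subrV. Qed.

(** Schur's test: |a(x)| |a(y)| is at most (a(x)^2 + a(y)^2) / 2, and the kernel has total mass 1 in
    either variable. *)
Lemma heat_schur (t : R) (a : E -> R) : 0 < t -> measurable_fun setT a ->
  (\int[mu]_x \int[mu]_y (`|a x| * (heat t (x - y) * `|a y|))%:E <= \int[mu]_x (a x ^+ 2)%:E)%E.
Proof.
move=> t0 ma; have mh := measurable_heat_prod t.
have mh1 x : measurable_fun setT (fun y => heat t (x - y)).
  exact: (measurableT_comp mh (@pair1_measurable _ _ _ _ x)).
have mh2 y : measurable_fun setT (fun x => heat t (x - y)).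
  exact: (measurableT_comp mh (@pair2_measurable _ _ _ _ y)).
have ma2 : measurable_fun setT (fun x => a x ^+ 2 / 2).
  by apply: measurable_funM => //; exact: measurable_funX.
have a20 x : 0 <= a x ^+ 2 / 2 by rewrite divr_ge0// sqr_ge0.
have ma1 : measurable_fun setT (fun z : E * E => a z.1 ^+ 2 / 2 * heat t (z.1 - z.2)).
  by apply: measurable_funM => //; apply: (measurableT_comp ma2).
have ma1' : measurable_fun setT (fun z : E * E => a z.2 ^+ 2 / 2 * heat t (z.1 - z.2)).
  by apply: measurable_funM => //; apply: (measurableT_comp ma2).
have P x y : 0 <= `|a x| * (heat t (x - y) * `|a y|).
  by apply: mulr_ge0 => //; apply: mulr_ge0 => //; exact: heat_ge0.
pose A1 : \bar R := (\int[mu]_x \int[mu]_y (a x ^+ 2 / 2 * heat t (x - y))%:E)%E.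
pose A2 : \bar R := (\int[mu]_x \int[mu]_y (a y ^+ 2 / 2 * heat t (x - y))%:E)%E.
have A1E : A1 = (\int[mu]_x (a x ^+ 2 / 2)%:E)%E.
  apply: eq_integral => x _; under eq_integral do rewrite EFinM.
  rewrite ge0_integralZl//; first by rewrite integral_heat_shift// mule1.
  - by apply/measurable_EFinP; exact: mh1.
  - by move=> y _; rewrite lee_fin heat_ge0.
  - by rewrite lee_fin.
have A2E : A2 = (\int[mu]_x (a x ^+ 2 / 2)%:E)%E.
  rewrite /A2 (fubini_tonelli (fun z : E * E => (a z.2 ^+ 2 / 2 * heat t (z.1 - z.2))%:E)); first last.
  - by move=> z; rewrite lee_fin mulr_ge0 ?heat_ge0.
  - exact/measurable_EFinP.
  apply: eq_integral => y _ /=; under eq_integral do rewrite EFinM.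
  rewrite ge0_integralZl//; first by rewrite integral_heat_shift2// mule1.
  - by apply/measurable_EFinP; exact: mh2.
  - by move=> x _; rewrite lee_fin heat_ge0.
  - by rewrite lee_fin.
have -> : (\int[mu]_x (a x ^+ 2)%:E = A1 + A2)%E.
  rewrite A1E A2E -ge0_integralD//.
  - by apply: eq_integral => x _; rewrite -EFinD; congr EFin; field.
  - by move=> x _; rewrite lee_fin.
  - exact/measurable_EFinP.
  - by move=> x _; rewrite lee_fin.
  - exact/measurable_EFinP.
rewrite -ge0_integralD//; first last.
- apply: (@measurable_fun_fubini_tonelli_F _ _ _ _ _ mu (fun z : E * E => (a z.2 ^+ 2 / 2 * heat t (z.1 - z.2))%:E)); first exact/measurable_EFinP.
  by move=> z; rewrite lee_fin mulr_ge0 ?heat_ge0.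
- by move=> x _; apply: integral_ge0 => y _; rewrite lee_fin mulr_ge0 ?heat_ge0.
- apply: (@measurable_fun_fubini_tonelli_F _ _ _ _ _ mu (fun z : E * E => (a z.1 ^+ 2 / 2 * heat t (z.1 - z.2))%:E)); first exact/measurable_EFinP.
  by move=> z; rewrite lee_fin mulr_ge0 ?heat_ge0.
- by move=> x _; apply: integral_ge0 => y _; rewrite lee_fin mulr_ge0 ?heat_ge0.
have mz1 x : measurable_fun setT (fun y => a x ^+ 2 / 2 * heat t (x - y)).
  exact: (measurableT_comp ma1 (@pair1_measurable _ _ _ _ x)).
have mz2 x : measurable_fun setT (fun y => a y ^+ 2 / 2 * heat t (x - y)).
  exact: (measurableT_comp ma1' (@pair1_measurable _ _ _ _ x)).
have maa : measurable_fun setT (fun z : E * E => `|a z.1| * (heat t (z.1 - z.2) * `|a z.2|)).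
  apply: measurable_funM; first by apply: measurableT_comp => //; exact: measurableT_comp ma _.
  by apply: measurable_funM => //; apply: measurableT_comp => //; exact: measurableT_comp ma _.
apply: ge0_le_integral => //.
- by move=> x _; apply: integral_ge0 => y _; rewrite lee_fin P.
- apply: (@measurable_fun_fubini_tonelli_F _ _ _ _ _ mu (fun z : E * E => (`|a z.1| * (heat t (z.1 - z.2) * `|a z.2|))%:E)); first exact/measurable_EFinP.
  by move=> z; rewrite lee_fin P.
- apply: emeasurable_funD.
    apply: (@measurable_fun_fubini_tonelli_F _ _ _ _ _ mu (fun z : E * E => (a z.1 ^+ 2 / 2 * heat t (z.1 - z.2))%:E)); first exact/measurable_EFinP.
    by move=> z; rewrite lee_fin mulr_ge0 ?heat_ge0.
  apply: (@measurable_fun_fubini_tonelli_F _ _ _ _ _ mu (fun z : E * E => (a z.2 ^+ 2 / 2 * heat t (z.1 - z.2))%:E)); first exact/measurable_EFinP.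
  by move=> z; rewrite lee_fin mulr_ge0 ?heat_ge0.
move=> x _; rewrite -ge0_integralD//; first last.
- by apply/measurable_EFinP; exact: mz2.
- by move=> y _; rewrite lee_fin mulr_ge0 ?heat_ge0.
- by apply/measurable_EFinP; exact: mz1.
- by move=> y _; rewrite lee_fin mulr_ge0 ?heat_ge0.
apply: ge0_le_integral => //.
- by move=> y _; rewrite lee_fin P.
- apply/measurable_EFinP; exact: (measurableT_comp maa (@pair1_measurable _ _ _ _ x)).
- by apply/measurable_EFinP; apply: measurable_funD; [exact: mz1|exact: mz2].
- move=> y _; rewrite -EFinD lee_fin -mulrDl mulrCA mulrC ler_wpM2r ?heat_ge0//.
  rewrite -(real_normK (num_real (a x))) -(real_normK (num_real (a y))).
  have := sqr_ge0 (`|a x| - `|a y|); nra.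
Qed.

Lemma heat_le (t : R) x : 0 < t -> heat t x <= ((Num.sqrt (4 * pi * t))^-1) ^+ n.
Proof.
move=> t0; rewrite /heat ler_piMr ?exprn_ge0 ?invr_ge0 ?sqrtr_ge0//.
by rewrite gaussn_le1// invr_ge0 mulr_ge0// ltW.
Qed.

Lemma cintegrable_heatM (t : R) x phi : 0 < t -> cintegrable mu phi ->
  cintegrable mu (fun y => ((heat t (x - y))%:C)%C * phi y).
Proof.
move=> t0; apply: (cintegrable_bounded (k := ((Num.sqrt (4 * pi * t))^-1) ^+ n)).
  apply: cmeasurable_real.
  exact: (measurableT_comp (measurable_heat_prod t) (@pair1_measurable _ _ _ _ x)).
by move=> y; rewrite normc_real ger0_norm ?heat_ge0// heat_le.
Qed.

Lemma cmeasurable_heatM (t : R) phi : cintegrable mu phi ->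
  cmeasurable (fun z : E * E => ((heat t (z.1 - z.2))%:C)%C * phi z.2).
Proof.
move=> [mphi _]; apply: cmeasurableM.
  by apply: cmeasurable_real; exact: measurable_heat_prod.
exact: (cmeasurable_comp mphi (measurable_snd)).
Qed.

Lemma gaussn_harmonic_nd x : nondecreasing_seq (fun k : nat => gaussn k.+1%:R^-1 x).
Proof.
move=> i j ij; apply: gaussian_le.
by rewrite lef_pV2 ?posrE// ler_nat.
Qed.

Lemma gaussn_harmonic_cvg x : gaussn k.+1%:R^-1 x @[k --> \oo] --> (1 : R).
Proof.
have : gaussn k.+1%:R^-1 x @[k --> \oo] --> expR (- (0 * euclid_norm x ^+ 2)).
  apply: (cvg_comp _ expR); last exact: continuous_expR.
  by apply: cvgN; apply: cvgMl; exact: cvg_harmonic.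
by rewrite mul0r oppr0 expR0.
Qed.

(* Damping by the Gaussian of parameter 1/k turns the left-hand side into a quadratic
   form in the heat kernel, bounded by Schur's test uniformly in k. *)
Lemma plancherel_le sg h : sg * sg = 1 -> cintegrable mu h ->
  (\int[mu]_x (normc (ft sg h x) ^+ 2)%:E <= \int[mu]_x (normc (h x) ^+ 2)%:E)%E.
Proof.
move=> sg1 ih; have [mh _] := ih.
have mft := cmeasurable_ft sg ih; have [K KP] := ft_bounded sg ih.
apply: (@ge0_integral_le_approx _ _ mu _ (fun k => gaussn k.+1%:R^-1)).
- by apply: measurable_funX; exact: cmeasurable_normc.
- by move=> x; exact: sqr_ge0.
- by move=> k; exact: measurable_gaussn.
- by move=> k x; exact: gaussn_ge0.
- exact: gaussn_harmonic_nd.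
- exact: gaussn_harmonic_cvg.
move=> k; set t : R := k.+1%:R^-1.
have t0 : 0 < t by rewrite invr_gt0.
have ich : cintegrable mu (fun x => ((h x)^*)%C).
  split; first exact: cmeasurable_conj.
  by under eq_integral do rewrite normc_conj; have [] := ih.
have [K' K'P] := ft_bounded (- sg) ich.
(* By conjugation [psi] is the Gaussian times the conjugate of [ft sg h], so its product with
   [ft sg h] is the damped square modulus, and [ft_mul] moves the transform onto [psi]. *)
pose psi x := ((gaussn t x)%:C)%C * ft (- sg) (fun x => ((h x)^*)%C) x.
have ipsi : cintegrable mu psi.
  by apply: (cintegrable_gaussnM (k := K')) => //; exact: cmeasurable_ft.
have sgN : - sg * - sg = 1 by rewrite mulrNN.
have E1 : cint mu (fun x => ft sg psi x * h x) =
    ((Rintegral mu setT (fun x => gaussn t x * normc (ft sg h x) ^+ 2))%:C)%C.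
  rewrite -(ft_mul _ ipsi ih) -cint_real; apply: eq_cint => x.
  rewrite /psi ft_conj// -mulrA [_^*%C * _]mulrC mulc_conj -rmorphM//.
have igr : mu.-integrable setT (fun x => (gaussn t x * normc (ft sg h x) ^+ 2)%:E).
  have /cintegrableP[+ _] : cintegrable mu (fun x => ((gaussn t x)%:C)%C * ((normc (ft sg h x) ^+ 2)%:C)%C).
    apply: (cintegrable_gaussnM (k := K ^+ 2)) => //.
      by apply: cmeasurable_real; apply: measurable_funX; exact: cmeasurable_normc.
    move=> x; rewrite normc_real ger0_norm ?sqr_ge0// lerXn2r ?nnegrE ?normc_ge0//.
    exact: le_trans (normc_ge0 _) (KP x).
  by under eq_fun do rewrite cReM /= mulr0 subr0.
have iprod : cintegrable mu (fun x => ft sg psi x * h x).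
  have [K2 K2P] := ft_bounded sg ipsi.
  by apply: (cintegrable_bounded (k := K2)) => //; exact: cmeasurable_ft.
have -> : (\int[mu]_x (gaussn t x * normc (ft sg h x) ^+ 2)%:E =
    (normc (cint mu (fun x => ft sg psi x * h x)))%:E)%E.
  rewrite E1 normc_real ger0_norm ?fineK//.
    exact: (integrable_fin_num measurableT igr).
  by apply: Rintegral_ge0 => x _; rewrite mulr_ge0 ?gaussn_ge0 ?sqr_ge0.
apply: (le_trans (le_normc_cint iprod)).
apply: le_trans (heat_schur t0 (cmeasurable_normc mh)).
have mF := cmeasurable_heatM t ich.
apply: ge0_le_integral => //.
- by move=> x _; rewrite lee_fin normc_ge0.
- by apply/measurable_EFinP; apply: cmeasurable_normc; have [] := iprod.
- apply: (@measurable_fun_fubini_tonelli_F _ _ _ _ _ mu (fun z : E * E =>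
    (`|normc (h z.1)| * (heat t (z.1 - z.2) * `|normc (h z.2)|))%:E)).
    apply/measurable_EFinP; apply: measurable_funM.
      apply: measurableT_comp => //; exact: (measurableT_comp (cmeasurable_normc mh) measurable_fst).
    apply: measurable_funM; first exact: measurable_heat_prod.
    apply: measurableT_comp => //; exact: (measurableT_comp (cmeasurable_normc mh) measurable_snd).
  by move=> z; rewrite lee_fin; apply: mulr_ge0 => //; apply: mulr_ge0 => //; exact: heat_ge0.
(* Read with the opposite sign, [ft sg psi] is a damped double transform of the conjugate of h, that
   is, a heat convolution. *)
move=> x _; rewrite normcM -[X in ft X psi]opprK (ft_heat _ sgN t0 ich).
rewrite mulrC EFinM.
under [leRHS]eq_integral do rewrite EFinM.
have mn : measurable_fun setT (fun y => (heat t (x - y) * `|normc (h y)|)%:E).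
  apply/measurable_EFinP; apply: measurable_funM.
    exact: (measurableT_comp (measurable_heat_prod t) (@pair1_measurable _ _ _ _ x)).
  by apply: measurableT_comp => //; exact: cmeasurable_normc.
have hn y : 0 <= heat t (x - y) * `|normc (h y)|.
  by apply: mulr_ge0 => //; exact: heat_ge0.
rewrite ge0_integralZl//; last by move=> y _; rewrite lee_fin; exact: hn.
rewrite (ger0_norm (normc_ge0 _)); apply: lee_wpmul2l; first by rewrite lee_fin normc_ge0.
apply: (le_trans (le_normc_cint (cintegrable_heatM x t0 ich))).
rewrite le_eqVlt; apply/orP; left; apply/eqP; apply: eq_integral => y _.
by rewrite normcM normc_real normc_conj (ger0_norm (heat_ge0 _ _)) (ger0_norm (normc_ge0 _)).
Qed.

Lemma sqr_euclid_normZ (c : R) x : euclid_norm (c *: x) ^+ 2 = c ^+ 2 * euclid_norm x ^+ 2.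
Proof. by rewrite !sqr_euclid_norm dotprodZl dotprodC dotprodZl mulrA. Qed.

Lemma heat_scale (t : R) x : 0 < t ->
  heat t (- Num.sqrt t *: x) = (Num.sqrt t)^-1 ^+ n * heat 1 x.
Proof.
move=> t0; rewrite /heat mulr1 sqrtrM ?mulr_ge0 ?pi_ge0// invfM exprMn.
rewrite [_^-1 ^+ n * _^-1 ^+ n]mulrC -mulrA; congr (_ * (_ * expR (- _))).
rewrite sqr_euclid_normZ sqrrN sqr_sqrtr ?ltW//.
by field; rewrite lt0r_neq0.
Qed.

(** The substitution y = x - sqrt(t) v freezes the kernel at time 1 and moves t into the argument of
    [phi], where continuity can be used as t tends to 0. *)
Lemma heat_conv_scale (t : R) x phi (K : R) : 0 < t -> cintegrable mu phi ->
  (forall x, normc (phi x) <= K) ->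
  cint mu (fun y => ((heat t (x - y))%:C)%C * phi y) =
  cint mu (fun v => ((heat 1 v)%:C)%C * phi (- Num.sqrt t *: v + x)).
Proof.
move=> t0 iphi phiK; have [mphi _] := iphi.
have s0 : 0 < Num.sqrt t by rewrite sqrtr_gt0.
have sn : - Num.sqrt t != 0 by rewrite oppr_eq0 gt_eqF.
have iF := cintegrable_heatM x t0 iphi.
have := cint_rV_affine x sn iF.
rewrite normrN (ger0_norm (ltW s0)) => H.
apply: (@mulfI _ (((Num.sqrt t)^-1 ^+ n)%:C)%C).
  by rewrite eq_complex /= negb_and expf_neq0// invr_neq0// gt_eqF.
apply: (etrans (esym H)).
have iheat : cintegrable mu (fun v => ((heat 1 v)%:C)%C * phi (- Num.sqrt t *: v + x)).
  under eq_fun do rewrite mulrC.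
  apply: (cintegrable_bounded (k := K)) => //.
    exact: cmeasurable_rV_affine.
  split; first by apply: cmeasurable_real; exact: measurable_heat.
  under eq_integral do rewrite normc_real ger0_norm ?heat_ge0//.
  by rewrite integral_heat// ltry.
rewrite -(cintZ _ iheat); apply: eq_cint => v.
rewrite mulrA -rmorphM -heat_scale//; congr (_%:C%C * _).
by rewrite -heatN opprB addrK.
Qed.

(** The Gaussian-damped double transform has two limits. Removing the damping by dominated
    convergence gives the undamped double transform; in the form of a heat convolution at time
    tending to 0 it gives [phi x]. *)
Lemma ft_inversion sg phi x (K : R) : sg * sg = 1 -> cintegrable mu phi ->
  cintegrable mu (ft sg phi) ->
  continuous (fun x => complex.Re (phi x)) -> continuous (fun x => complex.Im (phi x)) ->
  (forall x, normc (phi x) <= K) -> ft (- sg) (ft sg phi) x = phi x.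
Proof.
move=> sg1 iphi ift cR cI phiK; have [mphi _] := iphi.
pose t (k : nat) : R := k.+1%:R^-1.
have t0 k : 0 < t k by rewrite invr_gt0.
pose u k := ft (- sg) (fun xi => ((gaussn (t k) xi)%:C)%C * ft sg phi xi) x.
have mexp : cmeasurable (fun xi : E => expi (- sg * dotprod xi x)).
  by apply: cmeasurable_expi; apply: measurable_funM => //; apply: measurable_dotprod.
have mft := cmeasurable_ft sg iphi.
apply: (@ccvg_unique _ u).
  apply: ccvgM; first exact: ccvg_cst.
  apply: (cint_dominated_cvg (g := fun xi => normc (ft sg phi xi))).
  - move=> k; apply: cmeasurableM => //; apply: cmeasurableM => //.
    by apply: cmeasurable_real; exact: measurable_gaussn.
  - exact: cmeasurableM.
  - exact: cmeasurable_normc.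
  - by have [] := ift.
  - move=> xi; apply: ccvgM; first exact: ccvg_cst.
    rewrite -[X in ccvg _ X]mul1r; apply: ccvgM; last exact: ccvg_cst.
    by split => /=; [exact: gaussn_harmonic_cvg|exact: cvg_cst].
  - move=> k xi; rewrite normcM normc_expi mul1r normcM normc_real (ger0_norm (gaussn_ge0 _ _)).
    by apply: ler_piMl; [exact: normc_ge0|rewrite gaussn_le1// ltW].
have uE k : u k = cint mu (fun v => ((heat 1 v)%:C)%C * phi (- Num.sqrt (t k) *: v + x)).
  by rewrite -(heat_conv_scale x (t0 k) iphi phiK); exact: (ft_heat x sg1 (t0 k) iphi).
rewrite (_ : u = fun k => cint mu (fun v => ((heat 1 v)%:C)%C * phi (- Num.sqrt (t k) *: v + x))); last exact/funext.
have -> : phi x = cint mu (fun v => ((heat 1 v)%:C)%C * phi x).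
  have ih1 : cintegrable mu (fun v => ((heat 1 v)%:C)%C).
    split; first by apply: cmeasurable_real; exact: measurable_heat.
    under eq_integral do rewrite normc_real ger0_norm ?heat_ge0//.
    by rewrite integral_heat// ltry.
  under eq_cint do rewrite mulrC.
  rewrite cintZ// cint_real /Rintegral integral_heat//=.
  by rewrite mulr1.
apply: (cint_dominated_cvg (g := fun v => K * heat 1 v)).
- move=> k; apply: cmeasurableM; first by apply: cmeasurable_real; exact: measurable_heat.
  exact: cmeasurable_rV_affine.
- apply: cmeasurableM; first by apply: cmeasurable_real; exact: measurable_heat.
  exact: cmeasurable_cst.
- by apply: measurable_funM => //; exact: measurable_heat.
- under eq_integral do rewrite EFinM.
  rewrite ge0_integralZl//.
  + by rewrite integral_heat// mule1 ltry.
  + by apply/measurable_EFinP; exact: measurable_heat.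
  + by move=> v _; rewrite lee_fin heat_ge0.
  + by rewrite lee_fin (le_trans (normc_ge0 _) (phiK 0)).
- move=> v; apply: ccvgM; first exact: ccvg_cst.
  have cx : (- Num.sqrt (t k) *: v + x) @[k --> \oo] --> x.
    have : (- Num.sqrt (t k) *: v + x) @[k --> \oo] --> - Num.sqrt 0 *: v + x.
      apply: cvgD; last exact: cvg_cst.
      apply: cvgZl; apply: cvgN; apply: (cvg_comp _ Num.sqrt); last exact: sqrt_continuous.
      exact: cvg_harmonic.
    by rewrite sqrtr0 oppr0 scale0r add0r.
  by split; [exact: (cvg_comp _ _ cx (cR x))|exact: (cvg_comp _ _ cx (cI x))].
- move=> k v; rewrite normcM normc_real ger0_norm ?heat_ge0// mulrC.
  by rewrite ler_wpM2r ?heat_ge0.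
Qed.

End fourier.

(** * Schwartz functions *)

Section smooth_functions.
Context (R : realType) (n : nat).
Local Notation E := 'rV[R]_n.
Local Notation mu := (lebesgue_rV R n).
Local Notation C := R[i].
Implicit Types (h : E -> R) (phi : E -> C) (x xi : E).

Local Notation e_ i := (delta_mx ord0 i : E).

Lemma pderiv_cat (a b : seq 'I_n) h : pderiv (a ++ b) h = pderiv a (pderiv b h).
Proof. by rewrite /pderiv foldr_cat. Qed.

Lemma smooth_pderiv (b : seq 'I_n) h : smooth h -> smooth (pderiv b h).
Proof. by move=> sh a; rewrite -pderiv_cat; exact: sh. Qed.

Lemma is_derive_line h (i : 'I_n) x (s : R) :
  (forall y, derivable h y (e_ i)) ->
  is_derive s (1:R) (fun s => h (x + s *: e_ i)) ('D_(e_ i) h (x + s *: e_ i)).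
Proof.
move=> dh.
have E : (fun k : R => k^-1 *: (h (x + (k *: (1:R) + s) *: e_ i) - h (x + s *: e_ i))) =
         (fun k : R => k^-1 *: (h (k *: e_ i + (x + s *: e_ i)) - h (x + s *: e_ i))).
  apply/funext => k; congr (_ *: (h _ - _)).
  by rewrite scalerDl [k *: (1:R)]mulr1 addrCA.
apply: DeriveDef.
  by rewrite /derivable /= E; exact: dh.
by rewrite /derive /= E.
Qed.

(** An integrable weight of product form. Its inverse lies between 1 + |x|^2 and (1 + |x|)^(2n), so
    it measures polynomial decay while its integral factors over the coordinates. *)
Definition prodweight (x : E) : R := \prod_(j < n) (1 + x ord0 j ^+ 2)^-1.

Lemma prodweight_gt0 x : 0 < prodweight x.
Proof. by apply: prodr_gt0 => j _; rewrite invr_gt0 ltr_pwDl// sqr_ge0. Qed.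

Lemma measurable_oneDsqrV : measurable_fun [set: R] (fun r : R => (1 + r ^+ 2)^-1).
Proof. by apply: continuous_measurable_fun; exact: continuous_oneDsqrV. Qed.

Lemma measurable_prodweight : measurable_fun setT prodweight.
Proof.
apply: measurable_prod => j _.
exact: (measurableT_comp measurable_oneDsqrV (@measurable_coord R n j)).
Qed.

Lemma integral_oneDsqrV : (\int[@lebesgue_measure R]_r ((1 + r ^+ 2)^-1)%:E = pi%:E)%E.
Proof.
rewrite (@ge0_symfun_integralT _ (fun r => (1 + r ^+ 2)^-1)).
- rewrite (_ : [set x | _] = `[0, +oo[%classic); last first.
    by apply/seteqP; split => x/=; rewrite in_itv/= andbT.
  rewrite (_ : (\int[_]_(x in _) _ = (pi / 2)%:E)%E); last exact: integral0y_oneDsqr.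
  by rewrite -EFinM; congr EFin; rewrite mulrC divfK.
- by move=> x; rewrite invr_ge0 addr_ge0 ?sqr_ge0.
- exact: continuous_oneDsqrV.
- by move=> x /=; rewrite sqrrN.
Qed.

Lemma integral_prodweight_lty : (\int[mu]_x (prodweight x)%:E < +oo)%E.
Proof.
rewrite (ge0_integral_rV_prod (h := fun=> fun r => (1 + r ^+ 2)^-1)).
- apply: lty_prode => i; last by rewrite integral_oneDsqrV ltry.
  by rewrite integral_oneDsqrV lee_fin pi_ge0.
- by move=> i; exact: measurable_oneDsqrV.
- by move=> i r; rewrite invr_ge0 addr_ge0// sqr_ge0.
Qed.

Lemma integrable_prodweight (k : R) : mu.-integrable setT (EFin \o (fun x => k * prodweight x)).
Proof.
apply: (integrableZl measurableT k (f := EFin \o prodweight)).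
apply/integrableP; split; first by apply/measurable_EFinP; exact: measurable_prodweight.
rewrite (_ : (\int[mu]_x _ = \int[mu]_x (prodweight x)%:E)%E).
  exact: integral_prodweight_lty.
by apply: eq_integral => x _ /=; rewrite ger0_norm// ltW// prodweight_gt0.
Qed.

(** A shift of size below 1 costs only a constant, which provides the majorant for differentiating
    along a coordinate line. *)
Lemma prodweight_shift x (i : 'I_n) (s : R) : `|s| < 1 ->
  prodweight (x + s *: e_ i) <= 3 ^+ n * prodweight x.
Proof.
move=> s1.
have s2 : s ^+ 2 <= 1.
  by rewrite -(expr1n _ 2) -(real_normK (num_real s)) lerXn2r ?nnegrE// ltW.
rewrite /prodweight -[X in 3 ^+ X](card_ord n) -prodr_const -big_split /=.
apply: ler_prod => j _; rewrite invr_ge0 addr_ge0 ?sqr_ge0//= !mxE eqxx /=.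
have p1 : 0 < 1 + x ord0 j ^+ 2 by rewrite ltr_pwDl// sqr_ge0.
set y := x ord0 j + _.
have p2 : 0 < 1 + y ^+ 2 by rewrite ltr_pwDl// sqr_ge0.
rewrite -[leLHS]mul1r ler_pdivrMr// mulrAC ler_pdivlMr// mul1r.
rewrite /y; case: (j == i) => /=; last by rewrite mulr0 addr0; have := sqr_ge0 (x ord0 j); lra.
rewrite mulr1; have := sqr_ge0 (x ord0 j + 2 * s); nra.
Qed.

Definition rdecay h := exists k, forall x, `|h x| <= k * prodweight x.

Lemma rdecay_integrable h : measurable_fun setT h -> rdecay h ->
  mu.-integrable setT (EFin \o h).
Proof.
move=> mh [k hk]; apply: (le_integrable measurableT _ _ (integrable_prodweight k)).
  exact/measurable_EFinP.
by move=> x _ /=; rewrite lee_fin (le_trans (hk x))// ler_norm.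
Qed.

Lemma measurable_sinusoid (g : R -> R) (sg : R) xi : continuous g ->
  measurable_fun setT (fun x => g (sg * dotprod x xi)).
Proof.
move=> cg; apply: (measurableT_comp (continuous_measurable_fun cg)).
by apply: measurable_funM => //; apply: measurable_dotprod.
Qed.

(** Integration by parts in one coordinate, deduced from translation invariance along it. The pair
    g, g' is abstract so that cosine and sine are both instances. *)
Lemma Rintegral_pderiv_sinusoid h (i : 'I_n) (sg : R) xi (g g' : R -> R) :
  continuous h -> (forall x, derivable h x (e_ i)) -> continuous ('D_(e_ i) h) ->
  rdecay h -> rdecay ('D_(e_ i) h) ->
  (forall r, is_derive r (1:R) g (g' r)) -> continuous g -> continuous g' ->
  (forall r, `|g r| <= 1) -> (forall r, `|g' r| <= 1) ->
  Rintegral mu setT (fun x => 'D_(e_ i) h x * g (sg * dotprod x xi)) =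
  - (sg * xi ord0 i) * Rintegral mu setT (fun x => h x * g' (sg * dotprod x xi)).
Proof.
move=> ch dh cdh [k hk] [k' hk'] dg cg cg' g1 g1'.
have mh := continuous_measurable_rV ch; have mdh := continuous_measurable_rV cdh.
pose c := sg * xi ord0 i.
pose F x := h x * g (sg * dotprod x xi).
pose dF x := 'D_(e_ i) h x * g (sg * dotprod x xi) + c * (h x * g' (sg * dotprod x xi)).
have dotE x s : sg * dotprod (x + s *: e_ i) xi = sg * dotprod x xi + s * c.
  rewrite dotprodDl dotprodZl mulrDr /c; congr (_ + _).
  rewrite /dotprod (bigD1 i)//= big1 ?addr0; last first.
    by move=> j ji; rewrite mxE (negbTE ji) andbF mul0r.
  by rewrite mxE !eqxx mul1r mulrCA.
have dlin x s : is_derive s (1:R) (fun s => F (x + s *: e_ i)) (dF (x + s *: e_ i)).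
  have h1 := is_derive_line x s dh.
  have h2 : is_derive s (1:R) (fun s : R => sg * dotprod x xi + s * c) c.
    by apply: is_derive_eq; rewrite /GRing.scale /=; ring.
  have h3 := @is_derive1_comp _ g _ s _ _ (dg (sg * dotprod x xi + s * c)) h2.
  rewrite /F (_ : (fun s => _) = fun s => h (x + s *: e_ i) * g (sg * dotprod x xi + s * c)); last first.
    by apply/funext => u; rewrite dotE.
  have h4 := is_deriveM h1 h3.
  by apply: is_derive_eq; rewrite /dF dotE /GRing.scale /=; ring.
have mg := measurable_sinusoid sg xi cg; have mg' := measurable_sinusoid sg xi cg'.
have k0 : 0 <= k.
  have := le_trans (normr_ge0 _) (hk 0).
  by rewrite pmulr_lge0// prodweight_gt0.
have i1 : mu.-integrable setT (EFin \o (fun x => 'D_(e_ i) h x * g (sg * dotprod x xi))).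
  apply: rdecay_integrable; first exact: measurable_funM.
  by exists k' => x; rewrite normrM (le_trans _ (hk' x))// ler_piMr.
have i2 : mu.-integrable setT (EFin \o (fun x => h x * g' (sg * dotprod x xi))).
  apply: rdecay_integrable; first exact: measurable_funM.
  by exists k => x; rewrite normrM (le_trans _ (hk x))// ler_piMr.
have iF : mu.-integrable setT (EFin \o F).
  apply: rdecay_integrable; first exact: measurable_funM.
  by exists k => x; rewrite normrM (le_trans _ (hk x))// ler_piMr.
have inv s (f : E -> \bar R) : measurable_fun setT f -> (forall x, 0 <= f x)%E ->
    (\int[mu]_x f (x + s *: e_ i)%R = 1%:E * \int[mu]_x f x)%E.
  move=> mf f0; transitivity (\int[mu]_x f (1 *: x + s *: e_ i)%R)%E.
    by apply: eq_integral => x _; rewrite scale1r.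
  rewrite (ge0_integral_rV_affine (s *: e_ i) (oner_neq0 R))//.
  by rewrite normr1 invr1 expr1n.
have dFle x : `|dF x| <= (k' + `|c| * k) * prodweight x.
  rewrite /dF (le_trans (ler_normD _ _))// (mulrDl k') lerD//.
    by rewrite normrM (le_trans _ (hk' x))// ler_piMr.
  by rewrite normrM -(mulrA `|c|) ler_wpM2l// normrM (le_trans _ (hk x))// ler_piMr.
have dF1E s x : derive1 (fun s => F (x + s *: e_ i)) s = dF (x + s *: e_ i).
  by rewrite derive1E; apply: derive_val.
have H : Rintegral mu setT (fun x => derive1 (fun s => F (x + s *: e_ i)) 0) = 0.
  apply: (@Rintegral_derive_invariant _ _ _ mu (fun s x => F (x + s *: e_ i))
     (fun x => (k' + `|c| * k) * 3 ^+ n * prodweight x)).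
  - move=> s; apply/integrableP; split.
      apply/measurable_EFinP.
      have := measurable_comp_rV_affine 1 (s *: e_ i) (measurable_funM mh mg).
      by apply: eq_measurable_fun => x _; rewrite scale1r.
    rewrite (inv s (fun x => `|(F x)%:E|%E)) ?mul1e//; first by have /integrableP[] := iF.
    by apply/measurable_EFinP; apply: measurableT_comp => //; exact: measurable_funM.
  - by move=> s x; have [] := dlin x s.
  - exact: integrable_prodweight.
  - move=> s x s1; rewrite dF1E (le_trans (dFle _))// -mulrA ler_wpM2l ?prodweight_shift//.
    have := le_trans (normr_ge0 _) (dFle 0).
    by rewrite pmulr_lge0// prodweight_gt0.
  - move=> s.
    rewrite (@Rintegral_scaled_comp _ _ _ mu (fun x => x + s *: e_ i) 1 F (inv s) iF).
    by rewrite mul1r; apply: eq_Rintegral => x _; rewrite scale0r addr0.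
move: H; under eq_Rintegral do rewrite dF1E scale0r addr0.
rewrite RintegralD//; last exact: (integrableZl measurableT c i2).
rewrite (RintegralZl c measurableT i2).
by move/eqP; rewrite addr_eq0 => /eqP ->; rewrite mulNr.
Qed.

Lemma schwartz_bound phi k m : schwartz phi -> exists c : R, forall a x, (size a <= m)%N ->
  (1 + euclid_norm x) ^+ k * normc (cpderiv a phi x) <= c.
Proof.
move=> [_ /(_ k m)]; set S := seminorm k m phi => Soo.
have leS a x : (size a <= m)%N ->
    (((1 + euclid_norm x) ^+ k * normc (cpderiv a phi x))%:E <= S)%E.
  by move=> am; apply: ereal_sup_ubound; exists a, x.
have Sf : S \is a fin_num.
  have := leS [::] 0 isT; move: Soo; case: (S) => // r _.
exists (fine S) => a x am; rewrite -lee_fin fineK//; exact: leS.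
Qed.

Definition cpartial (i : 'I_n) phi : E -> C := fun x => cpderiv [:: i] phi x.

Lemma cpderiv_cpartial a (i : 'I_n) phi : cpderiv a (cpartial i phi) = cpderiv (rcons a i) phi.
Proof.
apply/funext => x; rewrite /cpderiv /cpartial /=; apply: complexP => /=.
  by rewrite -cats1 pderiv_cat.
by rewrite -cats1 pderiv_cat.
Qed.

Lemma schwartz_cpartial (i : 'I_n) phi : schwartz phi -> schwartz (cpartial i phi).
Proof.
move=> [[s1 s2] sn]; split.
  by split; [exact: (smooth_pderiv [:: i] s1)|exact: (smooth_pderiv [:: i] s2)].
move=> k m; apply: le_lt_trans (sn k m.+1); apply: ereal_sup_le.
move=> _ [a [x [am ->]]]; exists (rcons a i), x.
by rewrite size_rcons cpderiv_cpartial.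
Qed.

Lemma coord_le_euclid_norm x (j : 'I_n) : x ord0 j ^+ 2 <= euclid_norm x ^+ 2.
Proof.
rewrite sqr_euclid_norm /dotprod (bigD1 j)//= expr2 lerDl.
by apply: sumr_ge0 => i _; rewrite -expr2 sqr_ge0.
Qed.

Lemma euclid_norm_ge0 x : 0 <= euclid_norm x.
Proof. exact: sqrtr_ge0. Qed.

Lemma prodweightV_le x : (prodweight x)^-1 <= (1 + euclid_norm x) ^+ (2 * n).
Proof.
have -> : (1 + euclid_norm x) ^+ (2 * n) = \prod_(j < n) (1 + euclid_norm x) ^+ 2.
  by rewrite exprM prodr_const card_ord.
rewrite /prodweight -prodfV.
apply: ler_prod => j _; rewrite invrK addr_ge0 ?sqr_ge0//=.
have := coord_le_euclid_norm x j; have := euclid_norm_ge0 x; nra.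
Qed.

Lemma cpderiv0 phi x : cpderiv [::] phi x = phi x.
Proof. by rewrite /cpderiv /=; case: (phi x). Qed.

Lemma schwartz_decay phi : schwartz phi ->
  exists k, forall x, normc (phi x) <= k * prodweight x.
Proof.
move=> /(schwartz_bound (2 * n) 0)[k hk]; exists k => x.
have p0 := prodweight_gt0 x.
have := hk [::] x isT; rewrite cpderiv0.
move=> h; rewrite -ler_pdivrMr// (le_trans _ h)// mulrC ler_wpM2r ?normc_ge0//.
exact: prodweightV_le.
Qed.

Lemma schwartz_continuous phi : schwartz phi ->
  continuous (fun x => complex.Re (phi x)) /\ continuous (fun x => complex.Im (phi x)).
Proof. by move=> [[s1 s2] _]; split; [have [] := s1 [::]|have [] := s2 [::]]. Qed.

Lemma schwartz_cmeasurable phi : schwartz phi -> cmeasurable phi.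
Proof. by move=> /schwartz_continuous[c1 c2]; split; exact: continuous_measurable_rV. Qed.

Lemma schwartz_cintegrable phi : schwartz phi -> cintegrable mu phi.
Proof.
move=> sphi; have [k hk] := schwartz_decay sphi.
apply: (@le_cintegrable _ _ _ _ _ (fun x => k * prodweight x)) => //.
- exact: schwartz_cmeasurable.
- by apply: measurable_funM => //; exact: measurable_prodweight.
- have /integrableP[_] := integrable_prodweight k.
  apply: le_lt_trans; apply: ge0_le_integral => //.
  + by move=> x _; rewrite lee_fin (le_trans (normc_ge0 _) (hk x)).
  + by apply/measurable_EFinP; apply: measurable_funM => //; exact: measurable_prodweight.
  + by apply: measurableT_comp => //; apply/measurable_EFinP; apply: measurable_funM => //; exact: measurable_prodweight.
  + by move=> x _ /=; rewrite lee_fin ler_norm.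
Qed.

Lemma schwartz_bounded phi : schwartz phi -> exists k, forall x, normc (phi x) <= k.
Proof.
move=> /(schwartz_bound 0 0)[k hk]; exists k => x.
have := hk [::] x isT; rewrite cpderiv0.
by rewrite expr0 mul1r.
Qed.

Lemma schwartz_rdecay phi : schwartz phi ->
  rdecay (fun x => complex.Re (phi x)) /\ rdecay (fun x => complex.Im (phi x)).
Proof.
move=> /schwartz_decay[k hk]; split; exists k => x.
  exact: le_trans (Re_le_normc _) (hk x).
exact: le_trans (Im_le_normc _) (hk x).
Qed.

(** The four pairings of real or imaginary part with cosine or sine are integrated by parts
    separately and reassembled. *)
Lemma ft_cpartial (i : 'I_n) (sg : R) phi xi : schwartz phi ->
  ft sg (cpartial i phi) xi = Complex 0 (- (sg * xi ord0 i)) * ft sg phi xi.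
Proof.
move=> sphi; have sdphi := schwartz_cpartial i sphi.
have [c1 c2] := schwartz_continuous sphi; have [d1 d2] := schwartz_continuous sdphi.
have [r1 r2] := schwartz_rdecay sphi; have [q1 q2] := schwartz_rdecay sdphi.
have [[s1 s2] _] := sphi.
have e1 x : derivable (fun x => complex.Re (phi x)) x (e_ i) by have [_] := s1 [::]; apply.
have e2 x : derivable (fun x => complex.Im (phi x)) x (e_ i) by have [_] := s2 [::]; apply.
have cosc := @continuous_cos R; have sinc := @continuous_sin R.
have cos1 (r : R) : `|cos r| <= 1 by rewrite ler_norml cos_le1 cos_geN1.
have sin1 (r : R) : `|sin r| <= 1 by rewrite ler_norml sin_le1 sin_geN1.
have nsin1 (r : R) : `|- sin r| <= 1 by rewrite normrN.
have nsinc : continuous (fun r : R => - sin r).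
  by move=> r; apply: continuousN; exact: sinc.
have H h := @Rintegral_pderiv_sinusoid h i sg xi.
have A1 := H _ cos (fun r => - sin r) c1 e1 d1 r1 q1 (@is_derive_cos R) cosc nsinc cos1 nsin1.
have A2 := H _ sin cos c1 e1 d1 r1 q1 (@is_derive_sin R) sinc cosc sin1 cos1.
have B1 := H _ cos (fun r => - sin r) c2 e2 d2 r2 q2 (@is_derive_cos R) cosc nsinc cos1 nsin1.
have B2 := H _ sin cos c2 e2 d2 r2 q2 (@is_derive_sin R) sinc cosc sin1 cos1.
have I (h : E -> R) (g : R -> R) : continuous h -> rdecay h -> continuous g ->
    (forall r, `|g r| <= 1) ->
    mu.-integrable setT (EFin \o (fun x => h x * g (sg * dotprod x xi))).
  move=> ch [k hk] cg g1; apply: rdecay_integrable.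
    apply: measurable_funM; first exact: continuous_measurable_rV.
    exact: measurable_sinusoid.
  by exists k => x; rewrite normrM (le_trans _ (hk x))// ler_piMr.
have cintE (psi : E -> C) : continuous (fun x => complex.Re (psi x)) ->
    continuous (fun x => complex.Im (psi x)) -> rdecay (fun x => complex.Re (psi x)) ->
    rdecay (fun x => complex.Im (psi x)) ->
    cint mu (fun x => expi (sg * dotprod x xi) * psi x) = Complex
    (Rintegral mu setT (fun x => complex.Re (psi x) * cos (sg * dotprod x xi)) -
     Rintegral mu setT (fun x => complex.Im (psi x) * sin (sg * dotprod x xi)))
    (Rintegral mu setT (fun x => complex.Im (psi x) * cos (sg * dotprod x xi)) +
     Rintegral mu setT (fun x => complex.Re (psi x) * sin (sg * dotprod x xi))).
  move=> p1 p2 p3 p4; apply: complexP => /=.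
    rewrite -RintegralB//; [|exact: I|exact: I].
    by apply: eq_Rintegral => x _; rewrite cReM /= mulrC [sin _ * _]mulrC.
  rewrite -RintegralD//; [|exact: I|exact: I].
  by apply: eq_Rintegral => x _; rewrite cImM /= mulrC [sin _ * _]mulrC.
have N (h : E -> R) : continuous h -> rdecay h ->
    Rintegral mu setT (fun x => h x * - sin (sg * dotprod x xi)) =
    - Rintegral mu setT (fun x => h x * sin (sg * dotprod x xi)).
  move=> ch rh; rewrite -mulN1r -RintegralZl//; last exact: I.
  by apply: eq_Rintegral => x _; rewrite mulrN mulN1r.
rewrite /ft mulrCA; congr (_ * _).
rewrite (cintE _ d1 d2 q1 q2) (cintE _ c1 c2 r1 r2).
rewrite /= in A1 A2 B1 B2.
rewrite /cpartial /= A1 A2 B1 B2 !N//.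
by apply: complexP => /=; ring.
Qed.

(** Each factor 1 + xi_i^2 costs two derivatives: up to sign, xi_i^2 times the transform is the
    transform of the second derivative, which is again a Schwartz function. Hence the induction on
    the list is over all [phi] at once. *)
Lemma ft_decay_seq (sg : R) (l : seq 'I_n) phi : sg * sg = 1 -> schwartz phi ->
  exists c, forall xi, (\prod_(i <- l) (1 + xi ord0 i ^+ 2)) * normc (ft sg phi xi) <= c.
Proof.
move=> sg1; elim: l phi => [|i l IH] phi sphi.
  have [c hc] := ft_bounded sg (schwartz_cintegrable sphi).
  by exists c => xi; rewrite big_nil mul1r.
have [c1 h1] := IH _ sphi.
have [c2 h2] := IH _ (schwartz_cpartial i (schwartz_cpartial i sphi)).
exists (c1 + c2) => xi; rewrite big_cons.
have E2 : normc (ft sg (cpartial i (cpartial i phi)) xi) = xi ord0 i ^+ 2 * normc (ft sg phi xi).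
  rewrite !ft_cpartial//; last exact: schwartz_cpartial.
  rewrite mulrA normcM; congr (_ * _).
  rewrite (_ : _ * _ = ((- (xi ord0 i ^+ 2))%:C)%C).
    by rewrite normc_real normrN ger0_norm// sqr_ge0.
  apply: complexP => /=; last by rewrite mul0r mulr0 addr0.
  rewrite mul0r sub0r mulrNN; congr (- _).
  by rewrite mulrACA sg1 mul1r expr2.
have := h1 xi; have := h2 xi; rewrite E2 => k2 k1.
rewrite (_ : _ * _ = \prod_(j <- l) (1 + xi ord0 j ^+ 2) * normc (ft sg phi xi) +
   \prod_(j <- l) (1 + xi ord0 j ^+ 2) * (xi ord0 i ^+ 2 * normc (ft sg phi xi))); first exact: lerD.
by ring.
Qed.

Lemma ft_decay (sg : R) (N : nat) phi : sg * sg = 1 -> schwartz phi ->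
  exists c, forall xi, normc (ft sg phi xi) <= c * prodweight xi ^+ N.
Proof.
move=> sg1 sphi.
have [l hl] : exists l : seq 'I_n, forall xi : E,
    \prod_(i <- l) (1 + xi ord0 i ^+ 2) = (prodweight xi ^+ N)^-1.
  elim: N => [|N [l hl]]; first by exists [::] => xi; rewrite big_nil expr0 invr1.
  (* One pass through all coordinates contributes one further inverse of [prodweight]. *)
  exists (index_enum _ ++ l) => xi; rewrite big_cat/= hl exprS invfM; congr (_ * _).
  by rewrite /prodweight -prodfV; apply: eq_bigr => i _; rewrite invrK.
have [c hc] := ft_decay_seq l sg1 sphi; exists c => xi.
have p0 : 0 < prodweight xi ^+ N by rewrite exprn_gt0// prodweight_gt0.
by have := hc xi; rewrite hl mulrC ler_pdivrMr.
Qed.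

(** Expanding the product gives 1, the sum, and further nonnegative terms. *)
Lemma one_sum_le_prod (s : seq 'I_n) (a : 'I_n -> R) : (forall i, 0 <= a i) ->
  1 + \sum_(i <- s) a i <= \prod_(i <- s) (1 + a i).
Proof.
move=> a0; elim: s => [|i s IH]; first by rewrite !big_nil addr0.
rewrite !big_cons.
have s0 : 0 <= \sum_(j <- s) a j by apply: sumr_ge0.
apply: (@le_trans _ _ ((1 + a i) * (1 + \sum_(j <- s) a j))); last first.
  by rewrite ler_wpM2l// addr_ge0.
have := mulr_ge0 (a0 i) s0; lra.
Qed.

Lemma one_norm_le_prodweightV x : 1 + euclid_norm x ^+ 2 <= (prodweight x)^-1.
Proof.
rewrite sqr_euclid_norm /prodweight -prodfV.
under [leRHS]eq_bigr do rewrite invrK.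
under [X in 1 + X <= _]eq_bigr do rewrite -expr2.
by apply: one_sum_le_prod => i; exact: sqr_ge0.
Qed.

Definition bweight (s : R) x : R := (1 + euclid_norm x ^+ 2) `^ (s / 2).

Lemma bweight_ge0 s x : 0 <= bweight s x. Proof. exact: powR_ge0. Qed.

Lemma bessel_weightE s x : bessel_weight s x = ((bweight s x)%:C)%C.
Proof. by []. Qed.

Lemma measurable_sqr_norm : measurable_fun setT (fun x : E => euclid_norm x ^+ 2).
Proof.
rewrite (_ : (fun x => _) = fun x => dotprod x x); last by apply/funext => x; rewrite sqr_euclid_norm.
by apply: measurable_dotprod; exact: measurable_id.
Qed.

Lemma measurable_bweight s : measurable_fun setT (bweight s).
Proof.
apply: (measurableT_comp (measurable_powR _)).
by apply: measurable_funD => //; exact: measurable_sqr_norm.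
Qed.

Lemma bweight_le s (L : nat) x : s / 2 <= L%:R -> bweight s x <= (prodweight x ^+ L)^-1.
Proof.
move=> sL; have h1 : 1 <= 1 + euclid_norm x ^+ 2 by rewrite lerDl sqr_ge0.
apply: (@le_trans _ _ ((1 + euclid_norm x ^+ 2) ^+ L)).
  rewrite -powR_mulrn; last exact: le_trans h1.
  exact: ler_powR.
rewrite -exprVn lerXn2r ?nnegrE//; first exact: le_trans h1.
  by rewrite invr_ge0 ltW// prodweight_gt0.
exact: one_norm_le_prodweightV.
Qed.

Lemma bweight_ft_decay (s sg : R) phi : sg * sg = 1 -> schwartz phi ->
  exists c, forall xi, normc (bessel_weight s xi * ft sg phi xi) <= c * prodweight xi.
Proof.
move=> sg1 sphi.
(* The Bessel weight grows at most like the inverse of [prodweight ^+ L]; decay of order L + 1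
   leaves one integrable factor. *)
pose L := Num.bound `|s / 2|.
have sL : s / 2 <= L%:R by rewrite (le_trans (ler_norm _))// ltW// archi_boundP.
have [c hc] := ft_decay L.+1 sg1 sphi; exists c => xi.
have p0 := prodweight_gt0 xi.
have pL : 0 < prodweight xi ^+ L by rewrite exprn_gt0.
rewrite normcM bessel_weightE normc_real ger0_norm ?bweight_ge0//.
apply: (le_trans (ler_wpM2l (bweight_ge0 _ _) (hc xi))).
have c0 : 0 <= c * prodweight xi ^+ L.+1 := le_trans (normc_ge0 _) (hc xi).
apply: (le_trans (ler_wpM2r c0 (bweight_le xi sL))).
rewrite exprS; move: (prodweight xi ^+ L) pL => q q0.
suff -> : q^-1 * (c * (prodweight xi * q)) = c * prodweight xi by [].
by field; exact: lt0r_neq0.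
Qed.

Lemma cintegrable_decay (f : E -> C) (c : R) : cmeasurable f ->
  (forall x, normc (f x) <= c * prodweight x) -> cintegrable mu f.
Proof.
move=> mf hf; apply: (@le_cintegrable _ _ _ _ _ (fun x => c * prodweight x)) => //.
  by apply: measurable_funM => //; exact: measurable_prodweight.
have /integrableP[_] := integrable_prodweight c.
apply: le_lt_trans; apply: ge0_le_integral => //.
- by move=> x _; rewrite lee_fin (le_trans (normc_ge0 _) (hf x)).
- by apply/measurable_EFinP; apply: measurable_funM => //; exact: measurable_prodweight.
- by apply: measurableT_comp => //; apply/measurable_EFinP; apply: measurable_funM => //; exact: measurable_prodweight.
- by move=> x _ /=; rewrite lee_fin ler_norm.
Qed.

Lemma cmeasurable_bessel_weight s : cmeasurable (bessel_weight s : E -> C).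
Proof. by apply: cmeasurable_real; exact: measurable_bweight. Qed.

Lemma cintegrable_bweight_ft (s sg : R) phi : sg * sg = 1 -> schwartz phi ->
  cintegrable mu (fun xi => bessel_weight s xi * ft sg phi xi).
Proof.
move=> sg1 sphi; have [c hc] := bweight_ft_decay s sg1 sphi.
apply: (cintegrable_decay (c := c)) => //; apply: cmeasurableM.
  exact: cmeasurable_bessel_weight.
by apply: cmeasurable_ft; exact: schwartz_cintegrable.
Qed.

Lemma cintegrable_ft (sg : R) phi : sg * sg = 1 -> schwartz phi -> cintegrable mu (ft sg phi).
Proof.
move=> sg1 sphi; have [c hc] := ft_decay 1 sg1 sphi.
apply: (cintegrable_decay (c := c)) => //.
by apply: cmeasurable_ft; exact: schwartz_cintegrable.
Qed.

Lemma schwartz_inversion phi x : schwartz phi -> fourier (inv_fourier phi) x = phi x.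
Proof.
move=> sphi; have [c1 c2] := schwartz_continuous sphi; have [k hk] := schwartz_bounded sphi.
rewrite fourierE inv_fourierE; apply: (@ft_inversion R n 1 phi x k) => //; first by rewrite mulr1.
  exact: schwartz_cintegrable.
by apply: cintegrable_ft => //; rewrite mulr1.
Qed.

Lemma pderiv_eq0 (U : set E) (a : seq 'I_n) h : open U -> (forall x, U x -> h x = 0) ->
  forall x, U x -> pderiv a h x = 0.
Proof.
move=> oU h0; elim: a => [|i a IH] x Ux //=; first exact: h0.
rewrite (@near_eq_derive _ _ _ _ (cst 0)) ?derive_cst//.
have : nbhs x U by apply: open_nbhs_nbhs.
by apply: filterS => y Uy; rewrite IH.
Qed.

Lemma continuous_euclid_norm : continuous (@euclid_norm R n).
Proof.
have cd : continuous (fun x : E => dotprod x x).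
  have H (r : seq 'I_n) : continuous (fun x : E => \sum_(i <- r) x ord0 i * x ord0 i).
    elim: r => [|i r IH] x.
      have -> : (fun y : E => \sum_(i <- [::]) y ord0 i * y ord0 i) = cst (0:R).
        by apply/funext => y; rewrite big_nil.
      exact: cst_continuous.
    have -> : (fun y : E => \sum_(j <- i :: r) y ord0 j * y ord0 j) =
        fun y => y ord0 i * y ord0 i + \sum_(j <- r) y ord0 j * y ord0 j.
      by apply/funext => y; rewrite big_cons.
    have cc : {for x, continuous (fun y : E => y ord0 i)} by exact: coord_continuous.
    exact: (continuousD (continuousM cc cc) (IH x)).
  exact: H.
by move=> x; apply: (continuous_comp (cd x)); exact: sqrt_continuous.
Qed.

Lemma compact_bound (K : set E) h : compact K -> continuous h ->
  exists b, forall x, K x -> `|h x| <= b.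
Proof.
move=> cK ch.
have /compact_bounded[M [_ HM]] : compact (h @` K).
  by apply: continuous_compact => //; exact: continuous_subspaceT.
exists (M + 1) => x Kx; apply: (HM (M + 1)); first by rewrite ltrDl.
by exists x.
Qed.

(** There are finitely many lists of indices of size at most m; this makes bounds for single
    derivatives uniform over a seminorm. *)
Lemma seq_bound (B : seq 'I_n -> R) (m : nat) :
  exists c, forall a, (size a <= m)%N -> B a <= c.
Proof.
elim: m B => [|m IH] B; first by exists (B [::]) => a; rewrite leqn0 => /eqP/size0nil ->.
have /choice[f hf] i := IH (fun a => B (i :: a)).
exists (`|B [::]| + \sum_i `|f i|) => -[_|i a /= am].
  by rewrite (le_trans (ler_norm _))// lerDl sumr_ge0.
rewrite (le_trans (hf i a am))// (bigD1 i)//= (le_trans (ler_norm _))//.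
by rewrite addrCA lerDl addr_ge0// sumr_ge0.
Qed.

(** Off the closure of the nonvanishing set, whose complement is open, all derivatives vanish; on
    it, compactness bounds each derivative and the polynomial weight. *)
Lemma test_schwartz phi : test_function phi -> schwartz phi.
Proof.
move=> [[s1 s2] cK]; split => // k m.
set K := closure _ in cK.
have oK : open (~` K) by apply: closed_openC; exact: closed_closure.
have phi0 x : (~` K) x -> phi x = 0.
  move=> nK; apply/eqP; apply/negPn/negP => h; apply: nK.
  exact: subset_closure.
have d0 a x : (~` K) x -> cpderiv a phi x = 0.
  move=> nK; rewrite /cpderiv !(pderiv_eq0 _ oK)// => y /phi0 ->//.
have H a : exists b, forall x, (1 + euclid_norm x) ^+ k * normc (cpderiv a phi x) <= b.
  have [c1 _] := s1 a; have [c2 _] := s2 a.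
  have cn : continuous (fun x : E => (1 + euclid_norm x) ^+ k).
    move=> x; apply: (continuous_comp (f := fun x : E => 1 + euclid_norm x) (g := fun r => r ^+ k)).
      exact: (continuousD (@cst_continuous _ _ (1:R) x) (@continuous_euclid_norm x)).
    exact: exprn_continuous.
  have [b1 hb1] := compact_bound cK c1; have [b2 hb2] := compact_bound cK c2.
  have [b3 hb3] := compact_bound cK cn.
  exists (`|b3| * (`|b1| + `|b2|)) => x.
  have [Kx|nK] := pselect (K x); last first.
    by rewrite d0// normc0 mulr0 mulr_ge0// addr_ge0.
  apply: ler_pM.
  - by rewrite exprn_ge0// addr_ge0// sqrtr_ge0.
  - exact: normc_ge0.
  - by rewrite (le_trans (ler_norm _))// (le_trans (hb3 _ Kx))// ler_norm.
  - rewrite (le_trans (normc_le_ReIm _))// lerD//=.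
      by rewrite (le_trans (hb1 _ Kx))// ler_norm.
    by rewrite (le_trans (hb2 _ Kx))// ler_norm.
have [B hB] := choice H; have [c hc] := seq_bound B m.
apply: (@le_lt_trans _ _ c%:E); last exact: ltry.
apply: ge_ereal_sup => _ [a [x [am ->]]]; rewrite lee_fin.
exact: le_trans (hB a x) (hc a am).
Qed.

(** The converse of [is_derive_line] at s = 0; together they let one-variable derivative rules act
    on partial derivatives. *)
Lemma is_derive_lineP h (i : 'I_n) x (d : R) :
  is_derive (0:R) (1:R) (fun s => h (x + s *: e_ i)) d -> is_derive x (e_ i) h d.
Proof.
have E : (fun k : R => k^-1 *: (h (x + (k *: (1:R) + 0) *: e_ i) - h (x + 0 *: e_ i))) =
         (fun k : R => k^-1 *: (h (k *: e_ i + x) - h x)).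
  apply/funext => k; rewrite scale0r addr0 [k *: (1:R)]mulr1 addr0.
  by rewrite [x + _]addrC.
move=> [d1 d2]; apply: DeriveDef.
  by move: d1; rewrite /derivable /= E.
by move: d2; rewrite /derive /= E.
Qed.

Lemma is_derive_scale h (i : 'I_n) x (k : R) :
  (forall y, derivable h y (e_ i)) ->
  is_derive x (e_ i) (fun y => h (k *: y)) (k * 'D_(e_ i) h (k *: x)).
Proof.
move=> dh; apply: is_derive_lineP.
have h1 := is_derive_line (k *: x) (k * 0) dh.
have h2 : is_derive (0:R) (1:R) (fun s : R => k * s) k.
  by apply: is_derive_eq; rewrite /GRing.scale /=; ring.
have h3 := @is_derive1_comp _ (fun s => h (k *: x + s *: e_ i)) (fun s : R => k * s) 0 _ _ h1 h2.
rewrite (_ : (fun s => _) = (fun s => h (k *: x + s *: e_ i)) \o (fun s : R => k * s)).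
  by apply: is_derive_eq; rewrite mulr0 scale0r addr0 mulrC.
by apply/funext => s /=; rewrite scalerDr scalerA.
Qed.

Lemma pderiv_scale h (k : R) (a : seq 'I_n) : smooth h ->
  pderiv a (fun y => h (k *: y)) = (fun y => k ^+ size a * pderiv a h (k *: y)) /\
  forall i x, is_derive x (e_ i) (fun y => k ^+ size a * pderiv a h (k *: y))
    (k ^+ (size a).+1 * pderiv (i :: a) h (k *: x)).
Proof.
move=> sh.
have D b i x : is_derive x (e_ i) (fun y => k ^+ size b * pderiv b h (k *: y))
    (k ^+ (size b).+1 * pderiv (i :: b) h (k *: x)).
  have [_ db] := sh b.
  have h1 := is_derive_scale x k (db i).
  rewrite (_ : (fun y => _) = k ^+ size b \*: (fun y => pderiv b h (k *: y))); last by [].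
  have := is_deriveZ (k ^+ size b) h1 => h2.
  by apply: is_derive_eq; rewrite exprSr /GRing.scale /= mulrA.
split; last exact: D.
elim: a => [|i a IH]; first by apply/funext => y; rewrite expr0 mul1r.
apply/funext => y /=; rewrite [in LHS]/pderiv /= -/(pderiv a _) IH.
by apply: derive_val; exact: D.
Qed.

Lemma smooth_scale h (k : R) : smooth h -> smooth (fun y => h (k *: y)).
Proof.
move=> sh a; have [eqE D] := pderiv_scale k a sh; rewrite eqE; split.
  have [ca _] := sh a.
  move=> x; have ck : {for x, continuous (fun y : E => k *: y)} by exact: scaler_continuous.
  have cp : {for x, continuous (fun y : E => pderiv a h (k *: y))}.
    by apply: (continuous_comp ck); exact: ca.
  exact: (continuousM (@cst_continuous _ _ (k ^+ size a) x) cp).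
by move=> i x; have [] := D i x.
Qed.

Lemma test_function_scale phi (k : R) : k != 0 -> test_function phi ->
  test_function (fun y => phi (k *: y)).
Proof.
move=> k0 [[s1 s2] cK]; split.
  by split; [exact: (smooth_scale k s1)|exact: (smooth_scale k s2)].
set K := closure _ in cK.
(* The nonvanishing set of the dilate lies in this image of K, which is compact and therefore
   closed. *)
have cK' : compact ((fun y : E => k^-1 *: y) @` K).
  apply: continuous_compact => //; apply: continuous_subspaceT => y.
    exact: scaler_continuous.
have clK' : closed ((fun y : E => k^-1 *: y) @` K).
  by apply: compact_closed => //; exact: norm_hausdorff.
apply: (subclosed_compact _ cK'); first exact: closed_closure.
rewrite ((closure_id _).1 clK'); apply: closureS => y /= hy.
exists (k *: y); last by rewrite scalerA mulVf// scale1r.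
exact: subset_closure.
Qed.

End smooth_functions.

(** * Power functions and Riesz potentials on the line *)

Section power_integrals.
Context (R : realType).
Local Notation leb := (@lebesgue_measure R).
Implicit Types a b r y z rho : R.

Lemma integral_powRN_segment b x y : 0 < x -> x < y -> b != 1 ->
  (\int[leb]_(r in `[x, y]) (r `^ (- b))%:E =
   ((y `^ (1 - b) - x `^ (1 - b)) / (1 - b))%:E)%E.
Proof.
move=> x0 xy b1; have b1' : 1 - b != 0 by rewrite subr_eq0 eq_sym.
pose F r : R := (1 - b)^-1 * r `^ (1 - b).
have dF r : 0 < r -> is_derive r (1:R) F (r `^ (- b)).
  move=> r0; have h := is_derive1_powR (1 - b) r0.
  have h2 := is_deriveZ (1 - b)^-1 h.
  rewrite (_ : r `^ (- b) = (1 - b)^-1 *: ((1 - b) * r `^ (1 - b - 1))) //.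
  by rewrite /GRing.scale /= mulKf// addrAC subrr add0r.
have cF r : 0 < r -> {for r, continuous F}.
  move=> r0; have [d1 _] := dF r r0.
  by apply: differentiable_continuous; apply/derivable1_diffP.
have cf r : 0 < r -> {for r, continuous (fun r : R => r `^ (- b))}.
  move=> r0; have [d1 _] := is_derive1_powR (- b) r0.
  by apply: differentiable_continuous; apply/derivable1_diffP.
rewrite (@continuous_FTC2 _ _ F)//.
- by rewrite -EFinB; congr EFin; rewrite /F; field.
- apply: continuous_in_subspaceT => r /[1!inE]/=; rewrite in_itv/= => /andP[xr _].
  by apply: cf; exact: lt_le_trans xr.
- split.
  + move=> r; rewrite in_itv/= => /andP[xr _].
    by have [] := dF r (lt_trans x0 xr).
  + by apply: cvg_at_right_filter; exact: cF.
  + by apply: cvg_at_left_filter; apply: cF; exact: lt_trans xy.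
- move=> r; rewrite in_itv/= => /andP[xr _].
  by rewrite derive1E; apply: derive_val; apply: dF; exact: lt_trans xr.
Qed.

Lemma measurable_absB_le z rho : measurable_fun [set: R] (fun r : R => `|r - z| <= rho).
Proof.
apply: measurable_fun_ler => //; apply: measurableT_comp => //.
by apply: measurable_funB.
Qed.

Lemma measurable_abs_powR b z : measurable_fun [set: R] (fun r : R => `|r - z| `^ b).
Proof.
apply: (measurableT_comp (measurable_powR b)).
by apply: measurableT_comp => //; apply: measurable_funB.
Qed.

Lemma ge0_integral_le_segment b x y (h : R -> R) : 0 < x -> x < y -> b != 1 ->
  measurable_fun [set: R] h -> (forall r, 0 <= h r) ->
  (forall r, h r <= if x <= r <= y then r `^ (- b) else 0) ->
  (\int[leb]_r (h r)%:E <= ((y `^ (1 - b) - x `^ (1 - b)) / (1 - b))%:E)%E.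
Proof.
move=> x0 xy b1 mh h0 hle; rewrite -integral_powRN_segment// [leRHS]integral_mkcond.
apply: ge0_le_integral => //.
- by move=> r _; rewrite lee_fin.
- by apply/measurable_EFinP; exact: mh.
- apply/(measurable_restrictT _ _).1 => //; apply/measurable_EFinP.
  by apply: measurable_funTS; exact: measurable_powR.
- move=> r _; rewrite patchE; case: ifP => [|/negbT].
    by rewrite inE/= in_itv/= lee_fin => xry; have := hle r; rewrite xry.
  by rewrite notin_setE/= in_itv/= => /negP/negbTE xry; have := hle r; rewrite xry lee_fin.
Qed.

(** The singularity is cut off and the bound of the truncated integrals, in which a negative term is
    dropped, passes to the limit. *)
Lemma integral_powRN_near0 b : b < 1 ->
  (\int[leb]_r (if (0 < r <= 1)%R then r `^ (- b) else 0)%:E <= ((1 - b)^-1)%:E)%E.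
Proof.
move=> b1.
pose f r : R := if 0 < r <= 1 then r `^ (- b) else 0.
have mf : measurable_fun [set: R] f.
  apply: measurable_fun_ifT => //.
  by apply: measurable_and; [exact: measurable_fun_ltr|exact: measurable_fun_ler].
(* The index k + 2 keeps the left end of the segment strictly below 1. *)
pose w k r : R := if 0 < r < k.+2%:R^-1 then 0 else 1.
have mw k : measurable_fun [set: R] (w k).
  apply: measurable_fun_ifT => //.
  by apply: measurable_and; [exact: measurable_fun_ltr|exact: measurable_fun_ltr].
have f0 r : 0 <= f r by rewrite /f; case: ifP => // _; exact: powR_ge0.
have w0 k r : 0 <= w k r by rewrite /w; case: ifP.
apply: (@ge0_integral_le_approx R _ _ leb f w) => //.
- move=> r j k jk; rewrite /w; case: ifPn => // h1; case: ifPn => // /andP[r0 h2].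
  move: h1; rewrite r0/= -leNgt => h1; have := le_lt_trans h1 h2.
  by rewrite ltf_pV2 ?posrE// ltr_nat ltnNge !ltnS jk.
- move=> r; apply: cvg_near_cst; have [r0|r0] := leP r 0.
    by apply: nearW => k; rewrite /w ltNge r0.
  exists (Num.bound r^-1) => // k /= hk; rewrite /w r0/= ltNge.
  rewrite -[r]invrK lef_pV2 ?posrE ?invr_gt0//.
  rewrite (le_trans (ltW (archi_boundP _))) ?invr_ge0 ?ltW//.
  by rewrite ltr_nat ltnS (leq_trans hk).
move=> k; have x0 : 0 < k.+2%:R^-1 :> R by rewrite invr_gt0.
have x1 : k.+2%:R^-1 < 1 :> R by rewrite invf_lt1// ltr1n.
have b1' : b != 1 by rewrite lt_eqF.
apply: (le_trans (ge0_integral_le_segment (h := fun r => w k r * f r) x0 x1 b1' _ _ _)).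
- exact: measurable_funM.
- by move=> r; rewrite mulr_ge0.
- move=> r; rewrite /w /f; case: ifPn; rewrite ?mul0r ?mul1r.
    by move=> _; case: ifP => // _; exact: powR_ge0.
  move=> h1; case: ifPn => [/andP[r0 r1]|_].
    by move: h1; rewrite r0 /= -leNgt => ->; rewrite r1.
  by case: ifP => // _; exact: powR_ge0.
rewrite lee_fin powR1 -[leRHS]mul1r ler_pM2r ?invr_gt0 ?subr_gt0// gerBl powR_ge0.
Qed.

Lemma integral_powRN_tail b : 1 < b ->
  (\int[leb]_r (if (1 <= r)%R then r `^ (- b) else 0)%:E <= ((b - 1)^-1)%:E)%E.
Proof.
move=> b1.
pose f r : R := if 1 <= r then r `^ (- b) else 0.
have mf : measurable_fun [set: R] f.
  apply: measurable_fun_ifT => //.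
  exact: measurable_fun_ler.
(* The index k + 2 keeps the right end of the segment strictly above 1. *)
pose w k r : R := if k.+2%:R < r then 0 else 1.
have mw k : measurable_fun [set: R] (w k).
  by apply: measurable_fun_ifT => //; exact: measurable_fun_ltr.
have f0 r : 0 <= f r by rewrite /f; case: ifP => // _; exact: powR_ge0.
have w0 k r : 0 <= w k r by rewrite /w; case: ifP.
apply: (@ge0_integral_le_approx R _ _ leb f w) => //.
- move=> r j k jk; rewrite /w; case: ifPn => // h1; case: ifPn => // h2.
  by move: h1; rewrite (le_lt_trans _ h2)// ler_nat !ltnS.
- move=> r; apply: cvg_near_cst; exists (Num.bound `|r|) => // k /= hk.
  rewrite /w ltNge (le_trans (ler_norm r))//.
  rewrite (le_trans (ltW (archi_boundP _)))//.
  by rewrite ler_nat (leq_trans hk)// -addn2 leq_addr.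
move=> k; have x1 : 1 < k.+2%:R :> R by rewrite ltr1n.
have b1' : b != 1 by rewrite gt_eqF.
apply: (le_trans (ge0_integral_le_segment (h := fun r => w k r * f r) ltr01 x1 b1' _ _ _)).
- exact: measurable_funM.
- by move=> r; rewrite mulr_ge0.
- move=> r; rewrite /w /f; case: ifPn; rewrite ?mul0r ?mul1r.
    by move=> _; case: ifP => // _; exact: powR_ge0.
  rewrite -leNgt => ->; rewrite andbT; by case: ifP.
rewrite lee_fin powR1 -opprB mulNr -mulrN -invrN opprB -[leRHS]mul1r.
by rewrite ler_pM2r ?invr_gt0 ?subr_gt0// gerBl powR_ge0.
Qed.

Lemma measurable_if_absB z rho (g : R -> R) : measurable_fun [set: R] g ->
  measurable_fun [set: R] (fun r : R => if `|r - z| <= rho then g r else 0).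
Proof. by move=> mg; apply: measurable_fun_ifT => //; exact: measurable_absB_le. Qed.

Lemma ge0_integral_shift z (f : R -> R) : measurable_fun [set: R] f -> (forall r, 0 <= f r) ->
  (\int[leb]_r (f (r - z))%:E = \int[leb]_r (f r)%:E)%E.
Proof.
move=> mf f0; have := @ge0_integral_lebesgue_affine R 1 (- z) (EFin \o f) (oner_neq0 _).
rewrite normr1 invr1 mul1e => <- //; last by apply/measurable_EFinP; exact: mf.
by apply: eq_integral => r _ /=; rewrite mul1r.
Qed.

Lemma ge0_integral_normr_le (g : R -> R) : measurable_fun [set: R] g -> (forall r, 0 <= g r) ->
  (\int[leb]_r (g `|r|)%:E <= 2%:E * \int[leb]_r (g r)%:E)%E.
Proof.
move=> mg g0.
have mgN : measurable_fun [set: R] (fun r : R => g (- r)).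
  by apply: (measurableT_comp mg); apply: continuous_measurable_fun => r; exact: opp_continuous.
have E : (\int[leb]_r (g (- r))%:E = \int[leb]_r (g r)%:E)%E.
  have := @ge0_integral_lebesgue_affine R (-1) 0 (EFin \o g).
  rewrite oppr_eq0 oner_eq0 normrN1 invr1 mul1e => <- //; last by apply/measurable_EFinP; exact: mg.
  by apply: eq_integral => r _ /=; rewrite mulN1r addr0.
have -> : (2%:E * \int[leb]_r (g r)%:E = \int[leb]_r ((g r)%:E + (g (- r))%:E))%E.
  rewrite ge0_integralD//.
  - by rewrite mule_natl mule2n -[X in (_ + X = _)%E]E.
  - by move=> r _; rewrite lee_fin.
  - by apply/measurable_EFinP; exact: mg.
  - by move=> r _; rewrite lee_fin.
  - by apply/measurable_EFinP; exact: mgN.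
apply: ge0_le_integral => //.
- by move=> r _; rewrite lee_fin.
- apply/measurable_EFinP.
  by apply: (measurableT_comp mg); apply: continuous_measurable_fun => r; exact: norm_continuous.
- by apply: emeasurable_funD; apply/measurable_EFinP; [exact: mg|exact: mgN].
- move=> r _; rewrite -EFinD lee_fin.
  by have [r0|r0] := leP (0:R) (r:R); [rewrite ger0_norm// lerDl; exact: g0|
    rewrite ltr0_norm// lerDr; exact: g0].
Qed.

Lemma integral_absB_le z rho : 0 <= rho ->
  (\int[leb]_r (if (`|r - z| <= rho)%R then 1 else 0)%:E = (2 * rho)%:E)%E.
Proof.
move=> rho0; transitivity (\int[leb]_r (\1_(`[z - rho, z + rho]%classic) r)%:E)%E.
  apply: eq_integral => r _; rewrite indicE; congr EFin.
  rewrite mem_setE in_itv/= ler_distl.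
  by case: (_ && _).
transitivity (leb `[z - rho, z + rho]%classic); first by rewrite integral_indic// setIT.
rewrite lebesgue_measure_itv /= lte_fin.
case: ifPn => [_|].
  by rewrite -EFinB; congr EFin; ring.
rewrite -leNgt => h; have -> : rho = 0 by apply/eqP; rewrite eq_le rho0 andbT; lra.
by rewrite mulr0.
Qed.

Lemma integral_abs_near b : 0 < b -> b < 1 ->
  (\int[leb]_r (if (`|r| <= 1)%R then `|r| `^ (- b) else 0)%:E <= (2 / (1 - b))%:E)%E.
Proof.
move=> b0 b1; pose g r : R := if 0 < r <= 1 then r `^ (- b) else 0.
rewrite (_ : (\int[leb]_r _ = \int[leb]_r (g `|r|)%:E)%E); last first.
  apply: eq_integral => r _; rewrite /g; congr EFin.
  (* At the origin both sides are 0: a nonzero power of 0 is 0 by convention. *)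
  have [->|r0] := eqVneq r 0.
    by rewrite normr0 ltxx ler01 powR0// oppr_eq0 gt_eqF.
  by rewrite normr_gt0 r0.
apply: (le_trans (ge0_integral_normr_le _ _)).
- apply: measurable_fun_ifT => //.
  by apply: measurable_and; [exact: measurable_fun_ltr|exact: measurable_fun_ler].
- by move=> r; rewrite /g; case: ifP => // _; exact: powR_ge0.
- by rewrite EFinM lee_pmul2l//; exact: integral_powRN_near0.
Qed.

(** Outside the unit interval the power is at most 1, so the singularity contributes 2 / (1 - b) and
    the rest at most the length of the window. The bound does not depend on z, which is where
    uniformity in the localization originates. *)
Lemma integral_near b z rho : 0 < b -> b < 1 -> 0 <= rho ->
  (\int[leb]_r (if (`|r - z| <= rho)%R then `|r| `^ (- b) else 0)%:E <= (2 / (1 - b) + 2 * rho)%:E)%E.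
Proof.
move=> b0 b1 rho0; have n0 := integral_abs_near b0 b1.
have mb : measurable_fun [set: R] (fun r : R => `|r| `^ (- b)).
  by have := measurable_abs_powR (- b) 0; under eq_fun do rewrite subr0.
have m1 : measurable_fun [set: R] (fun r : R => if `|r| <= 1 then `|r| `^ (- b) else 0).
  by have := measurable_if_absB 0 1 mb; under eq_fun do rewrite subr0.
have m2 : measurable_fun [set: R] (fun r : R => if `|r - z| <= rho then 1 else 0 : R).
  by apply: measurable_if_absB.
have m3 := measurable_if_absB z rho mb.
rewrite EFinD -(integral_absB_le z rho0).
apply: (@le_trans _ _ (\int[leb]_r ((if (`|r| <= 1)%R then `|r| `^ (- b) else 0)%:E +
   (if (`|r - z| <= rho)%R then 1 else 0)%:E))%E).
  apply: ge0_le_integral => //.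
  - by move=> r _; rewrite lee_fin; case: ifP => // _; exact: powR_ge0.
  - by apply/measurable_EFinP; exact: m3.
  - by apply: emeasurable_funD; apply/measurable_EFinP; [exact: m1|exact: m2].
  - move=> r _; rewrite -EFinD lee_fin; case: ifPn => h1; case: ifPn => h2; rewrite ?addr0 ?add0r//.
      by rewrite lerDl.
    rewrite -ltNge in h2; rewrite powRN invf_le1 ?powR_gt0 ?(lt_trans _ h2)//.
    by rewrite -[X in X <= _](powRr0 `|r|) ler_powR ?ltW.
rewrite ge0_integralD//.
- by rewrite leeD2r.
- by move=> r _; rewrite lee_fin; case: ifP => // _; exact: powR_ge0.
- by apply/measurable_EFinP; exact: m1.
- by move=> r _; rewrite lee_fin; case: ifP.
- by apply/measurable_EFinP; exact: m2.
Qed.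

Lemma integral_oneD_abs b : 1 < b ->
  (\int[leb]_r ((1 + `|r|) `^ (- b))%:E <= (2 + 2 / (b - 1))%:E)%E.
Proof.
move=> b1; pose g r : R := if 1 <= r then r `^ (- b) else 0.
have mg : measurable_fun [set: R] g.
  by apply: measurable_fun_ifT => //; exact: measurable_fun_ler.
have g0 r : 0 <= g r by rewrite /g; case: ifP => // _; exact: powR_ge0.
have mgn : measurable_fun [set: R] (fun r : R => g `|r|).
  by apply: (measurableT_comp mg); apply: continuous_measurable_fun => r; exact: norm_continuous.
have m2 : measurable_fun [set: R] (fun r : R => if `|r - 0| <= 1 then 1 else 0 : R).
  by apply: measurable_if_absB.
rewrite (EFinD 2); have := integral_absB_le 0 ler01; rewrite mulr1 => <-.
apply: (@le_trans _ _ (\int[leb]_r ((if (`|r - 0| <= 1)%R then 1 else 0)%:E + (g `|r|)%:E))%E).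
  apply: ge0_le_integral => //.
  - apply/measurable_EFinP; apply: (measurableT_comp (measurable_powR (- b))).
    by apply: measurable_funD => //; exact: measurableT_comp.
  - by apply: emeasurable_funD; apply/measurable_EFinP; [exact: m2|exact: mgn].
  - move=> r _; rewrite -EFinD lee_fin subr0 /g.
    have p1 : (1 + `|r|) `^ (- b) <= 1.
      by rewrite powRN invf_le1 ?powR_gt0 ?ltr_pwDl// -[X in X <= _](powRr0 (1 + `|r|)) ler_powR ?lerDl// ltW// (lt_trans ltr01).
    case: ifPn => h1.
      by rewrite (le_trans p1)// lerDl g0.
    rewrite -ltNge in h1; rewrite (ltW h1) add0r !powRN lef_pV2 ?posrE ?powR_gt0 ?ltr_pwDl// ?(lt_trans _ h1)//.
    by rewrite ge0_ler_powR ?nnegrE ?addr_ge0 ?lerDr// (le_trans ler01)// ltW.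
rewrite ge0_integralD//.
- rewrite leeD2l//; apply: (le_trans (ge0_integral_normr_le mg g0)).
  by rewrite EFinM lee_pmul2l//; exact: integral_powRN_tail.
- by move=> r _; rewrite lee_fin; case: ifP.
- by apply/measurable_EFinP; exact: m2.
- by move=> r _; rewrite lee_fin.
- by apply/measurable_EFinP; exact: mgn.
Qed.

(** For c in [0, 1] and k >= 1 one has k^c <= k, so comparison constants come out free of
    exponents. *)
Lemma powRN_le_mul (k u v c : R) : 0 <= c -> c <= 1 -> 1 <= k -> 0 < v -> v <= k * u ->
  u `^ (- c) <= k * v `^ (- c).
Proof.
move=> c0 c1 k1 v0 vku; have k0 : 0 < k by rewrite (lt_le_trans ltr01).
have u0 : 0 < u by rewrite -(pmulr_rgt0 _ k0) (lt_le_trans v0).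
rewrite !powRN -[leLHS]mul1r ler_pdivrMr ?powR_gt0// mulrAC ler_pdivlMr ?powR_gt0// mul1r.
rewrite (@le_trans _ _ ((k * u) `^ c))//.
  by apply: ge0_ler_powR => //; rewrite nnegrE ltW// mulr_gt0.
by rewrite powRM ?(ltW u0) ?(ltW k0)// ler_wpM2r ?powR_ge0// ler1_powR.
Qed.

(** * Riesz potentials of powers on the line *)

Section riesz.
Variables l a : R.
Hypotheses (l0 : 0 < l) (la : l < a) (a1 : a < 1).

Let a0 : 0 < a. Proof. exact: lt_trans la. Qed.
Let l1 : l < 1. Proof. exact: lt_trans a1. Qed.

(** The three terms bound the integral of [kernel] near 0, near 1 and in the tail; the factors 2, 2
    and 25 are those of [kernel_le]. *)
Definition riesz_cst : R :=
  2 * (2 / (1 - a)) + (2 * (2 / l) + 25 * (2 + 2 / (a - l))).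

Let kernel r : R := `|r - 1| `^ (- (1 - l)) * `|r| `^ (- a).

Let measurable_kernel : measurable_fun [set: R] kernel.
Proof.
apply: measurable_funM; first exact: measurable_abs_powR.
by have := measurable_abs_powR (- a) 0; under eq_fun do rewrite subr0.
Qed.

(** Within 1/2 of one singularity the other factor is at most 2. Elsewhere both |r| and |r - 1| are
    at least (1 + |r|) / 5, and the two exponents add up to 1 + (a - l), which is integrable at
    infinity. *)
Let kernel_le r : kernel r <=
  2 * (if `|r - 0| <= 1 then `|r| `^ (- a) else 0) +
  (2 * (if `|r - 1| <= 1 then `|r - 1| `^ (- (1 - l)) else 0) +
  25 * (1 + `|r|) `^ (- (1 + (a - l)))).
Proof.
rewrite subr0 /kernel.
have t0 : 0 <= 25 * (1 + `|r|) `^ (- (1 + (a - l))) :> R.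
  by rewrite mulr_ge0// powR_ge0.
have n0 : 0 <= 2 * (if `|r| <= 1 then `|r| `^ (- a) else 0).
  by rewrite mulr_ge0//; case: ifP => // _; exact: powR_ge0.
have n1 : 0 <= 2 * (if `|r - 1| <= 1 then `|r - 1| `^ (- (1 - l)) else 0).
  by rewrite mulr_ge0//; case: ifP => // _; exact: powR_ge0.
have b0 : 0 <= 1 - l by rewrite subr_ge0 ltW.
have b1 : 1 - l <= 1 by rewrite gerBl ltW.
have tri : `|r| <= `|r - 1| + 1.
  by rewrite -[X in `|X| <= _](subrK 1 r) (le_trans (ler_normD _ _))// normr1.
have tri2 : 1 <= `|r - 1| + `|r|.
  by rewrite distrC -[leLHS]normr1 -[X in `|X| <= _](subrK r 1) ler_normD.
have [h|h] := leP `|r| 2^-1.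
  rewrite -[leLHS]addr0 lerD ?addr_ge0//.
  have -> : `|r| <= 1 by lra.
  rewrite ler_wpM2r ?powR_ge0//.
  have := @powRN_le_mul 2 `|r - 1| 1 (1 - l) b0 b1; rewrite powR1 mulr1; apply => //; lra.
have [h1|h1] := leP `|r - 1| 2^-1.
  rewrite -[leLHS]add0r lerD// -[leLHS]addr0 lerD//.
  have -> : `|r - 1| <= 1 by lra.
  rewrite mulrC ler_wpM2r ?powR_ge0//.
  have := @powRN_le_mul 2 `|r| 1 a (ltW a0) (ltW a1); rewrite powR1 mulr1; apply => //; lra.
rewrite -[leLHS]add0r lerD// -[leLHS]add0r lerD//.
have v0 : 0 < 1 + `|r| by rewrite ltr_pwDl.
have e : (1 + `|r|) `^ (- (1 + (a - l))) = (1 + `|r|) `^ (- (1 - l)) * (1 + `|r|) `^ (- a).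
  rewrite -powRD; last by rewrite (gt_eqF v0) implybT.
  by congr (_ `^ _); ring.
rewrite e (_ : 25 * _ = (5 * (1 + `|r|) `^ (- (1 - l))) * (5 * (1 + `|r|) `^ (- a))); last by ring.
apply: ler_pM; rewrite ?powR_ge0//; apply: powRN_le_mul => //; try lra.
- exact: ltW.
- exact: ltW.
Qed.

Let integral_kernel : (\int[leb]_r (kernel r)%:E <= riesz_cst%:E)%E.
Proof.
have m0 : measurable_fun [set: R] (fun r : R => `|r| `^ (- a)).
  by have := measurable_abs_powR (- a) 0; under eq_fun do rewrite subr0.
pose f0 r : R := if `|r - 0| <= 1 then `|r| `^ (- a) else 0.
pose f1 r : R := if `|r - 1| <= 1 then `|r - 1| `^ (- (1 - l)) else 0.
pose f2 r : R := (1 + `|r|) `^ (- (1 + (a - l))).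
have mf0 : measurable_fun [set: R] f0 by apply: measurable_if_absB.
have mf1 : measurable_fun [set: R] f1.
  by apply: measurable_if_absB; exact: measurable_abs_powR.
have mf2 : measurable_fun [set: R] f2.
  apply: (measurableT_comp (measurable_powR _)).
  by apply: measurable_funD => //; exact: measurableT_comp.
have f00 r : 0 <= f0 r by rewrite /f0; case: ifP => // _; exact: powR_ge0.
have f10 r : 0 <= f1 r by rewrite /f1; case: ifP => // _; exact: powR_ge0.
have f20 r : 0 <= f2 r by exact: powR_ge0.
apply: (@le_trans _ _ (\int[leb]_r ((2 * f0 r)%:E + ((2 * f1 r)%:E + (25 * f2 r)%:E)))%E).
  apply: ge0_le_integral => //.
  - by move=> r _; rewrite lee_fin mulr_ge0 ?powR_ge0.
  - by apply/measurable_EFinP; exact: measurable_kernel.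
  - apply: emeasurable_funD; [|apply: emeasurable_funD];
      apply/measurable_EFinP; apply: measurable_funM => //.
  - by move=> r _; rewrite -!EFinD lee_fin; exact: kernel_le.
have mZ k (f : R -> R) : measurable_fun [set: R] f ->
    measurable_fun [set: measurableTypeR R] (fun r => (k * f r)%:E).
  by move=> mf; apply/measurable_EFinP; apply: measurable_funM.
have Z k (f : R -> R) : measurable_fun [set: R] f -> 0 <= k -> (forall r, 0 <= f r) ->
    (\int[leb]_r (k * f r)%:E = k%:E * \int[leb]_r (f r)%:E)%E.
  move=> mf k0 f0'; under eq_integral do rewrite EFinM.
  rewrite ge0_integralZl//.
  - by apply/measurable_EFinP; exact: mf.
  - by move=> r _; rewrite lee_fin.
rewrite ge0_integralD//; first last.
- by apply: emeasurable_funD; exact: mZ.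
- by move=> r _; rewrite -EFinD lee_fin addr_ge0// mulr_ge0.
- exact: mZ.
- by move=> r _; rewrite lee_fin mulr_ge0.
rewrite ge0_integralD//; first last.
- exact: mZ.
- by move=> r _; rewrite lee_fin mulr_ge0.
- exact: mZ.
- by move=> r _; rewrite lee_fin mulr_ge0.
rewrite !Z// /riesz_cst (EFinD (2 * (2 / (1 - a)))) (EFinD (2 * (2 / l))).
rewrite [(2 * (2 / (1 - a)))%:E]EFinM [(2 * (2 / l))%:E]EFinM (EFinM 25).
apply: leeD; [|apply: leeD].
- rewrite lee_pmul2l// /f0; under eq_integral do rewrite subr0.
  by exact: integral_abs_near.
- rewrite lee_pmul2l// /f1.
  rewrite (@ge0_integral_shift 1 (fun r => if `|r| <= 1 then `|r| `^ (- (1 - l)) else 0)).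
  + apply: (le_trans (integral_abs_near _ _)); rewrite ?subr_gt0 ?gerBl//; first by rewrite gtrBl.
    by rewrite subKr.
  + by have := measurable_if_absB 0 1 (measurable_abs_powR (- (1 - l)) 0); under eq_fun do rewrite subr0.
  + by move=> r; case: ifP => // _; exact: powR_ge0.
- rewrite lee_pmul2l//; apply: (le_trans (integral_oneD_abs _)).
    by rewrite ltrDl subr_gt0.
  by rewrite [1 + (a - l) - 1]addrAC subrr add0r.
Qed.

(** Homogeneity: the dilation by y pulls out the power |y|^(l - a) and leaves the integral of
    [kernel], the case y = 1. *)
Lemma integral_riesz y : y != 0 ->
  (\int[leb]_r (`|y - r| `^ (- (1 - l)) * `|r| `^ (- a))%:E <= (riesz_cst * `|y| `^ (- (a - l)))%:E)%E.
Proof.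
move=> y0; have y0' : 0 < `|y| by rewrite normr_gt0.
have e r : `|y - r| `^ (- (1 - l)) * `|r| `^ (- a) = `|y| `^ (- (1 - l) - a) * kernel (y^-1 * r + 0).
  rewrite /kernel addr0.
  have -> : `|y - r| = `|y| * `|y^-1 * r - 1|.
    by rewrite -normrM mulrBr mulr1 mulVKf// distrC.
  have -> : `|r| = `|y| * `|y^-1 * r| by rewrite -normrM mulVKf.
  rewrite !powRM// powRD ?(gt_eqF y0') ?implybT//.
  by rewrite mulrACA.
under eq_integral do rewrite e EFinM.
rewrite ge0_integralZl//; first last.
- by move=> r _; rewrite lee_fin mulr_ge0 ?powR_ge0.
- apply/measurable_EFinP; apply: (measurableT_comp measurable_kernel).
  by apply: measurable_funD => //; exact: measurable_funM.
rewrite (ge0_integral_lebesgue_affine (f := EFin \o kernel) 0)//=; first last.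
- by move=> r; rewrite lee_fin mulr_ge0 ?powR_ge0.
- by apply/measurable_EFinP; exact: measurable_kernel.
- by rewrite invr_neq0.
rewrite normfV invrK muleA -EFinM.
have -> : `|y| `^ (- (1 - l) - a) * `|y| = `|y| `^ (- (a - l)).
  rewrite -[X in _ * X]powRr1// -powRD ?(gt_eqF y0') ?implybT//; congr (_ `^ _); ring.
by rewrite [riesz_cst * _]mulrC EFinM lee_pmul2l// lte_fin powR_gt0.
Qed.

End riesz.

Lemma measurable_riesz_near l a y z rho : measurable_fun [set: R]
  (fun r : R => `|y - r| `^ (- (1 - l)) * (if `|r - z| <= rho then `|r| `^ (- a) else 0)).
Proof.
apply: measurable_funM.
  by have := measurable_abs_powR (- (1 - l)) y; under eq_fun do rewrite distrC.
apply: measurable_if_absB.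
by have := measurable_abs_powR (- a) 0; under eq_fun do rewrite subr0.
Qed.

(** Near z the full Riesz potential is an upper bound, locally p-integrable because (a - l) p < 1.
    Far from z the potential of a window decays like |y - z|^(l - 1), p-integrable at infinity
    because (1 - l) p > 1. At y = 0 the conventional value of a power of 0 would not bound the
    singular integral. *)
Lemma riesz_near_bound l a p rho : 0 < l -> l < a -> a < 1 -> 0 < p ->
  (a - l) * p < 1 -> 1 < (1 - l) * p -> 1 <= rho ->
  exists C : R, forall z, exists J : R -> R,
    [/\ measurable_fun [set: R] J, forall y, 0 <= J y,
     (\int[leb]_y (J y `^ p)%:E <= C%:E)%E &
     forall y, y != 0 -> (\int[leb]_r (`|y - r| `^ (- (1 - l)) *
       (if (`|r - z| <= rho)%R then `|r| `^ (- a) else 0))%:E <= (J y)%:E)%E].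
Proof.
move=> l0 la a1 p0 alp lp rho1.
have rho0 : 0 <= rho by rewrite (le_trans ler01).
have a0 : 0 < a := lt_trans l0 la.
have l1 : l < 1 := lt_trans la a1.
pose A := riesz_cst l a; pose B := 4 * (2 / (1 - a) + 2 * rho).
have A0 : 0 <= A.
  rewrite /A /riesz_cst; apply: addr_ge0; [|apply: addr_ge0]; apply: mulr_ge0 => //.
  - by rewrite divr_ge0// subr_ge0 ltW.
  - by rewrite divr_ge0// ltW.
  - by rewrite addr_ge0// divr_ge0// subr_ge0 ltW.
have B0 : 0 <= B.
  apply: mulr_ge0 => //; apply: addr_ge0; last by rewrite mulr_ge0.
  by rewrite divr_ge0// subr_ge0 ltW.
exists (A `^ p * (2 / (1 - (a - l) * p) + 2 * (2 * rho)) +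
        B `^ p * (2 + 2 / ((1 - l) * p - 1))) => z.
(* The radius 2 rho separates y from the window of radius rho in the second branch. *)
pose J y : R := if `|y - z| <= 2 * rho then A * `|y| `^ (- (a - l))
                else B * (1 + `|y - z|) `^ (- (1 - l)).
have mabs b : measurable_fun [set: R] (fun r : R => `|r| `^ b).
  by have := measurable_abs_powR b 0; under eq_fun do rewrite subr0.
have m1D b : measurable_fun [set: R] (fun r : R => (1 + `|r|) `^ b).
  apply: (measurableT_comp (measurable_powR b)).
  by apply: measurable_funD => //; exact: measurableT_comp.
have m1Dz b : measurable_fun [set: R] (fun r : R => (1 + `|r - z|) `^ b).
  apply: (measurableT_comp (measurable_powR b)).
  by apply: measurable_funD => //; apply: measurableT_comp => //; exact: measurable_funB.
have mJ : measurable_fun [set: R] J.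
  apply: measurable_fun_ifT; first exact: measurable_absB_le.
  - by apply: measurable_funM => //; exact: mabs.
  - by apply: measurable_funM => //; exact: m1Dz.
have J0 y : 0 <= J y.
  by rewrite /J; case: ifP => _; rewrite mulr_ge0 ?powR_ge0.
exists J; split => //.
  pose f0 r : R := if `|r - z| <= 2 * rho then `|r| `^ (- ((a - l) * p)) else 0.
  pose f1 r : R := (1 + `|r - z|) `^ (- ((1 - l) * p)).
  have mf0 : measurable_fun [set: R] f0 by apply: measurable_if_absB; exact: mabs.
  have mf1 : measurable_fun [set: R] f1 by exact: m1Dz.
  have f00 r : 0 <= f0 r by rewrite /f0; case: ifP => // _; exact: powR_ge0.
  have f10 r : 0 <= f1 r by exact: powR_ge0.
  have Z k (f : R -> R) : measurable_fun [set: R] f -> 0 <= k -> (forall r, 0 <= f r) ->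
      (\int[leb]_r (k * f r)%:E = k%:E * \int[leb]_r (f r)%:E)%E.
    move=> mf k0 f0'; under eq_integral do rewrite EFinM.
    rewrite ge0_integralZl//.
    - by apply/measurable_EFinP; exact: mf.
    - by move=> r _; rewrite lee_fin.
  have mZ k (f : R -> R) : measurable_fun [set: R] f ->
      measurable_fun [set: measurableTypeR R] (fun r => (k * f r)%:E).
    by move=> mf; apply/measurable_EFinP; apply: measurable_funM.
  apply: (@le_trans _ _ (\int[leb]_r ((A `^ p * f0 r)%:E + (B `^ p * f1 r)%:E))%E).
    apply: ge0_le_integral => //.
    - by move=> r _; rewrite lee_fin powR_ge0.
    - apply/measurable_EFinP; apply: (measurableT_comp (measurable_powR p)); exact: mJ.
    - by apply: emeasurable_funD; exact: mZ.
    - move=> r _; rewrite -EFinD lee_fin /J /f0 /f1; case: ifPn => h.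
        rewrite powRM ?powR_ge0// -powRrM mulNr lerDl.
        by rewrite mulr_ge0 ?powR_ge0.
      by rewrite powRM ?powR_ge0// -powRrM mulNr mulr0 add0r.
  rewrite ge0_integralD//; first last.
  - exact: mZ.
  - by move=> r _; rewrite lee_fin mulr_ge0 ?powR_ge0.
  - exact: mZ.
  - by move=> r _; rewrite lee_fin mulr_ge0 ?powR_ge0.
  rewrite !Z ?powR_ge0// EFinD !(EFinM (_ `^ p)); apply: leeD.
    apply: lee_wpmul2l; first by rewrite lee_fin powR_ge0.
    apply: integral_near => //; last by rewrite mulr_ge0.
    by rewrite mulr_gt0// subr_gt0.
  apply: lee_wpmul2l; first by rewrite lee_fin powR_ge0.
  rewrite (@ge0_integral_shift z (fun r => (1 + `|r|) `^ (- ((1 - l) * p)))) //.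
  exact: integral_oneD_abs.
move=> y y0; rewrite /J; case: ifPn => h.
  apply: le_trans (integral_riesz l0 la a1 y0).
  apply: ge0_le_integral => //.
  - by move=> r _; rewrite lee_fin mulr_ge0 ?powR_ge0//; case: ifP => // _; exact: powR_ge0.
  - by apply/measurable_EFinP; exact: measurable_riesz_near.
  - apply/measurable_EFinP; apply: measurable_funM; last exact: mabs.
    by have := measurable_abs_powR (- (1 - l)) y; under eq_fun do rewrite distrC.
  - move=> r _; rewrite lee_fin; apply: ler_wpM2l; first exact: powR_ge0.
    by case: ifP => // _; exact: powR_ge0.
rewrite -ltNge in h.
pose f r : R := if `|r - z| <= rho then `|r| `^ (- a) else 0.
have mf : measurable_fun [set: R] f by apply: measurable_if_absB; exact: mabs.
have f0 r : 0 <= f r by rewrite /f; case: ifP => // _; exact: powR_ge0.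
apply: (@le_trans _ _ (\int[leb]_r ((4 * (1 + `|y - z|) `^ (- (1 - l)))%:E * (f r)%:E))%E).
  apply: ge0_le_integral => //.
  - by move=> r _; rewrite lee_fin mulr_ge0 ?powR_ge0//; exact: f0.
  - by apply/measurable_EFinP; exact: measurable_riesz_near.
  - under eq_fun do rewrite -EFinM.
    by apply/measurable_EFinP; apply: measurable_funM.
  - move=> r _; rewrite -EFinM lee_fin /f; case: ifPn => h1; last by rewrite !mulr0.
    apply: ler_wpM2r; first exact: powR_ge0.
    have tri : `|y - z| <= `|y - r| + `|r - z| := ler_distD r y z.
    have v0 : 0 < `|y - z| by apply: le_lt_trans h; rewrite mulr_ge0.
    (* Here |y - r| exceeds |y - z| / 2, and |y - z| > 2 because rho >= 1; so 4 |y - r| also absorbs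
       the summand 1. *)
    have key (u v w : R) : v <= u + w -> w <= rho -> 2 * rho < v -> 1 + v <= 4 * u.
      by lra.
    apply: powRN_le_mul => //.
    + by rewrite subr_ge0 ltW.
    + by rewrite gerBl ltW.
    + by rewrite ler1n.
    + exact: key tri h1 h.
rewrite ge0_integralZl//; first last.
- by move=> r _; rewrite lee_fin.
- by apply/measurable_EFinP; exact: mf.
rewrite [B * _](_ : _ = 4 * (1 + `|y - z|) `^ (- (1 - l)) * (2 / (1 - a) + 2 * rho)).
  2: by rewrite /B mulrAC.
rewrite [leRHS]EFinM; apply: lee_wpmul2l; first by rewrite lee_fin mulr_ge0// powR_ge0.
exact: integral_near.
Qed.

End power_integrals.

(** * Bessel kernel *)

Section gamma_kernel.
Context (R : realType).
Local Notation leb := (@lebesgue_measure R).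
Implicit Types a tau r : R.

(** The integrand of Euler's Gamma integral, extended by 0 so that averages over tau run over the
    whole line. *)
Definition gamma_kernel a tau : R :=
  if 0 < tau then tau `^ (a - 1) * expR (- tau) else 0.

Lemma gamma_kernel_ge0 a tau : 0 <= gamma_kernel a tau.
Proof. by rewrite /gamma_kernel; case: ifP => // _; rewrite mulr_ge0 ?powR_ge0 ?expR_ge0. Qed.

Lemma measurable_gamma_kernel a : measurable_fun [set: R] (gamma_kernel a).
Proof.
apply: measurable_fun_ifT => //; first exact: measurable_fun_ltr.
apply: measurable_funM; first exact: measurable_powR.
by apply: continuous_measurable_fun => r; apply: continuous_comp; [exact: opp_continuous|exact: continuous_expR].
Qed.

(** The inequality 1 + u <= exp u at u = tau / (k+1), raised to the power k+1. It converts
    exponential decay into powers in the tail of the Gamma integral. *)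
Lemma oneD_exprn_le_expR tau (k : nat) : 0 <= tau ->
  (1 + tau) ^+ k.+1 <= k.+1%:R ^+ k.+1 * expR tau.
Proof.
move=> t0.
have h : 1 + tau <= k.+1%:R * expR (tau / k.+1%:R).
  have := expR_ge1Dx (tau / k.+1%:R).
  have k1 : 1 <= k.+1%:R :> R by rewrite ler1n.
  have k0 : 0 < k.+1%:R :> R by [].
  rewrite -(ler_pM2l k0) mulrDr mulr1 mulrCA divff ?gt_eqF// mulr1.
  by apply: le_trans; rewrite lerD2r.
have -> : expR tau = expR (tau / k.+1%:R) ^+ k.+1.
  by rewrite -expRM_natl mulrCA divff ?mulr1// gt_eqF.
by rewrite -exprMn lerXn2r ?nnegrE// ?addr_ge0// mulr_ge0 ?expR_ge0.
Qed.

Lemma integral_gamma_kernel_lty a : 0 < a -> (\int[leb]_tau (gamma_kernel a tau)%:E < +oo)%E.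
Proof.
move=> a0; pose N := Num.bound `|a|.
(* Of N + 2 powers of 1 + tau gained from the exponential, N absorb tau^(a-1) and two give
   integrability at infinity. *)
pose c : R := N.+2%:R ^+ N.+2.
have c0 : 0 <= c by rewrite exprn_ge0.
pose f0 r : R := if 0 < r <= 1 then r `^ (- (1 - a)) else 0.
pose f1 r : R := (1 + `|r|) `^ (- 2).
have mf0 : measurable_fun [set: R] f0.
  apply: measurable_fun_ifT => //.
  by apply: measurable_and; [exact: measurable_fun_ltr|exact: measurable_fun_ler].
have mf1 : measurable_fun [set: R] f1.
  apply: (measurableT_comp (measurable_powR _)).
  by apply: measurable_funD => //; exact: measurableT_comp.
have f00 r : 0 <= f0 r by rewrite /f0; case: ifP => // _; exact: powR_ge0.
have f10 r : 0 <= f1 r by exact: powR_ge0.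
have mcf1 : measurable_fun [set: measurableTypeR R] (fun r => (c * f1 r)%:E).
  by apply/measurable_EFinP; apply: measurable_funM.
apply: (@le_lt_trans _ _ (\int[leb]_r ((f0 r)%:E + (c * f1 r)%:E))%E).
  apply: ge0_le_integral => //.
  - by move=> r _; rewrite lee_fin gamma_kernel_ge0.
  - by apply/measurable_EFinP; exact: measurable_gamma_kernel.
  - by apply: emeasurable_funD => //; apply/measurable_EFinP; exact: mf0.
  move=> r _; rewrite -EFinD lee_fin /gamma_kernel; case: ifPn => [r0|_]; last first.
    by rewrite addr_ge0// mulr_ge0.
  have [r1|r1] := leP r 1.
    have -> : f0 r = r `^ (a - 1) by rewrite /f0 r0 r1 opprB.
    rewrite -[leLHS]addr0; apply: lerD; last exact: mulr_ge0.
    by rewrite ler_piMr ?powR_ge0// -expR0 ler_expR oppr_le0 ltW.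
  rewrite -[leLHS]add0r; apply: lerD => //; rewrite /f1 gtr0_norm//.
  have p0 : 0 < 1 + r by rewrite addr_gt0.
  rewrite powR_invn; last exact: ltW.
  rewrite ler_pdivlMr ?exprn_gt0// expRN -mulrA [_^-1 * _]mulrC mulrA ler_pdivrMr ?expR_gt0//.
  apply: le_trans (oneD_exprn_le_expR N.+1 (ltW r0)).
  rewrite -[in leRHS]addn2 exprD ler_wpM2r ?exprn_ge0 ?(ltW p0)//.
  apply: (@le_trans _ _ (r ^+ N)).
    rewrite -powR_mulrn; last exact: ltW.
    apply: ler_powR; first exact: ltW.
    rewrite (@le_trans _ _ `|a|)//; last by rewrite ltW// archi_boundP.
    by rewrite (le_trans _ (ler_norm a))// gerBl.
  by rewrite lerXn2r ?nnegrE ?(ltW p0) ?(ltW r0)// lerDr.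
rewrite ge0_integralD//; first last.
- by move=> r _; rewrite lee_fin mulr_ge0.
- by apply/measurable_EFinP; exact: mf0.
- by move=> r _; rewrite lee_fin.
apply: lte_add_pinfty.
  by apply: (le_lt_trans (integral_powRN_near0 _)); rewrite ?ltry// gtrBl.
under eq_integral do rewrite EFinM.
rewrite ge0_integralZl//; first last.
- by move=> r _; rewrite lee_fin.
- by apply/measurable_EFinP; exact: mf1.
rewrite lte_mul_pinfty//.
by apply: (le_lt_trans (integral_oneD_abs _)); rewrite ?ltry// ltr1n.
Qed.

(** A bound on one dyadic window of times; with h = r^2 it selects the heat times that matter at
    spatial scale r. *)
Lemma gamma_kernel_ge a h tau : 0 < a -> 0 < h -> h <= tau <= 2 * h ->
  h `^ a / (2 * h) * expR (- (2 * h)) <= gamma_kernel a tau.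
Proof.
move=> a0 h0 /andP[h1 h2]; have t0 : 0 < tau by exact: lt_le_trans h1.
rewrite /gamma_kernel t0; apply: ler_pM.
- by rewrite divr_ge0 ?powR_ge0// mulr_ge0// ltW.
- exact: expR_ge0.
- rewrite powRB; last by rewrite (gt_eqF t0) implybT.
  rewrite powRr1 ?(ltW t0)//; apply: ler_pM.
  + exact: powR_ge0.
  + by rewrite invr_ge0 mulr_ge0// ltW.
  + by apply: ge0_ler_powR => //; rewrite ?nnegrE ltW.
  + by rewrite lef_pV2 ?posrE// mulr_gt0.
- by rewrite ler_expR lerN2.
Qed.

Lemma gamma_kernel_scale a c tau : 0 < c ->
  gamma_kernel a (c * tau) = c `^ (a - 1) * (gamma_kernel a tau * expR (- (tau * (c - 1)))).
Proof.
move=> c0; rewrite /gamma_kernel pmulr_rgt0//; case: ifPn => [t0|]; last by rewrite mul0r mulr0.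
rewrite powRM ?(ltW c0) ?(ltW t0)// -!mulrA -expRD; congr (_ * (_ * expR _)); ring.
Qed.

(** For a > 0 this is Gamma(a). *)
Definition gamma_cst a : R := Rintegral leb setT (gamma_kernel a).

Lemma gamma_cstE a : 0 < a -> (\int[leb]_tau (gamma_kernel a tau)%:E = (gamma_cst a)%:E)%E.
Proof.
move=> a0; rewrite /gamma_cst /Rintegral fineK// ge0_fin_numE ?integral_gamma_kernel_lty//.
by apply: integral_ge0 => r _; rewrite lee_fin gamma_kernel_ge0.
Qed.

Lemma ge0_integral_ge_segment (f : R -> R) x y (b : R) : measurable_fun [set: R] f ->
  (forall r, 0 <= f r) -> x <= y -> 0 <= b -> (forall r, x <= r <= y -> b <= f r) ->
  ((b * (y - x))%:E <= \int[leb]_r (f r)%:E)%E.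
Proof.
move=> mf f0 xy b0 bf.
apply: (@le_trans _ _ (\int[leb]_(r in `[x, y]) (f r)%:E)%E); last first.
  apply: ge0_subset_integral => //.
  - by apply/measurable_EFinP; exact: mf.
  - by move=> r _; rewrite lee_fin.
apply: (@le_trans _ _ (\int[leb]_(r in `[x, y]) (cst b%:E r))%E).
  rewrite integral_cst//= lebesgue_measure_itv/= lte_fin.
  case: ifPn => [_|]; first by rewrite -EFinB EFinM.
  by rewrite -leNgt => yx; rewrite (_ : y - x = 0) ?mulr0 ?mule0//; apply/eqP; rewrite subr_eq0 eq_le yx xy.
apply: ge0_le_integral => //.
by apply: measurable_funTS; apply/measurable_EFinP; exact: mf.
Qed.

Lemma gamma_cst_gt0 a : 0 < a -> 0 < gamma_cst a.
Proof.
move=> a0; rewrite -lte_fin -gamma_cstE//.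
have b0 : 0 < 1 `^ a / (2 * 1) * expR (- (2 * 1)) :> R.
  by rewrite powR1 mulr_gt0 ?expR_gt0// divr_gt0.
apply: (@lt_le_trans _ _ ((1 `^ a / (2 * 1) * expR (- (2 * 1)) * (2 * 1 - 1))%:E)).
  by rewrite lte_fin mulr_gt0// mulr1; lra.
apply: ge0_integral_ge_segment.
- exact: measurable_gamma_kernel.
- exact: gamma_kernel_ge0.
- lra.
- exact: ltW.
- by move=> r hr; exact: gamma_kernel_ge.
Qed.

(** The substitution tau -> (1 + r) tau in the Gamma integral. At r = |xi|^2 it writes a negative
    Bessel weight as an average of Gaussians. *)
Lemma laplace_gamma_kernel a r : 0 < a -> 0 <= r ->
  (\int[leb]_tau (gamma_kernel a tau * expR (- (tau * r)))%:E =
   (gamma_cst a * (1 + r) `^ (- a))%:E)%E.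
Proof.
move=> a0 r0; have c0 : 0 < 1 + r by rewrite ltr_pwDl.
have h := @ge0_integral_lebesgue_affine R (1 + r) 0 (EFin \o gamma_kernel a).
have mg : measurable_fun [set: R] (fun tau : R => gamma_kernel a tau * expR (- (tau * r))).
  apply: measurable_funM; first exact: measurable_gamma_kernel.
  apply: (measurableT_comp (continuous_measurable_fun (@continuous_expR R))).
  by under eq_fun do rewrite -mulrN; apply: measurable_funM.
have {h} : (((1 + r) `^ (a - 1))%:E * (\int[leb]_tau (gamma_kernel a tau * expR (- (tau * r)))%:E) =
    ((1 + r)^-1)%:E * (gamma_cst a)%:E)%E.
  rewrite -gamma_cstE// -[in RHS](gtr0_norm c0) -h; first last.
  - by move=> t; rewrite lee_fin gamma_kernel_ge0.
  - by apply/measurable_EFinP; exact: measurable_gamma_kernel.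
  - by rewrite gt_eqF.
  rewrite -ge0_integralZl//; first last.
  - by rewrite lee_fin powR_ge0.
  - by move=> t _; rewrite lee_fin mulr_ge0 ?gamma_kernel_ge0 ?expR_ge0.
  - by apply/measurable_EFinP; exact: mg.
  apply: eq_integral => t _ /=; rewrite addr0 gamma_kernel_scale//.
  by rewrite [1 + r - 1]addrAC subrr add0r.
move=> h.
have p0 : 0 < (1 + r) `^ (a - 1) by rewrite powR_gt0.
set L := (\int[leb]_tau _)%E in h *.
have -> : L = ((((1 + r) `^ (a - 1))^-1)%:E * (((1 + r) `^ (a - 1))%:E * L))%E.
  by rewrite muleA -EFinM mulVf ?mul1e// lt0r_neq0.
rewrite h -!EFinM; congr EFin.
rewrite mulrA mulrC; congr (_ * _).
have -> : (1 + r) `^ (- a) = (1 + r) `^ (- (a - 1)) * (1 + r) `^ (- 1).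
  rewrite -powRD; last by rewrite (gt_eqF c0) implybT.
  by congr (_ `^ _); ring.
by rewrite powRN powR_inv1// ltW.
Qed.

End gamma_kernel.

(** * Domination of iterated integrals *)

Section dominated_fubini.
Context d1 d2 (T1 : measurableType d1) (T2 : measurableType d2) (R : realType).
Context (m1 : {sigma_finite_measure set T1 -> \bar R}).
Context (m2 : {sigma_finite_measure set T2 -> \bar R}).
Local Open Scope ereal_scope.

Lemma ge0_le_integral_nested (f h : T1 * T2 -> R) :
  measurable_fun setT f -> measurable_fun setT h -> (forall z, (0 <= f z)%R) ->
  (forall z, (f z <= h z)%R) ->
  \int[m1]_x \int[m2]_y (f (x, y))%:E <= \int[m1]_x \int[m2]_y (h (x, y))%:E.
Proof.
move=> mf mh f0 fh; have h0 z := le_trans (f0 z) (fh z).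
have mF (g : T1 * T2 -> R) : measurable_fun setT g -> (forall z, (0 <= g z)%R) ->
    measurable_fun setT (fun x => \int[m2]_y (g (x, y))%:E).
  move=> mg g0; apply: (@measurable_fun_fubini_tonelli_F _ _ _ _ _ m2 (EFin \o g)).
    exact/measurable_EFinP.
  by move=> z; rewrite lee_fin.
have mx (g : T1 * T2 -> R) x : measurable_fun setT g ->
    measurable_fun setT (fun y => (g (x, y))%:E).
  by move=> mg; apply/measurable_EFinP; exact: (measurableT_comp mg (@pair1_measurable _ _ _ _ x)).
apply: ge0_le_integral => //.
- by move=> x _; apply: integral_ge0 => y _; rewrite lee_fin.
- exact: mF.
- exact: mF.
- move=> x _; apply: ge0_le_integral => //.
  + by move=> y _; rewrite lee_fin.
  + exact: mx.
  + exact: mx.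
  + by move=> y _; rewrite lee_fin.
Qed.

Lemma normc_tensor_lty (f : T1 * T2 -> R[i]) (f1 : T1 -> R) (f2 : T2 -> R) :
  cmeasurable f -> measurable_fun setT f1 -> measurable_fun setT f2 ->
  (forall x, (0 <= f1 x)%R) -> (forall y, (0 <= f2 y)%R) ->
  (forall x y, (normc (f (x, y)) <= f1 x * f2 y)%R) ->
  \int[m1]_x (f1 x)%:E < +oo -> \int[m2]_y (f2 y)%:E < +oo ->
  \int[m1]_x \int[m2]_y (normc (f (x, y)))%:E < +oo.
Proof.
move=> mf mf1 mf2 f10 f20 fle if1 if2.
pose h (z : T1 * T2) : R := (f1 z.1 * f2 z.2)%R.
have mh : measurable_fun setT h.
  by apply: measurable_funM; [exact: (measurableT_comp mf1 measurable_fst)|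
    exact: (measurableT_comp mf2 measurable_snd)].
apply: (@le_lt_trans _ _ (\int[m1]_x \int[m2]_y (h (x, y))%:E)).
  apply: (ge0_le_integral_nested (f := fun z => normc (f z))) => //.
  - exact: cmeasurable_normc.
  - by move=> z; exact: normc_ge0.
  - by case=> x y; exact: fle.
rewrite /h /= ge0_integral_tensor// lte_mul_pinfty//.
  by apply: integral_ge0 => x _; rewrite lee_fin.
by rewrite ge0_fin_numE//; apply: integral_ge0 => x _; rewrite lee_fin.
Qed.

End dominated_fubini.

(** * The Bessel potential as an average of heat convolutions *)

Section bessel_kernel.
Context (R : realType) (n : nat).
Local Notation E := 'rV[R]_n.
Local Notation mu := (lebesgue_rV R n).
Local Notation leb := (@lebesgue_measure R).
Local Notation C := R[i].
Local Notation cst_ft := ((2 * pi) `^ (- (n%:R / 2)) : R).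
Implicit Types (phi : E -> C) (x xi y : E) (a tau m : R).

Lemma measurable_gaussn_joint :
  measurable_fun [set: measurableTypeR R * E] (fun z : measurableTypeR R * E => gaussn z.1 z.2).
Proof.
apply: (measurableT_comp (continuous_measurable_fun (@continuous_expR R))).
under eq_fun do rewrite -mulNr; apply: measurable_funM.
  by apply: measurableT_comp => //; exact: measurable_fst.
by apply: (measurableT_comp (@measurable_sqr_norm R n)); exact: measurable_snd.
Qed.

Lemma Rintegral_gamma_gaussn m xi : 0 < m ->
  Rintegral leb setT (fun tau => gamma_kernel (m / 2) tau * gaussn tau xi) =
  gamma_cst (m / 2) * bweight (- m) xi.
Proof.
move=> m0; have a0 : 0 < m / 2 by rewrite divr_gt0.
rewrite /Rintegral (laplace_gamma_kernel a0 (sqr_ge0 (euclid_norm xi))) /=.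
by rewrite /bweight mulNr.
Qed.

Lemma gamma_kernel_gaussn_le a tau xi :
  gamma_kernel a tau * gaussn tau xi <= gamma_kernel a tau.
Proof.
have [t0|t0] := leP tau 0; first by rewrite /gamma_kernel ltNge t0 /= mul0r.
by rewrite ler_piMr ?gamma_kernel_ge0// gaussn_le1// ltW.
Qed.

(** The Laplace formula replaces the weight by Gaussians, Fubini exchanges tau and xi, and for each
    tau > 0 the remaining frequency integral is the damped double transform of [ft_heat]. *)
Lemma bessel_potential_heat m phi x : 0 < m -> schwartz phi ->
  fourier (fun xi => bessel_weight (- m) xi * inv_fourier phi xi) x =
  ((gamma_cst (m / 2))^-1%:C)%C *
  cint leb (fun tau => ((gamma_kernel (m / 2) tau)%:C)%C *
    cint mu (fun y => ((heat tau (x - y))%:C)%C * phi y)).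
Proof.
move=> m0 sphi; have a0 : 0 < m / 2 by rewrite divr_gt0.
have G0 := gamma_cst_gt0 a0.
have iphi : cintegrable mu phi by exact: schwartz_cintegrable.
rewrite fourierE inv_fourierE; set psi := ft 1 phi.
have ipsi : cintegrable mu psi by apply: cintegrable_ft => //; rewrite mulr1.
pose e xi := expi (-1 * dotprod xi x) * psi xi.
have ie : cintegrable mu e by exact: cintegrable_expiM.
have [me ei] := ie.
pose f (z : measurableTypeR R * E) : C :=
  ((gamma_kernel (m / 2) z.1)%:C)%C * (((gaussn z.1 z.2)%:C)%C * e z.2).
have mf : cmeasurable f.
  apply: cmeasurableM.
    apply: cmeasurable_real; apply: measurableT_comp; last exact: measurable_fst.
    exact: measurable_gamma_kernel.
  apply: cmeasurableM; last exact: (cmeasurable_comp me measurable_snd).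
  by apply: cmeasurable_real; exact: measurable_gaussn_joint.
have fi : (\int[leb]_t \int[mu]_xi (normc (f (t, xi)))%:E < +oo)%E.
  apply: (normc_tensor_lty (m1 := leb) (m2 := mu) (f1 := gamma_kernel (m / 2)) (f2 := fun xi => normc (e xi))) => //.
  - exact: measurable_gamma_kernel.
  - exact: cmeasurable_normc.
  - exact: gamma_kernel_ge0.
  - by move=> xi; exact: normc_ge0.
  - move=> t xi; have -> : f (t, xi) = ((gamma_kernel (m / 2) t * gaussn t xi)%:C)%C * e xi.
      by rewrite /f /= mulrA -rmorphM.
    rewrite normcM normc_real ger0_norm ?mulr_ge0 ?gamma_kernel_ge0 ?gaussn_ge0//.
    by apply: ler_wpM2r; [exact: normc_ge0|exact: gamma_kernel_gaussn_le].
  - exact: integral_gamma_kernel_lty.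
have ig xi : cintegrable leb (fun t => ((gamma_kernel (m / 2) t * gaussn t xi)%:C)%C).
  apply: (@le_cintegrable _ (measurableTypeR R) R leb _ (gamma_kernel (m / 2))).
  - apply: cmeasurable_real; apply: measurable_funM; first exact: measurable_gamma_kernel.
    exact: (measurableT_comp measurable_gaussn_joint (@pair2_measurable _ _ _ _ xi)).
  - exact: measurable_gamma_kernel.
  - by move=> t; rewrite normc_real ger0_norm ?gamma_kernel_gaussn_le// mulr_ge0 ?gamma_kernel_ge0 ?gaussn_ge0.
  - exact: integral_gamma_kernel_lty.
have f1E t : ((gamma_kernel (m / 2) t)%:C)%C * cint mu (fun y => ((heat t (x - y))%:C)%C * phi y) =
    (cst_ft%:C)%C * cint mu (fun xi => f (t, xi)).
  (* For nonpositive times both sides vanish with [gamma_kernel]. *)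
  have [t0|t0] := leP t 0.
    have g0 : gamma_kernel (m / 2) t = 0 by rewrite /gamma_kernel ltNge t0.
    have -> : (fun xi => f (t, xi)) = fun xi => 0 * e xi.
      by apply/funext => xi; rewrite /f /= g0 !mul0r.
    by rewrite cintZ// g0 !mul0r mulr0.
  rewrite -(ft_heat x (sg := 1) _ t0 iphi) ?mulr1// /ft.
  have ie2 : cintegrable mu (fun xi => ((gaussn t xi)%:C)%C * e xi).
    apply: (cintegrable_bounded (k := 1)) => //.
      by apply: cmeasurable_real; exact: measurable_gaussn.
    by move=> xi; rewrite normc_real ger0_norm ?gaussn_ge0// gaussn_le1// ltW.
  rewrite /f /= cintZ// mulrCA; congr (_ * (_ * _)).
  by apply: eq_cint => xi; rewrite /e mulrCA.
have f2E xi : cint leb (fun t => f (t, xi)) =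
    ((gamma_cst (m / 2))%:C)%C * (bessel_weight (- m) xi * e xi).
  transitivity (cint leb (fun t => e xi * ((gamma_kernel (m / 2) t * gaussn t xi)%:C)%C)).
    by apply: eq_cint => t; rewrite /f /= mulrA mulrC; congr (_ * _); rewrite rmorphM.
  rewrite cintZ// cint_real Rintegral_gamma_gaussn// bessel_weightE rmorphM /=.
  by rewrite mulrC mulrA.
have -> : cint leb (fun t => ((gamma_kernel (m / 2) t)%:C)%C *
    cint mu (fun y => ((heat t (x - y))%:C)%C * phi y)) =
    cint leb (fun t => (cst_ft%:C)%C * cint mu (fun xi => f (t, xi))).
  by apply: eq_cint => t; exact: f1E.
rewrite cintZ; last exact: cintegrable_cint1.
rewrite cint_fubini//.
have -> : cint mu (fun xi => cint leb (fun t => f (t, xi))) =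
    cint mu (fun xi => ((gamma_cst (m / 2))%:C)%C * (bessel_weight (- m) xi * e xi)).
  by apply: eq_cint => xi; exact: f2E.
have ibe : cintegrable mu (fun xi => bessel_weight (- m) xi * e xi).
  rewrite (_ : (fun xi => _) = fun xi => expi (-1 * dotprod xi x) * (bessel_weight (- m) xi * psi xi)).
    exact: cintegrable_expiM (cintegrable_bweight_ft (- m) (mulr1 (1:R)) sphi).
  by apply/funext => xi; rewrite /e mulrCA.
rewrite (cintZ (((gamma_cst (m / 2))%:C)%C) ibe).
have inv1 (z : C) : (((gamma_cst (m / 2))^-1)%:C)%C * (((gamma_cst (m / 2))%:C)%C * z) = z.
  by rewrite mulrA -rmorphM /= mulVf ?mul1r// gt_eqF.
rewrite [RHS]mulrCA inv1 /ft; apply: (congr1 (fun z => _ * z)).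
by apply: eq_cint => xi; rewrite /e mulrCA.
Qed.

(** Square roots and inverses become real powers, so that joint measurability in (tau, x) follows
    from that of powers. The two forms need only agree for tau > 0, where [gamma_kernel] is
    nonzero. *)
Lemma gamma_heatE a tau x : gamma_kernel a tau * heat tau x =
  gamma_kernel a tau * (((4 * pi * tau) `^ (- 2^-1)) ^+ n * gaussn ((4 * tau) `^ (- 1)) x).
Proof.
rewrite /gamma_kernel; case: ifPn => [t0|_]; last by rewrite !mul0r.
have p0 := pi_gt0 R; congr (_ * _); rewrite /heat powR_inv1; last by rewrite mulr_ge0 ?(ltW t0).
by rewrite powRN powR12_sqrt// !mulr_ge0 ?(ltW t0) ?(ltW p0).
Qed.

Lemma gamma_heat_ge0 a tau x : 0 <= gamma_kernel a tau * heat tau x.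
Proof. by rewrite mulr_ge0 ?gamma_kernel_ge0 ?heat_ge0. Qed.

Lemma measurable_gamma_heat a : measurable_fun [set: measurableTypeR R * E]
  (fun z : measurableTypeR R * E => gamma_kernel a z.1 * heat z.1 z.2).
Proof.
under eq_fun do rewrite gamma_heatE.
have mpow (b c : R) : measurable_fun [set: measurableTypeR R * E]
    (fun z : measurableTypeR R * E => (c * z.1) `^ b).
  apply: (measurableT_comp (measurable_powR b)).
  by apply: measurable_funM => //; exact: measurable_fst.
apply: measurable_funM.
  by apply: measurableT_comp; [exact: measurable_gamma_kernel|exact: measurable_fst].
apply: measurable_funM; first by apply: measurable_funX; exact: mpow.
apply: (measurableT_comp (continuous_measurable_fun (@continuous_expR R))).
under eq_fun do rewrite -mulNr; apply: measurable_funM.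
  by apply: measurableT_comp => //; exact: mpow.
by apply: (measurableT_comp (@measurable_sqr_norm R n)); exact: measurable_snd.
Qed.

Lemma measurable_gamma_heat1 a x :
  measurable_fun [set: measurableTypeR R] (fun tau : R => gamma_kernel a tau * heat tau x).
Proof. exact: (measurableT_comp (measurable_gamma_heat a) (@pair2_measurable _ _ _ _ x)). Qed.

Lemma measurable_gamma_heat_shift a x : measurable_fun [set: measurableTypeR R * E]
  (fun z : measurableTypeR R * E => gamma_kernel a z.1 * heat z.1 (x - z.2)).
Proof.
apply: (measurableT_comp (measurable_gamma_heat a)
  (f := fun z : measurableTypeR R * E => gamma_kernel a z.1 * heat z.1 z.2)
  (g := fun z : measurableTypeR R * E => (z.1, x - z.2))).
apply: measurable_fun_pair; first exact: measurable_fst.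
rewrite (_ : (fun z => _) = fun z : measurableTypeR R * E => -1 *: z.2 + x); last first.
  by apply/funext => z; rewrite scaleN1r addrC.
apply: (measurableT_comp (@measurable_rV_affine R n (-1) x)); exact: measurable_snd.
Qed.

Lemma integral_gamma_heat_shift a x : 0 < a ->
  (\int[leb]_tau \int[mu]_y (gamma_kernel a tau * heat tau (x - y))%:E = (gamma_cst a)%:E)%E.
Proof.
move=> a0; rewrite -gamma_cstE//; apply: eq_integral => t _.
have [t0|t0] := leP t 0.
  rewrite /gamma_kernel ltNge t0 /= integral0_eq// => y _.
  by rewrite mul0r.
under eq_integral do rewrite EFinM.
rewrite ge0_integralZl//; first last.
- by rewrite lee_fin gamma_kernel_ge0.
- by move=> y _; rewrite lee_fin heat_ge0.
- apply/measurable_EFinP.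
  exact: (measurableT_comp (measurable_heat_prod t) (@pair1_measurable _ _ _ _ x)).
by rewrite integral_heat_shift// mule1.
Qed.

(* No integrability is assumed: [fine] sends both infinities to 0. *)
Lemma RintegralZr_ge0 (h : R -> R) (c : R) : measurable_fun [set: measurableTypeR R] h ->
  (forall r, 0 <= h r) ->
  Rintegral leb setT (fun r => h r * c) = Rintegral leb setT h * c.
Proof.
move=> mh h0; rewrite /Rintegral.
have mhE : measurable_fun [set: measurableTypeR R] (fun r => (h r)%:E) by exact/measurable_EFinP.
have pos (k : R) : 0 <= k -> (\int[leb]_r (h r * k)%:E = (\int[leb]_r (h r)%:E) * k%:E)%E.
  move=> k0; under eq_integral do rewrite EFinM.
  by rewrite ge0_integralZr// => r _; rewrite lee_fin.
have fineM (e : \bar R) (k : R) : fine (e * k%:E)%E = fine e * k.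
  have [->|k0] := eqVneq k 0; first by rewrite mule0 mulr0.
  case: e => [r| |] //=; rewrite mul0r.
    by case/lt_total/orP: k0 => k0; [rewrite lt0_mulye|rewrite gt0_mulye].
  by case/lt_total/orP: k0 => k0; [rewrite lt0_mulNye|rewrite gt0_mulNye].
have [c0|c0] := leP 0 c; first by rewrite pos// fineM.
rewrite -(opprK c) mulrN; under eq_integral do rewrite mulrN EFinN.
rewrite integral_ge0N; last by move=> r _; rewrite lee_fin mulr_ge0// oppr_ge0 ltW.
by rewrite pos ?oppr_ge0 ?ltW// fineN fineM.
Qed.

(* Junk value 0 where the integral diverges, e.g. at the origin when [m <= n]. *)
Definition bessel_kernel m x : R := (gamma_cst (m / 2))^-1 *
  Rintegral leb setT (fun tau => gamma_kernel (m / 2) tau * heat tau x).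

Lemma bessel_kernel_ge0 m x : 0 < m -> 0 <= bessel_kernel m x.
Proof.
move=> m0; apply: mulr_ge0.
  by rewrite invr_ge0 ltW// gamma_cst_gt0// divr_gt0.
by apply: Rintegral_ge0 => t _; exact: gamma_heat_ge0.
Qed.

Lemma integrable_gamma_heat_shift a x : 0 < a ->
  (leb \x mu)%E.-integrable setT
    (EFin \o (fun z : measurableTypeR R * E => gamma_kernel a z.1 * heat z.1 (x - z.2))).
Proof.
move=> a0; apply/integrableP; split.
  by apply/measurable_EFinP; exact: measurable_gamma_heat_shift.
rewrite (_ : (\int[_]_z _ = \int[(leb \x mu)%E]_z
    (gamma_kernel a z.1 * heat z.1 (x - z.2))%:E)%E); last first.
  by apply: eq_integral => z _ /=; rewrite ger0_norm// gamma_heat_ge0.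
rewrite fubini_tonelli1.
- by rewrite integral_gamma_heat_shift// ltry.
- by apply/measurable_EFinP; exact: measurable_gamma_heat_shift.
- by move=> z; rewrite lee_fin gamma_heat_ge0.
Qed.

Lemma measurable_bessel_kernel m : 0 < m -> measurable_fun setT (bessel_kernel m).
Proof.
move=> m0; have a0 : 0 < m / 2 by rewrite divr_gt0.
apply: measurable_funM => //.
apply: eq_measurable_fun (measurable_Rintegral_fubini2 (integrable_gamma_heat_shift 0 a0)).
by move=> y _; apply: eq_Rintegral => t _; rewrite /= sub0r heatN.
Qed.

Lemma measurable_bessel_kernel_shift m x : 0 < m ->
  measurable_fun setT (fun y => bessel_kernel m (x - y)).
Proof.
move=> m0; apply: (measurableT_comp (measurable_bessel_kernel m0)).
apply: eq_measurable_fun (@measurable_rV_affine R n (-1) x) => y _.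
by rewrite scaleN1r addrC.
Qed.

(** An inequality, since [fine] replaces an infinite integral by 0. *)
Lemma bessel_kernel_le m x : 0 < m ->
  ((bessel_kernel m x)%:E <= ((gamma_cst (m / 2))^-1)%:E *
    \int[leb]_tau (gamma_kernel (m / 2) tau * heat tau x)%:E)%E.
Proof.
move=> m0; have G0 : 0 <= (gamma_cst (m / 2))^-1.
  by rewrite invr_ge0 ltW// gamma_cst_gt0// divr_gt0.
rewrite /bessel_kernel EFinM; apply: lee_wpmul2l; first by rewrite lee_fin.
rewrite /Rintegral; set I := (\int[_]_x0 _)%E.
have : (0 <= I)%E by apply: integral_ge0 => t _; rewrite lee_fin gamma_heat_ge0.
by case: I => //= _; exact: leey.
Qed.

Lemma integral_bessel_kernel_le m x : 0 < m ->
  (\int[mu]_y (bessel_kernel m (x - y))%:E <= 1)%E.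
Proof.
move=> m0; have a0 : 0 < m / 2 by rewrite divr_gt0.
have G0 := gamma_cst_gt0 a0.
have mF : measurable_fun setT (fun y => \int[leb]_tau
    (gamma_kernel (m / 2) tau * heat tau (x - y))%:E)%E.
  apply: (@measurable_fun_fubini_tonelli_G _ _ _ _ _ leb (fun z : measurableTypeR R * E => (gamma_kernel (m / 2) z.1 * heat z.1 (x - z.2))%:E)).
    by apply/measurable_EFinP; exact: measurable_gamma_heat_shift.
  by move=> z; rewrite lee_fin gamma_heat_ge0.
have F0 y : (0 <= \int[leb]_tau (gamma_kernel (m / 2) tau * heat tau (x - y))%:E)%E.
  by apply: integral_ge0 => t _; rewrite lee_fin gamma_heat_ge0.
apply: (@le_trans _ _ (\int[mu]_y (((gamma_cst (m / 2))^-1)%:E *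
    \int[leb]_tau (gamma_kernel (m / 2) tau * heat tau (x - y))%:E))%E).
  apply: ge0_le_integral => //.
  - by move=> y _; rewrite lee_fin bessel_kernel_ge0.
  - by apply/measurable_EFinP; exact: measurable_bessel_kernel_shift.
  - by apply: measurable_funeM.
  - by move=> y _; exact: bessel_kernel_le.
rewrite ge0_integralZl//; last by rewrite lee_fin invr_ge0 ltW.
rewrite -(@fubini_tonelli _ _ _ _ R leb mu
  (fun z : measurableTypeR R * E => (gamma_kernel (m / 2) z.1 * heat z.1 (x - z.2))%:E)).
- by rewrite integral_gamma_heat_shift// -EFinM mulVf ?gt_eqF.
- by apply/measurable_EFinP; exact: measurable_gamma_heat_shift.
- by move=> z; rewrite lee_fin gamma_heat_ge0.
Qed.

Lemma cintegrable_bessel_kernelM m phi x (k : R) : 0 < m -> cmeasurable phi ->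
  (forall y, normc (phi y) <= k) ->
  cintegrable mu (fun y => ((bessel_kernel m (x - y))%:C)%C * phi y).
Proof.
move=> m0 mphi hk; have mG := measurable_bessel_kernel_shift x m0.
have k0 : 0 <= k := le_trans (normc_ge0 _) (hk 0).
have G0 y := bessel_kernel_ge0 (x - y) m0.
apply: (@le_cintegrable _ _ _ _ _ (fun y => k * bessel_kernel m (x - y))).
- by apply: cmeasurableM => //; exact: cmeasurable_real.
- exact: measurable_funM.
- by move=> y; rewrite normcM normc_real ger0_norm// mulrC ler_wpM2r.
under eq_integral do rewrite EFinM.
rewrite ge0_integralZl//.
- by rewrite lte_mul_pinfty ?lee_fin// (le_lt_trans (integral_bessel_kernel_le x m0))// ltry.
- exact/measurable_EFinP.
- by move=> y _; rewrite lee_fin.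
Qed.

(** Fubini in (tau, y) applied to the heat representation. [RintegralZr_ge0] extracts [phi y] at
    every y, including those where the tau-integral diverges. *)
Lemma bessel_potential_kernel m phi x : 0 < m -> schwartz phi ->
  fourier (fun xi => bessel_weight (- m) xi * inv_fourier phi xi) x =
  cint mu (fun y => ((bessel_kernel m (x - y))%:C)%C * phi y).
Proof.
move=> m0 sphi; have a0 : 0 < m / 2 by rewrite divr_gt0.
have G0 := gamma_cst_gt0 a0.
have iphi : cintegrable mu phi by exact: schwartz_cintegrable.
have [mphi _] := iphi; have [k hk] := schwartz_bounded sphi.
have k0 : 0 <= k := le_trans (normc_ge0 _) (hk 0).
rewrite bessel_potential_heat//.
pose f (z : measurableTypeR R * E) : C :=
  ((gamma_kernel (m / 2) z.1 * heat z.1 (x - z.2))%:C)%C * phi z.2.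
have mf : cmeasurable f.
  apply: cmeasurableM; last exact: (cmeasurable_comp mphi measurable_snd).
  by apply: cmeasurable_real; exact: measurable_gamma_heat_shift.
have fi : (\int[leb]_t \int[mu]_y (normc (f (t, y)))%:E < +oo)%E.
  apply: (@le_lt_trans _ _ (\int[leb]_t \int[mu]_y
      (k * (gamma_kernel (m / 2) t * heat t (x - y)))%:E)%E).
    apply: (@ge0_le_integral_nested _ _ (measurableTypeR R) _ R leb mu (fun z => normc (f z))
      (fun z => k * (gamma_kernel (m / 2) z.1 * heat z.1 (x - z.2)))) => //.
    - exact: cmeasurable_normc.
    - by apply: measurable_funM => //; exact: measurable_gamma_heat_shift.
    - by move=> z; exact: normc_ge0.
    - move=> z; rewrite /f normcM normc_real ger0_norm ?gamma_heat_ge0// mulrC.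
      by apply: ler_wpM2r; [exact: gamma_heat_ge0|exact: hk].
  rewrite (_ : (\int[leb]_t _ = k%:E * \int[leb]_t \int[mu]_y (gamma_kernel (m / 2) t * heat t (x - y))%:E)%E).
    by rewrite integral_gamma_heat_shift// -EFinM ltry.
  have mH : measurable_fun setT (fun z : measurableTypeR R * E => (gamma_kernel (m / 2) z.1 * heat z.1 (x - z.2))%:E).
    by apply/measurable_EFinP; exact: measurable_gamma_heat_shift.
  have H0 (z : measurableTypeR R * E) : (0 <= (gamma_kernel (m / 2) z.1 * heat z.1 (x - z.2))%:E)%E.
    by rewrite lee_fin gamma_heat_ge0.
  rewrite -ge0_integralZl//.
  - apply: eq_integral => t _; under eq_integral do rewrite EFinM.
    rewrite ge0_integralZl//.
    + exact: (measurableT_comp mH (@pair1_measurable _ _ _ _ t)).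
    + by move=> y _; exact: (H0 (t, y)).
  - exact: (@measurable_fun_fubini_tonelli_F _ _ _ _ _ mu _ mH H0).
  - by move=> t _; apply: integral_ge0 => y _; exact: (H0 (t, y)).
have -> : cint leb (fun tau => ((gamma_kernel (m / 2) tau)%:C)%C *
    cint mu (fun y => ((heat tau (x - y))%:C)%C * phi y)) =
    cint leb (fun tau => cint mu (fun y => f (tau, y))).
  apply: eq_cint => t.
  have [t0|t0] := leP t 0.
    have g0 : gamma_kernel (m / 2) t = 0 by rewrite /gamma_kernel ltNge t0.
    have -> : (fun y => f (t, y)) = fun y => 0 * phi y.
      by apply/funext => y; rewrite /f /= g0 !mul0r.
    by rewrite cintZ// g0 !mul0r.
  rewrite -cintZ; last exact: cintegrable_heatM.
  by apply: eq_cint => y; rewrite /f /= mulrA -rmorphM.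
rewrite (cint_fubini mf fi).
have -> : cint mu (fun y => cint leb (fun t => f (t, y))) =
    cint mu (fun y => ((gamma_cst (m / 2))%:C)%C * (((bessel_kernel m (x - y))%:C)%C * phi y)).
  apply: eq_cint => y; rewrite mulrA -rmorphM /= /bessel_kernel mulVKf ?gt_eqF// /f.
  have mh := measurable_gamma_heat1 (m / 2) (x - y).
  have h0 t := gamma_heat_ge0 (m / 2) t (x - y).
  apply: complexP.
    rewrite cReM /= mul0r subr0 -RintegralZr_ge0//; apply: eq_Rintegral => t _.
    by rewrite cReM /= mul0r subr0.
  rewrite cImM /= mul0r addr0 -RintegralZr_ge0//; apply: eq_Rintegral => t _.
  by rewrite cImM /= mul0r addr0.
rewrite cintZ; last exact: cintegrable_bessel_kernelM hk.
by rewrite mulrA -rmorphM /= mulVf ?mul1r// gt_eqF.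
Qed.

(* With u = r^2 / tau this is exp(-u/4) <= 5 u^(-(1-l)/2): Gaussian decay is traded for
   a power, at the price of an integrable power of tau. *)
Lemma heat_1d_le tau (r l : R) : 0 < tau -> r != 0 -> 0 < l -> l < 1 ->
  (Num.sqrt (4 * pi * tau))^-1 * gaussian (4 * tau)^-1 r <=
  5 * (tau `^ (- (l / 2)) * `|r| `^ (- (1 - l))).
Proof.
move=> t0 r0 l0 l1; have p0 := pi_gt0 R.
have nr0 : 0 < `|r| by rewrite normr_gt0.
pose c := (1 - l) / 2.
have c0 : 0 < c by rewrite divr_gt0// subr_gt0.
have c1 : c <= 1 by rewrite /c; lra.
pose u := `|r| ^+ 2 / tau.
have u0 : 0 < u by rewrite divr_gt0// exprn_gt0.
have uc : u `^ c <= 1 + u.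
  have [h|h] := leP u 1.
    rewrite (@le_trans _ _ 1)//; last by rewrite lerDl ltW.
    by rewrite -[leRHS](powRr0 u) ger_powR ?u0// ltW.
  rewrite (@le_trans _ _ u)//; last by rewrite lerDr.
  by rewrite ler1_powR// ltW.
have ge : gaussian (4 * tau)^-1 r <= 5 * u `^ (- c).
  have -> : gaussian (4 * tau)^-1 r = (expR (u / 4))^-1.
    rewrite /gaussian expRN; congr ((expR _)^-1).
    rewrite /u real_normK ?num_real//; field; exact: lt0r_neq0.
  rewrite powRN -[leLHS]mul1r ler_pdivrMr ?expR_gt0// mulrAC ler_pdivlMr ?powR_gt0// mul1r.
  apply: (le_trans uc); have := expR_ge1Dx (u / 4); lra.
have sq : (Num.sqrt (4 * pi * tau))^-1 <= tau `^ (- 2^-1).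
  have q0 : 0 < 4 * pi * tau by rewrite !mulr_gt0.
  rewrite powRN powR12_sqrt ?(ltW t0)// lef_pV2 ?posrE ?sqrtr_gt0// ler_sqrt ?(ltW q0)//.
  by rewrite ler_peMl ?(ltW t0)//; have := pi_ge2 R; lra.
apply: (le_trans (ler_pM _ _ sq ge)).
- by rewrite invr_ge0 sqrtr_ge0.
- exact: expR_ge0.
rewrite mulrCA ler_pM2l// le_eqVlt; apply/orP; left; apply/eqP.
rewrite /u powRM ?exprn_ge0 ?invr_ge0 ?(ltW t0)//.
rewrite mulrCA mulrC.
have -> : tau^-1 = tau `^ (- 1) by rewrite powR_inv1// ltW.
have -> : `|r| ^+ 2 = `|r| `^ 2 by rewrite powR_mulrn.
rewrite -!powRrM -powRD; last by rewrite (gt_eqF t0) implybT.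
by congr (_ `^ _ * _ `^ _); rewrite /c; field.
Qed.

Lemma heat_prod_le tau (v : E) (l : R) : 0 < tau -> (forall i, v ord0 i != 0) -> 0 < l -> l < 1 ->
  heat tau v <= 5 ^+ n * (tau `^ (- (n%:R * l / 2)) * \prod_(i < n) `|v ord0 i| `^ (- (1 - l))).
Proof.
move=> t0 v0 l0 l1.
have -> : heat tau v = \prod_(i < n) ((Num.sqrt (4 * pi * tau))^-1 * gaussian (4 * tau)^-1 (v ord0 i)).
  by rewrite /heat gaussnE big_split /= prodr_const card_ord.
have -> : 5 ^+ n * (tau `^ (- (n%:R * l / 2)) * \prod_(i < n) `|v ord0 i| `^ (- (1 - l))) =
    \prod_(i < n) (5 * (tau `^ (- (l / 2)) * `|v ord0 i| `^ (- (1 - l)))).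
  rewrite !big_split /= !prodr_const card_ord; congr (_ * (_ * _)).
  rewrite -powR_mulrn ?powR_ge0// -powRrM; congr (_ `^ _); ring.
apply: ler_prod => i _; rewrite heat_1d_le// andbT.
by rewrite mulr_ge0 ?invr_ge0 ?sqrtr_ge0 ?expR_ge0.
Qed.

(** The power of tau in [heat_prod_le] shifts the Gamma parameter from m / 2 to (m - n l) / 2, which
    stays positive because n l < m. *)
Lemma bessel_kernel_prod_le m (l : R) : 0 < m -> 0 < l -> l < 1 -> n%:R * l < m ->
  exists2 c : R, 0 <= c & forall v : E, (forall i, v ord0 i != 0) ->
    bessel_kernel m v <= c * \prod_(i < n) `|v ord0 i| `^ (- (1 - l)).
Proof.
move=> m0 l0 l1 nl; have a0 : 0 < m / 2 by rewrite divr_gt0.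
have b0 : 0 < m / 2 - n%:R * l / 2 by rewrite -mulrBl divr_gt0// subr_gt0.
have G0 := gamma_cst_gt0 a0.
have Gi : 0 <= (gamma_cst (m / 2))^-1 by apply: ltW; rewrite invr_gt0.
have G1 := gamma_cst_gt0 b0.
exists ((gamma_cst (m / 2))^-1 * (5 ^+ n * gamma_cst (m / 2 - n%:R * l / 2))).
  apply: mulr_ge0 => //.
  by apply: mulr_ge0; [exact: exprn_ge0|exact: ltW].
move=> v v0; set P := \prod_(i < n) _.
have P0 : 0 <= P by apply: prodr_ge0 => i _; exact: powR_ge0.
rewrite -lee_fin; apply: (le_trans (bessel_kernel_le v m0)).
rewrite -(mulrA _ (_ * _) P) [leRHS]EFinM; apply: lee_wpmul2l => //.
rewrite mulrAC [leRHS]EFinM -gamma_cstE// -ge0_integralZl//; first last.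
- by rewrite lee_fin; apply: mulr_ge0 => //; exact: exprn_ge0.
- by move=> t _; rewrite lee_fin gamma_kernel_ge0.
- by apply/measurable_EFinP; exact: measurable_gamma_kernel.
apply: ge0_le_integral => //.
- by move=> t _; rewrite lee_fin gamma_heat_ge0.
- by apply/measurable_EFinP; exact: measurable_gamma_heat1.
- by apply: measurable_funeM; apply/measurable_EFinP; exact: measurable_gamma_kernel.
move=> t _; rewrite -EFinM lee_fin /gamma_kernel; case: ifPn => [t0|_]; last by rewrite mul0r mulr0.
apply: (le_trans (ler_wpM2l _ (heat_prod_le t0 v0 l0 l1))).
  by rewrite mulr_ge0 ?powR_ge0 ?expR_ge0.
rewrite -/P le_eqVlt; apply/orP; left; apply/eqP.
have -> : t `^ (m / 2 - n%:R * l / 2 - 1) = t `^ (m / 2 - 1) * t `^ (- (n%:R * l / 2)).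
  rewrite -powRD; last by rewrite (gt_eqF t0) implybT.
  by congr (_ `^ _); ring.
ring.
Qed.

End bessel_kernel.

(** * Uniform local membership of inverse powers *)

Section near_box.
Context (R : realType) (n : nat).
Local Notation E := 'rV[R]_n.
Local Notation mu := (lebesgue_rV R n).
Local Notation leb := (@lebesgue_measure R).
Local Notation C := R[i].
Implicit Types (f g F phi : E -> C) (x y z : E) (a p rho alpha : R).

(** Such a hyperplane is a box with one side reduced to a point. The product majorants are singular
    precisely along these sets. *)
Lemma rV_coord_neq_ae y : {ae mu, forall x : E, forall i, x ord0 i != y ord0 i}.
Proof.
have N i : mu.-negligible [set x : E | x ord0 i = y ord0 i].
  pose A (j : 'I_n) : set R := if j == i then [set y ord0 i] else setT.
  have mA j : measurable (A j) by rewrite /A; case: ifP => // _; exact: measurable_set1.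
  have eqA : [set x : E | x ord0 i = y ord0 i] = [set x | forall j, A j (x ord0 j)].
    apply/seteqP; split => [x /= x0 j|x /= /(_ i)]; rewrite /A ?eqxx//.
    by case: eqP => // ->.
  have M : measurable [set x : E | x ord0 i = y ord0 i].
    have -> : [set x : E | x ord0 i = y ord0 i] =
      setT `&` (fun x : E => x ord0 i) @^-1` [set y ord0 i] by rewrite setTI.
    by apply: measurable_coord => //; exact: measurable_set1.
  exists [set x : E | x ord0 i = y ord0 i]; split => //.
  rewrite [X in mu X]eqA lebesgue_rV_box// (bigD1 i)//=.
  by rewrite {1}/A eqxx lebesgue_measure_set1 mul0e.
apply: filter_forall => i; apply: negligibleS (N i) => x /= /negP.
by rewrite negbK => /eqP.
Qed.

Lemma rV_coord_neq0_ae : {ae mu, forall x : E, forall i, x ord0 i != 0}.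
Proof. by apply: filterS (rV_coord_neq_ae 0) => x h i; have := h i; rewrite mxE. Qed.

Lemma eq_cint_ae f g : cmeasurable f -> cmeasurable g -> {ae mu, forall x, f x = g x} ->
  cint mu f = cint mu g.
Proof.
move=> [f1 f2] [g1 g2] fg; apply: complexP => /=; rewrite /Rintegral; congr fine.
  apply: ae_eq_integral => //; try by apply/measurable_EFinP.
  by apply: filterS fg => x -> _.
apply: ae_eq_integral => //; try by apply/measurable_EFinP.
by apply: filterS fg => x -> _.
Qed.

Lemma powR_prod (I : Type) (s : seq I) (h : I -> R) (b : R) : (forall i, 0 <= h i) ->
  (\prod_(i <- s) h i) `^ b = \prod_(i <- s) h i `^ b.
Proof.
move=> h0; elim: s => [|i s IH]; first by rewrite !big_nil powR1.
by rewrite !big_cons powRM ?IH// prodr_ge0.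
Qed.

Lemma prode_ord_le (k : nat) (e : 'I_k -> \bar R) (c : 'I_k -> R) :
  (forall i, 0 <= e i)%E -> (forall i, e i <= (c i)%:E)%E ->
  (\prod_(i < k) e i <= (\prod_(i < k) c i)%:E)%E.
Proof.
move=> e0 ec.
suff [] : (0 <= \prod_(i < k) e i)%E /\ (\prod_(i < k) e i <= (\prod_(i < k) c i)%:E)%E by [].
elim/big_rec2: _ => [|i x y _ [y0 yx]]; first by rewrite lee_fin.
by split; [exact: mule_ge0|rewrite EFinM; exact: lee_pmul].
Qed.

Lemma Lp_norm_le p (K D : R) g (H : E -> R) : 0 < p -> cmeasurable g ->
  measurable_fun setT H -> (forall x, 0 <= H x) -> 0 <= K ->
  {ae mu, forall x, normc (g x) <= K * H x} -> (\int[mu]_x (H x `^ p)%:E <= D%:E)%E ->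
  (Lp_norm p g <= (K * D `^ p^-1)%:E)%E.
Proof.
move=> p0 mg mH H0 K0 gH HD.
have D0 : 0 <= D.
  rewrite -lee_fin; apply: le_trans HD.
  by apply: integral_ge0 => x _; rewrite lee_fin powR_ge0.
have mHp : measurable_fun setT (fun x => (H x `^ p)%:E).
  by apply/measurable_EFinP; exact: (measurableT_comp (measurable_powR p) mH).
rewrite /Lp_norm unlock.
have -> : (fun x => `|(normc (g x))%:E| `^ p)%E = (fun x => (normc (g x) `^ p)%:E).
  by apply/funext => x; rewrite /= ger0_norm// normc_ge0.
have -> : (K * D `^ p^-1)%:E = (((K `^ p)%:E * D%:E) `^ p^-1)%E.
  by rewrite -EFinM poweR_EFin powRM ?powR_ge0// -powRrM mulfV ?gt_eqF// powRr1.
apply: gt0_ler_poweR.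
- by rewrite invr_ge0 ltW.
- by rewrite in_itv/= leey andbT; apply: integral_ge0 => x _; rewrite lee_fin powR_ge0.
- by rewrite in_itv/= leey andbT mule_ge0// lee_fin powR_ge0.
apply: (@le_trans _ _ (\int[mu]_x ((K `^ p)%:E * (H x `^ p)%:E))%E); last first.
  rewrite ge0_integralZl//.
  - by apply: lee_wpmul2l => //; rewrite lee_fin powR_ge0.
  - by move=> x _; rewrite lee_fin powR_ge0.
  - by rewrite lee_fin powR_ge0.
apply: ae_ge0_le_integral => //.
- by move=> x _; rewrite lee_fin powR_ge0.
- apply/measurable_EFinP; apply: (measurableT_comp (measurable_powR p)).
  exact: cmeasurable_normc.
- by move=> x _; rewrite mule_ge0// lee_fin powR_ge0.
- by apply: measurable_funeM.
apply: filterS gH => x gx _; rewrite -EFinM lee_fin.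
rewrite -powRM//; apply: ge0_ler_powR => //; rewrite ?nnegrE ?normc_ge0 ?mulr_ge0//.
exact: ltW.
Qed.

(** The product majorant of a power |x|^(-alpha) localized to a cube around z, with a = alpha /
    n. *)
Definition near_box z rho a x : R :=
  \prod_(i < n) (if `|x ord0 i - z ord0 i| <= rho then `|x ord0 i| `^ (- a) else 0).

Lemma near_pow_ge0 (b r c rho : R) : 0 <= (if `|r - c| <= rho then `|r| `^ b else 0).
Proof. by case: ifP => // _; exact: powR_ge0. Qed.

Lemma near_box_ge0 z rho a x : 0 <= near_box z rho a x.
Proof. by apply: prodr_ge0 => i _; exact: near_pow_ge0. Qed.

Lemma measurable_near_pow (b c rho : R) :
  measurable_fun [set: R] (fun r : R => if `|r - c| <= rho then `|r| `^ b else 0).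
Proof.
apply: measurable_if_absB.
by have := measurable_abs_powR b 0; under eq_fun do rewrite subr0.
Qed.

Lemma measurable_near_box z rho a : measurable_fun setT (near_box z rho a).
Proof.
apply: measurable_prod => i _.
exact: (measurableT_comp (measurable_near_pow (- a) (z ord0 i) rho) (@measurable_coord R n i)).
Qed.

Lemma integral_near_box z rho a : 0 < a -> a < 1 -> 0 <= rho ->
  (\int[mu]_x (near_box z rho a x)%:E <= ((2 / (1 - a) + 2 * rho) ^+ n)%:E)%E.
Proof.
move=> a0 a1 rho0.
rewrite (ge0_integral_rV_prod (h := fun i r => if `|r - z ord0 i| <= rho then `|r| `^ (- a) else 0)).
- rewrite -[X in _ ^+ X](card_ord n) -prodr_const.
  apply: prode_ord_le => i; last exact: integral_near.
  by apply: integral_ge0 => r _; rewrite lee_fin near_pow_ge0.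
- by move=> i; exact: measurable_near_pow.
- by move=> i r; exact: near_pow_ge0.
Qed.

Lemma cintegrable_near_box F z rho a (b : R) : cmeasurable F -> 0 < a -> a < 1 -> 0 <= rho ->
  0 <= b -> {ae mu, forall x, normc (F x) <= b * near_box z rho a x} -> cintegrable mu F.
Proof.
move=> mF a0 a1 rho0 b0 Fb; split => //.
have mN := measurable_near_box z rho a.
apply: (@le_lt_trans _ _ (\int[mu]_x (b%:E * (near_box z rho a x)%:E))%E).
  apply: ae_ge0_le_integral => //.
  - by move=> x _; rewrite lee_fin normc_ge0.
  - by apply/measurable_EFinP; exact: cmeasurable_normc.
  - by move=> x _; rewrite mule_ge0 ?lee_fin ?near_box_ge0.
  - by apply: measurable_funeM; apply/measurable_EFinP.
  - by apply: filterS Fb => x Fx _; rewrite -EFinM lee_fin.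
rewrite ge0_integralZl//; first last.
- by move=> x _; rewrite lee_fin near_box_ge0.
- by apply/measurable_EFinP.
rewrite lte_mul_pinfty ?lee_fin//.
by apply: le_lt_trans (integral_near_box z a0 a1 rho0) _; rewrite ltry.
Qed.

Lemma normc_boundedM_lty d1 d2 (T1 : measurableType d1) (T2 : measurableType d2)
  (m1 : {sigma_finite_measure set T1 -> \bar R}) (m2 : {sigma_finite_measure set T2 -> \bar R})
  (f h : T1 * T2 -> C) (k : R) : cmeasurable f -> cmeasurable h ->
  (forall w, normc (h w) <= k) ->
  (\int[m1]_x \int[m2]_y (normc (f (x, y)))%:E < +oo)%E ->
  (\int[m1]_x \int[m2]_y (normc (f (x, y) * h (x, y)))%:E < +oo)%E.
Proof.
move=> mf mh hk fi.
have [mhf] := cintegrable_bounded mh hk (cintegrable_prod mf fi).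
rewrite fubini_tonelli1; first last.
- by move=> w; rewrite lee_fin normc_ge0.
- by apply/measurable_EFinP; exact: cmeasurable_normc.
apply: le_lt_trans; rewrite le_eqVlt; apply/orP; left; apply/eqP.
by apply: eq_integral => x _; apply: eq_integral => y _; rewrite mulrC.
Qed.

(** The density is g(y), the integral of F(x) G(x - y) over x: Fubini transposes the convolution
    from the test function to F. The constant is chosen before z, F and b, which makes the estimate
    uniform over localizations. *)
Lemma bessel_kernel_density m l a p rho : 0 < m -> 0 < l -> l < a -> a < 1 ->
  n%:R * l < m -> 0 < p -> (a - l) * p < 1 -> 1 < (1 - l) * p -> 1 <= rho ->
  exists c : R, forall z F (b : R), cmeasurable F -> 0 <= b ->
    {ae mu, forall x, normc (F x) <= b * near_box z rho a x} ->
    exists g, [/\ cmeasurable g, (Lp_norm p g <= (b * c)%:E)%E &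
      forall phi, schwartz phi ->
        cint mu (fun x => F x * fourier (fun xi => bessel_weight (- m) xi * inv_fourier phi xi) x) =
        cint mu (fun y => g y * phi y)].
Proof.
move=> m0 l0 la a1 nl p0 alp lp rho1.
have l1 : l < 1 := lt_trans la a1.
have a0 : 0 < a := lt_trans l0 la.
have rho0 : 0 <= rho := le_trans ler01 rho1.
have [c1 c10 hc1] := bessel_kernel_prod_le m0 l0 l1 nl.
have [D hD] := riesz_near_bound l0 la a1 p0 alp lp rho1.
exists (c1 * (D ^+ n) `^ p^-1) => z F b mF b0 Fb.
have iF := cintegrable_near_box mF a0 a1 rho0 b0 Fb; have [_ Fi] := iF.
have [J hJ] := choice (fun i : 'I_n => hD (z ord0 i)).
have mJ i : measurable_fun [set: R] (J i) by have [] := hJ i.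
have J0 i r : 0 <= J i r by have [] := hJ i.
pose G := @bessel_kernel R n m.
have G0 v : 0 <= G v by exact: bessel_kernel_ge0.
have mG2 : measurable_fun [set: E * E] (fun z : E * E => G (z.1 - z.2)).
  by rewrite /G; apply: (measurableT_comp (measurable_bessel_kernel m0)); exact: measurable_subrV.
pose f (w : E * E) : C := F w.1 * ((G (w.1 - w.2))%:C)%C.
have mf : cmeasurable f.
  apply: cmeasurableM; first exact: (cmeasurable_comp mF measurable_fst).
  exact: cmeasurable_real.
have nf x y : normc (f (x, y)) = normc (F x) * G (x - y).
  by rewrite /f normcM normc_real ger0_norm.
have fi : (\int[mu]_x \int[mu]_y (normc (f (x, y)))%:E < +oo)%E.
  apply: le_lt_trans Fi; apply: ge0_le_integral => //.
  - by move=> x _; apply: integral_ge0 => y _; rewrite lee_fin normc_ge0.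
  - apply: (@measurable_fun_fubini_tonelli_F _ _ _ _ _ mu (fun w => (normc (f w))%:E)).
      by apply/measurable_EFinP; exact: cmeasurable_normc.
    by move=> w; rewrite lee_fin normc_ge0.
  - by apply/measurable_EFinP; exact: cmeasurable_normc.
  - move=> x _; under eq_integral do rewrite nf EFinM.
    rewrite ge0_integralZl//; first last.
    + by rewrite lee_fin normc_ge0.
    + by move=> y _; rewrite lee_fin.
    + by apply/measurable_EFinP; exact: measurable_bessel_kernel_shift.
    rewrite -[leRHS]mule1; apply: lee_wpmul2l; first by rewrite lee_fin normc_ge0.
    exact: integral_bessel_kernel_le.
pose g y := cint mu (fun x => f (x, y)).
have mg : cmeasurable g by exact: cmeasurable_cint2 mf fi.
pose H y := \prod_(i < n) J i (y ord0 i).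
have H0 y : 0 <= H y by apply: prodr_ge0 => i _.
have mH : measurable_fun setT H.
  by apply: measurable_prod => i _; exact: (measurableT_comp (mJ i) (@measurable_coord R n i)).
(* The bound on G and the majorant of F both factor, so the integral splits into n one-dimensional
   localized Riesz potentials. *)
have key y : (forall i, y ord0 i != 0) ->
    (\int[mu]_x (normc (f (x, y)))%:E <= (b * c1 * H y)%:E)%E.
  move=> y0.
  pose k i r := `|y ord0 i - r| `^ (- (1 - l)) *
    (if `|r - z ord0 i| <= rho then `|r| `^ (- a) else 0).
  have mk i : measurable_fun [set: R] (k i) by exact: measurable_riesz_near.
  have k0 i r : 0 <= k i r by rewrite mulr_ge0 ?powR_ge0// near_pow_ge0.
  have mP : measurable_fun setT (fun x : E => \prod_(i < n) k i (x ord0 i)).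
    by apply: measurable_prod => i _; exact: (measurableT_comp (mk i) (@measurable_coord R n i)).
  have P0 (x : E) : 0 <= \prod_(i < n) k i (x ord0 i) by apply: prodr_ge0 => i _.
  apply: (@le_trans _ _ (\int[mu]_x ((b * c1)%:E * (\prod_(i < n) k i (x ord0 i))%:E))%E).
    apply: ae_ge0_le_integral => //.
    - by move=> x _; rewrite lee_fin normc_ge0.
    - apply/measurable_EFinP; apply: cmeasurable_normc.
      exact: (cmeasurable_comp mf (@pair2_measurable _ _ _ _ y)).
    - by move=> x _; rewrite mule_ge0 ?lee_fin// mulr_ge0.
    - by apply: measurable_funeM; apply/measurable_EFinP.
    - apply: filterS2 Fb (rV_coord_neq_ae y) => x Fx xy _.
      rewrite -EFinM lee_fin nf.
      have Gx : G (x - y) <= c1 * \prod_(i < n) `|y ord0 i - x ord0 i| `^ (- (1 - l)).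
        have := hc1 (x - y); under eq_bigr do rewrite !mxE distrC; apply => i.
        by rewrite !mxE subr_eq0.
      apply: (le_trans (ler_pM (normc_ge0 _) (G0 _) Fx Gx)).
      by rewrite mulrACA /k big_split /= [X in _ * X]mulrC.
  rewrite ge0_integralZl//; first last.
  - by rewrite lee_fin; apply: mulr_ge0.
  - by move=> x _; rewrite lee_fin.
  - by apply/measurable_EFinP.
  rewrite [leRHS]EFinM; apply: lee_wpmul2l; first by rewrite lee_fin mulr_ge0.
  rewrite (ge0_integral_rV_prod mk k0); apply: prode_ord_le => i.
    by apply: integral_ge0 => r _; rewrite lee_fin.
  by have [_ _ _] := hJ i; apply.
have fy y : (forall i, y ord0 i != 0) -> cintegrable mu (fun x => f (x, y)).
  move=> y0; split; first exact: (cmeasurable_comp mf (@pair2_measurable _ _ _ _ y)).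
  by apply: le_lt_trans (key y y0) _; rewrite ltry.
exists g; split => //.
  rewrite mulrA; apply: (Lp_norm_le p0 mg mH) => //.
  - by rewrite mulr_ge0.
  - apply: filterS rV_coord_neq0_ae => y y0; rewrite -lee_fin.
    by apply: le_trans (key y y0); apply: le_normc_cint; exact: fy.
  - under eq_integral do rewrite /H powR_prod//.
    rewrite (ge0_integral_rV_prod (h := fun i r => J i r `^ p)).
    + rewrite -[X in _ ^+ X](card_ord n) -prodr_const; apply: prode_ord_le => i.
        by apply: integral_ge0 => r _; rewrite lee_fin powR_ge0.
      by have [] := hJ i.
    + by move=> i; exact: (measurableT_comp (measurable_powR p) (mJ i)).
    + by move=> i r; exact: powR_ge0.
move=> phi sphi; have [k hk] := schwartz_bounded sphi.
have mphi := schwartz_cmeasurable sphi.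
have k0 : 0 <= k := le_trans (normc_ge0 _) (hk 0).
pose fphi (w : E * E) : C := f w * phi w.2.
have mfphi : cmeasurable fphi.
  by apply: cmeasurableM => //; exact: (cmeasurable_comp mphi measurable_snd).
have fphii : (\int[mu]_x \int[mu]_y (normc (fphi (x, y)))%:E < +oo)%E.
  apply: (normc_boundedM_lty mf (h := fun w => phi w.2) (k := k)) => //.
  exact: (cmeasurable_comp mphi measurable_snd).
transitivity (cint mu (fun x => cint mu (fun y => fphi (x, y)))).
  apply: eq_cint => x; rewrite bessel_potential_kernel//.
  rewrite -cintZ; last exact: cintegrable_bessel_kernelM hk.
  by apply: eq_cint => y; rewrite /fphi /f mulrA.
rewrite (cint_fubini mfphi fphii); apply: eq_cint_ae.
- exact: cmeasurable_cint2 mfphi fphii.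
- exact: cmeasurableM.
(* Integrability in x for fixed y is available off the coordinate hyperplanes, so the integrands are
   identified almost everywhere. *)
- apply: filterS rV_coord_neq0_ae => y y0; rewrite mulrC -cintZ; last exact: fy.
  by apply: eq_cint => x; rewrite /fphi mulrC.
Qed.

(** Serves the exponent m = 0, where J_0 is the identity and F is its own density. *)
Lemma Lp_norm_near_box a p rho : 0 < a -> 0 < p -> a * p < 1 -> 0 <= rho ->
  exists c : R, forall z F (b : R), cmeasurable F -> 0 <= b ->
    {ae mu, forall x, normc (F x) <= b * near_box z rho a x} ->
    (Lp_norm p F <= (b * c)%:E)%E.
Proof.
move=> a0 p0 ap rho0; have ap0 : 0 < a * p by rewrite mulr_gt0.
exists (((2 / (1 - a * p) + 2 * rho) ^+ n) `^ p^-1) => z F b mF b0 Fb.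
apply: (Lp_norm_le p0 mF (measurable_near_box z rho a)) => //.
  by move=> x; exact: near_box_ge0.
apply: le_trans (integral_near_box z ap0 ap rho0).
rewrite le_eqVlt; apply/orP; left; apply/eqP; apply: eq_integral => x _; congr EFin.
rewrite /near_box powR_prod; last by move=> i; exact: near_pow_ge0.
apply: eq_bigr => i _; case: ifP => _; last by rewrite powR0// gt_eqF.
by rewrite -powRrM mulNr.
Qed.

Lemma bessel_potential0 phi x : schwartz phi ->
  fourier (fun xi => bessel_weight 0 xi * inv_fourier phi xi) x = phi x.
Proof.
move=> sphi; rewrite -[RHS]schwartz_inversion//.
congr (fourier _ x); apply/funext => xi.
by rewrite bessel_weightE /bweight mul0r powRr0 mul1r.
Qed.

(** Strict inequality in (n a - m) p < n leaves room to take l slightly below m / n, so that n l < m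
    holds and the p-integrability condition survives. *)
Lemma near_box_density m a p rho : 0 <= m -> m * 2 < n%:R -> m < n%:R * a -> a < 1 ->
  2 < p -> (n%:R * a - m) * p < n%:R -> 1 <= rho ->
  exists c : R, forall z F (b : R), cmeasurable F -> 0 <= b ->
    {ae mu, forall x, normc (F x) <= b * near_box z rho a x} ->
    exists g, [/\ cmeasurable g, (Lp_norm p g <= (b * c)%:E)%E &
      forall phi, schwartz phi ->
        cint mu (fun x => F x * fourier (fun xi => bessel_weight (- m) xi * inv_fourier phi xi) x) =
        cint mu (fun y => g y * phi y)].
Proof.
move=> m0 mn ma a1 p2 amp rho1.
have n0 : 0 < n%:R :> R by apply: le_lt_trans mn; rewrite mulr_ge0.
have p0 : 0 < p by apply: lt_trans p2.
have rho0 : 0 <= rho := le_trans ler01 rho1.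
have [m00|m0'] := eqVneq m 0.
  have a0 : 0 < a by rewrite -(pmulr_rgt0 _ n0) -m00.
  have ap : a * p < 1 by rewrite -(ltr_pM2l n0) mulr1 mulrA; move: amp; rewrite m00 subr0.
  have [c hc] := Lp_norm_near_box a0 p0 ap rho0.
  exists c => z F b mF b0 Fb; exists F; split => //; first exact: hc Fb.
  by move=> phi sphi; apply: eq_cint => x; rewrite m00 oppr0 bessel_potential0.
have {}m0 : 0 < m by rewrite lt_neqAle eq_sym m0'.
pose q := m / n%:R.
have q0 : 0 < q by rewrite divr_gt0.
have q2 : q * 2 < 1 by rewrite /q mulrAC ltr_pdivrMr// mul1r.
have qa : q < a by rewrite /q ltr_pdivrMr// mulrC.
have aqp : (a - q) * p < 1.
  rewrite -(ltr_pM2l n0) mulr1 mulrA mulrBr.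
  by rewrite /q [n%:R * (m / _)]mulrC divfK ?gt_eqF.
pose d := 1 - (a - q) * p; have d0 : 0 < d by rewrite subr_gt0.
(* With l = q - e, the bound e <= q / 2 keeps l positive and e p <= d / 2 keeps (a - l) p below 1.
   The remaining condition (1 - l) p > 1 follows from l < 1/2 and p > 2. *)
pose e := Num.min (q / 2) (d / (2 * p)).
have e0 : 0 < e by rewrite lt_min !divr_gt0// mulr_gt0.
have eq2 : e <= q / 2 by rewrite ge_min lexx.
have ed : e * p <= d / 2.
  have : e <= d / (2 * p) by rewrite ge_min lexx orbT.
  by rewrite ler_pdivlMr ?mulr_gt0// => h; move: h; lra.
have [||||||||c hc] := @bessel_kernel_density m (q - e) a p rho m0.
- lra.
- lra.
- exact: a1.
- by rewrite mulrBr /q [n%:R * (m / _)]mulrC divfK ?gt_eqF// gtrBl mulr_gt0.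
- exact: p0.
- by rewrite /d in ed d0; nra.
- by nra.
- exact: rho1.
by exists c.
Qed.

Lemma measurable_euclid_norm : measurable_fun setT (@euclid_norm R n).
Proof. exact: continuous_measurable_rV (@continuous_euclid_norm R n). Qed.

Lemma cmeasurable_inverse_power alpha : 0 < alpha -> cmeasurable (@inverse_power R n alpha).
Proof.
move=> al0.
(* The case distinction at the origin agrees with the convention that a nonzero power of 0 is 0. *)
rewrite (_ : @inverse_power R n alpha = fun x => ((euclid_norm x `^ (- alpha))%:C)%C).
  apply: cmeasurable_real; apply: (measurableT_comp (measurable_powR _)).
  exact: measurable_euclid_norm.
apply/funext => x; rewrite /inverse_power; case: eqP => // ->.
have -> : euclid_norm (0 : E) = 0.
  by rewrite /euclid_norm /dotprod big1 ?sqrtr0// => i _; rewrite mxE mul0r.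
by rewrite powR0// oppr_eq0 gt_eqF.
Qed.

Lemma normr_coord_le x (i : 'I_n) : `|x ord0 i| <= euclid_norm x.
Proof.
rewrite -(@ler_pXn2r _ 2) ?nnegrE ?euclid_norm_ge0// real_normK ?num_real//.
exact: coord_le_euclid_norm.
Qed.

(** Split the power of |x| into n equal powers and replace |x| by the smaller |x_i| in each. *)
Lemma inverse_power_le alpha x : 0 < n%:R :> R -> 0 < alpha -> (forall i, x ord0 i != 0) ->
  normc (inverse_power alpha x) <= \prod_(i < n) `|x ord0 i| `^ (- (alpha / n%:R)).
Proof.
move=> n0 al0 x0; rewrite /inverse_power.
case: ifPn => [_|xn].
  by rewrite normc_real normr0 prodr_ge0// => i _; exact: powR_ge0.
rewrite normc_real ger0_norm ?powR_ge0//.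
have -> : euclid_norm x `^ (- alpha) = \prod_(i < n) euclid_norm x `^ (- (alpha / n%:R)).
  rewrite prodr_const card_ord -powR_mulrn ?powR_ge0// -powRrM.
  by rewrite mulNr divfK// gt_eqF.
apply: ler_prod => i _; rewrite powR_ge0 /=.
have xi0 : 0 < `|x ord0 i| by rewrite normr_gt0.
have xe := normr_coord_le x i.
have e0 : 0 < euclid_norm x by exact: lt_le_trans xe.
rewrite !powRN lef_pV2 ?posrE ?powR_gt0//.
by apply: ge0_ler_powR; rewrite ?nnegrE ?(ltW xi0) ?(ltW e0)// divr_ge0 ?(ltW al0)// ltW.
Qed.

Lemma inverse_powerM_near_box alpha f z rho (b : R) : 0 < n%:R :> R -> 0 < alpha -> 0 <= b ->
  (forall x, normc (f x) <= b) ->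
  (forall x, ~ (forall i, `|x ord0 i - z ord0 i| <= rho) -> f x = 0) ->
  {ae mu, forall x, normc (inverse_power alpha x * f x) <= b * near_box z rho (alpha / n%:R) x}.
Proof.
move=> n0 al0 b0 fb f0; apply: filterS rV_coord_neq0_ae => x x0.
have [h|h] := pselect (forall i, `|x ord0 i - z ord0 i| <= rho); last first.
  by rewrite f0// mulr0 normc0 mulr_ge0// near_box_ge0.
rewrite normcM mulrC; apply: ler_pM; rewrite ?normc_ge0//.
rewrite /near_box (eq_bigr (fun i => `|x ord0 i| `^ (- (alpha / n%:R)))); last by move=> i _; rewrite h.
exact: inverse_power_le.
Qed.

Lemma schwartz_seminorm0 phi : schwartz phi -> exists s : R,
  [/\ seminorm 0 0 phi = s%:E, 0 <= s & forall x, normc (phi x) <= s].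
Proof.
move=> [_ /(_ 0%N 0%N)]; set S := seminorm _ _ _ => Sy.
have le x : ((normc (phi x))%:E <= S)%E.
  apply: ereal_sup_ubound; exists [::], x; split => //.
  by rewrite expr0 mul1r /cpderiv /=; case: (phi x).
have S0 : (0 <= S)%E by apply: le_trans (le 0); rewrite lee_fin normc_ge0.
have Sf : S \is a fin_num by rewrite ge0_fin_numE.
exists (fine S); split; first by rewrite fineK.
  exact: fine_ge0.
by move=> x; rewrite -lee_fin fineK.
Qed.

Lemma cint_bounded_linear F f g (k1 k2 : R) (c : C) : cintegrable mu F ->
  cmeasurable f -> cmeasurable g -> (forall x, normc (f x) <= k1) ->
  (forall x, normc (g x) <= k2) ->
  cint mu (fun x => F x * (c * f x + g x)) =
  c * cint mu (fun x => F x * f x) + cint mu (fun x => F x * g x).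
Proof.
move=> iF mf mg fk gk.
have iFM h k : cmeasurable h -> (forall x, normc (h x) <= k) -> cintegrable mu (fun x => F x * h x).
  move=> mh hk; rewrite (_ : (fun x => _) = fun x => h x * F x).
    exact: cintegrable_bounded hk iF.
  by apply/funext => x; rewrite mulrC.
have i1 := iFM _ _ mf fk; have i2 := iFM _ _ mg gk.
rewrite -cintZ// -cintD//; last exact: cintegrableZ.
by apply: eq_cint => x; rewrite mulrDr mulrCA.
Qed.

Lemma normc_cint_bounded_le F f (k : R) : cintegrable mu F -> cmeasurable f ->
  (forall x, normc (f x) <= k) ->
  ((normc (cint mu (fun x => F x * f x)))%:E <= (fine (\int[mu]_x (normc (F x))%:E))%:E * k%:E)%E.
Proof.
move=> iF mf fk; have [mF Fi] := iF.
have k0 : 0 <= k := le_trans (normc_ge0 _) (fk 0).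
have I0 : (0 <= \int[mu]_x (normc (F x))%:E)%E.
  by apply: integral_ge0 => x _; rewrite lee_fin normc_ge0.
have iFf : cintegrable mu (fun x => F x * f x).
  rewrite (_ : (fun x => _) = fun x => f x * F x).
    exact: cintegrable_bounded fk iF.
  by apply/funext => x; rewrite mulrC.
apply: (le_trans (le_normc_cint iFf)); rewrite fineK ?ge0_fin_numE//.
have mnF : measurable_fun setT (fun x => (normc (F x))%:E).
  by apply/measurable_EFinP; exact: cmeasurable_normc.
rewrite -ge0_integralZr//; last by move=> x _; rewrite lee_fin normc_ge0.
apply: ge0_le_integral => //.
- by move=> x _; rewrite lee_fin normc_ge0.
- by apply/measurable_EFinP; apply: cmeasurable_normc; have [] := iFf.
- by apply: emeasurable_funM.
- by move=> x _; rewrite -EFinM lee_fin normcM ler_wpM2l ?normc_ge0.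
Qed.

Lemma tempered_cintegrable F : cintegrable mu F ->
  tempered_distributions (fun phi => cint mu (fun x => F x * phi x)).
Proof.
move=> iF; split.
  move=> c f g sf sg; have [k1 h1] := schwartz_bounded sf; have [k2 h2] := schwartz_bounded sg.
  exact: (cint_bounded_linear c iF (schwartz_cmeasurable sf) (schwartz_cmeasurable sg) h1 h2).
exists (fine (\int[mu]_x (normc (F x))%:E)), 0%N, 0%N => phi sphi.
have [s [-> s0 hs]] := schwartz_seminorm0 sphi.
exact: normc_cint_bounded_le (schwartz_cmeasurable sphi) hs.
Qed.

Lemma fmul_regularE f h : fmul f (regular_functional h) =
  (fun phi => cint mu (fun x => (h x * f x) * phi x)).
Proof. by apply/funext => phi; apply: eq_cint => x; rewrite mulrA. Qed.

Lemma compact_box (K : set E) : compact K ->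
  exists rho : R, 1 <= rho /\ forall x, K x -> forall i, `|x ord0 i| <= rho.
Proof.
move=> cK.
have H i := compact_bound cK (@coord_continuous R 1 n ord0 i).
have [b hb] := choice H.
exists (1 + \sum_i `|b i|); split; first by rewrite lerDl sumr_ge0.
move=> x Kx i; apply: (le_trans (hb i x Kx)); apply: (le_trans (ler_norm _)).
by rewrite (bigD1 i)//= addrCA lerDl addr_ge0// sumr_ge0.
Qed.

Lemma test_function_box phi : test_function phi -> exists rho b : R,
  [/\ 1 <= rho, 0 <= b, forall x, normc (phi x) <= b &
   forall x, ~ (forall i, `|x ord0 i| <= rho) -> phi x = 0].
Proof.
move=> tphi; have [k hk] := schwartz_bounded (test_schwartz tphi).
have [_ cK] := tphi; have [rho [rho1 hrho]] := compact_box cK.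
exists rho, k; split => //; first exact: le_trans (normc_ge0 _) (hk 0).
move=> x nx; apply/eqP; apply/negPn/negP => h; apply: nx => i.
by apply: hrho; exact: subset_closure.
Qed.

(** * Local and uniform membership of the inverse power *)

Section local_membership.
Variable alpha : R.
Hypotheses (n0 : 0 < n%:R :> R) (al0 : 0 < alpha) (aln : alpha < n%:R).

Local Notation h := (@inverse_power R n alpha).
Let a := alpha / n%:R.

Let a0 : 0 < a. Proof. exact: divr_gt0. Qed.
Let a1 : a < 1. Proof. by rewrite /a ltr_pdivrMr// mul1r. Qed.

(** For alpha < n the inverse power is not integrable at infinity; multiplied by this indicator it
    is, and its pairing with functions vanishing outside the cube is unchanged. *)
Let box_indic rho x : C := if `[< forall i, `|x ord0 i - (0 : E) ord0 i| <= rho >] then 1 else 0.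

Let cmeasurable_box_indic rho : cmeasurable (box_indic rho).
Proof.
(* With exponent 0 the majorant is exactly the indicator, as a zeroth power is 1 even at 0. *)
rewrite (_ : box_indic rho = fun x => ((near_box 0 rho 0 x)%:C)%C).
  by apply: cmeasurable_real; exact: measurable_near_box.
apply/funext => x; rewrite /box_indic /near_box; case: asboolP => H.
  by rewrite big1// => i _; rewrite H oppr0 powRr0.
have [i /negP/negbTE Hi] : exists i, ~ (`|x ord0 i - (0 : E) ord0 i| <= rho) by exact/existsNP.
by rewrite (bigD1 i)//= Hi mul0r.
Qed.

Lemma cintegrable_inverse_powerM f z rho (b : R) : 0 <= rho -> 0 <= b -> cmeasurable f ->
  (forall x, normc (f x) <= b) ->
  (forall x, ~ (forall i, `|x ord0 i - z ord0 i| <= rho) -> f x = 0) ->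
  cintegrable mu (fun x => h x * f x).
Proof.
move=> rho0 b0 mf fb f0.
apply: (@cintegrable_near_box _ z rho a b) => //.
  by apply: cmeasurableM => //; exact: cmeasurable_inverse_power.
exact: inverse_powerM_near_box.
Qed.

Let cintegrable_indic rho : 1 <= rho -> cintegrable mu (fun x => h x * box_indic rho x).
Proof.
move=> rho1; apply: (@cintegrable_inverse_powerM _ 0 rho 1) => //.
- exact: le_trans rho1.
- by move=> x; rewrite /box_indic; case: asboolP => _; rewrite ?normc1 ?normc0.
- by move=> x H; rewrite /box_indic; case: asboolP.
Qed.

Let regularE rho phi : (forall x, ~ (forall i, `|x ord0 i| <= rho) -> phi x = 0) ->
  regular_functional h phi = cint mu (fun x => (h x * box_indic rho x) * phi x).
Proof.
move=> hphi; apply: eq_cint => x; rewrite /box_indic; case: asboolP => H; first by rewrite mulr1.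
rewrite hphi ?mulr0// => H'; apply: H => i; by rewrite mxE subr0.
Qed.

Lemma distribution_inverse_power : distributions (regular_functional h).
Proof.
split.
  move=> c f g tf tg.
  have [r1 [b1 [r11 _ fb f0]]] := test_function_box tf.
  have [r2 [b2 [r21 _ gb g0]]] := test_function_box tg.
  pose r := Num.max r1 r2.
  have r1' : 1 <= r by rewrite le_max r11.
  have f0' x : ~ (forall i, `|x ord0 i| <= r) -> f x = 0.
    by move=> H; apply: f0 => H'; apply: H => i; rewrite le_max H'.
  have g0' x : ~ (forall i, `|x ord0 i| <= r) -> g x = 0.
    by move=> H; apply: g0 => H'; apply: H => i; rewrite le_max H' orbT.
  rewrite (regularE f0') (regularE g0') (@regularE r).
    have mf := schwartz_cmeasurable (test_schwartz tf).
    have mg := schwartz_cmeasurable (test_schwartz tg).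
    exact: (cint_bounded_linear c (cintegrable_indic r1') mf mg fb gb).
  by move=> x H; rewrite f0'// g0'// mulr0 addr0.
move=> K cK; have [r [r1 hr]] := compact_box cK.
exists (fine (\int[mu]_x (normc (h x * box_indic r x))%:E)), 0%N => phi tphi phiK.
have sphi := test_schwartz tphi.
have [s [-> s0 hs]] := schwartz_seminorm0 sphi.
rewrite (@regularE r); last by move=> x H; apply: phiK => Kx; apply: H; exact: hr.
exact: normc_cint_bounded_le (cintegrable_indic r1) (schwartz_cmeasurable sphi) hs.
Qed.

Lemma inverse_power_density m p rho : 0 <= m -> m * 2 < n%:R -> m < alpha -> 2 < p ->
  (alpha - m) * p < n%:R -> 1 <= rho ->
  exists c : R, forall z f (b : R), cmeasurable f -> 0 <= b -> (forall x, normc (f x) <= b) ->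
  (forall x, ~ (forall i, `|x ord0 i - z ord0 i| <= rho) -> f x = 0) ->
  exists g, bessel_density (- m) p (fmul f (regular_functional h)) g /\
    (Lp_norm p g <= (b * c)%:E)%E.
Proof.
move=> m0 mn ma p2 amp rho1.
have na : n%:R * a = alpha by rewrite /a mulrC divfK// gt_eqF.
have [||c hc] := @near_box_density m a p rho m0 mn _ a1 p2 _ rho1; [by rewrite na|by rewrite na|].
exists c => z f b mf b0 fb f0.
have mF : cmeasurable (fun x => h x * f x).
  by apply: cmeasurableM => //; exact: cmeasurable_inverse_power.
have [g [mg gn hg]] := hc z _ b mF b0 (inverse_powerM_near_box n0 al0 b0 fb f0).
exists g; split => //; split.
  by have [g1 g2] := mg; split => //; apply: le_lt_trans gn _; rewrite ltry.
by move=> phi sphi; rewrite fmul_regularE; exact: hg.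
Qed.

Lemma inverse_power_bessel_loc m p : 0 <= m -> m * 2 < n%:R -> m < alpha -> 2 < p ->
  (alpha - m) * p < n%:R -> bessel_loc (- m) p (regular_functional h).
Proof.
move=> m0 mn ma p2 amp; split; first exact: distribution_inverse_power.
move=> f tf; have [r [b [r1 b0 fb f0]]] := test_function_box tf.
have mf := schwartz_cmeasurable (test_schwartz tf).
have f0' x : ~ (forall i, `|x ord0 i - (0 : E) ord0 i| <= r) -> f x = 0.
  by move=> H; apply: f0 => H'; apply: H => i; rewrite mxE subr0.
split.
  rewrite fmul_regularE; apply: tempered_cintegrable.
  by apply: (cintegrable_inverse_powerM _ b0 mf fb f0'); exact: le_trans r1.
have [c hc] := inverse_power_density m0 mn ma p2 amp r1.
by have [g [dg _]] := hc 0 f b mf b0 fb f0'; exists g.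
Qed.

Lemma inverse_power_bessel_unif (eta : E -> R) m p : cutoff eta ->
  0 <= m -> m * 2 < n%:R -> m < alpha -> 2 < p -> (alpha - m) * p < n%:R ->
  bessel_unif eta (- m) p (regular_functional h).
Proof.
move=> [teta eta01 eta1 eta0] m0 mn ma p2 amp; split; first exact: inverse_power_bessel_loc.
(* The translated cutoff is bounded by 1 and vanishes outside the cube of half-side 2 around z, so
   one constant serves all z. *)
have [c hc] := @inverse_power_density m p 2 m0 mn ma p2 amp (ler1n _ 2).
apply: (@le_lt_trans _ _ (1 * c)%:E); last exact: ltry.
apply: ge_ereal_sup => _ [z _ <-].
have meta := schwartz_cmeasurable (test_schwartz teta).
have mz : cmeasurable (cutoff_at eta z).
  rewrite (_ : cutoff_at eta z = fun x => (fun y => ((eta y)%:C)%C) (1 *: x + (- z))).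
    exact: (cmeasurable_rV_affine 1 (- z) meta).
  by apply/funext => x; rewrite scale1r.
have [||g [dg gn]] := hc z _ 1 mz ler01.
- move=> x; rewrite /cutoff_at normc_real ger0_norm; first by have /andP[] := eta01 (x - z).
  by have /andP[] := eta01 (x - z).
- move=> x H; rewrite /cutoff_at eta0//; apply/negP => H'; apply: H => i.
  move/negP: H'; rewrite -ltNge => H'; have := normr_coord_le (x - z) i; rewrite !mxE => h1.
  by rewrite (le_trans h1)// ltW.
apply: le_trans gn; apply: ereal_inf_lbound; by exists g.
Qed.

End local_membership.

End near_box.

(** * Failure of the multiplier estimate *)

Section non_multiplier.
Context (R : realType) (n : nat).
Local Notation E := 'rV[R]_n.
Local Notation mu := (lebesgue_rV R n).
Local Notation leb := (@lebesgue_measure R).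
Local Notation C := R[i].
Implicit Types (f g phi : E -> C) (e : E -> R) (x y v xi : E) (s t r : R).

Lemma ge0_integral_ge_box (f : E -> R) r (b : R) : 0 <= r -> measurable_fun setT f ->
  (forall x, 0 <= f x) -> 0 <= b ->
  {ae mu, forall x, (forall i, `|x ord0 i| <= r) -> b <= f x} ->
  ((b * (2 * r) ^+ n)%:E <= \int[mu]_x (f x)%:E)%E.
Proof.
move=> r0 mf f0 b0 bf; pose k (i : 'I_n) (u : R) : R := if `|u - 0| <= r then 1 else 0.
have mk i : measurable_fun [set: R] (k i) by apply: measurable_if_absB.
have k0 i u : 0 <= k i u by rewrite /k; case: ifP.
have mP : measurable_fun setT (fun x : E => \prod_(i < n) k i (x ord0 i)).
  by apply: measurable_prod => i _; exact: (measurableT_comp (mk i) (@measurable_coord R n i)).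
have -> : ((b * (2 * r) ^+ n)%:E = b%:E * \int[mu]_x (\prod_(i < n) k i (x ord0 i))%:E)%E.
  rewrite (ge0_integral_rV_prod mk k0) EFinM; congr (_ * _)%E.
  rewrite -[X in _ ^+ X](card_ord n) -prodr_const -prodEFin.
  by apply: eq_bigr => i _; rewrite integral_absB_le.
rewrite -ge0_integralZl//; first last.
- by move=> x _; rewrite lee_fin prodr_ge0.
- by apply/measurable_EFinP.
apply: ae_ge0_le_integral => //.
- by move=> x _; rewrite mule_ge0// lee_fin prodr_ge0.
- by apply: measurable_funeM; apply/measurable_EFinP.
- by move=> x _; rewrite lee_fin.
- by apply/measurable_EFinP.
apply: filterS bf => x bfx _; rewrite -EFinM lee_fin.
have [H|/existsNP[i /negP/negbTE Hi]] := pselect (forall i, `|x ord0 i| <= r).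
  by rewrite big1 ?mulr1 ?bfx// => i _; rewrite /k subr0 H.
by rewrite (bigD1 i)//= {1}/k subr0 Hi mul0r mulr0.
Qed.

Lemma sqr_euclid_norm_box x r : (forall i, `|x ord0 i| <= r) -> euclid_norm x ^+ 2 <= n%:R * r ^+ 2.
Proof.
move=> xr; rewrite sqr_euclid_norm /dotprod.
apply: (@le_trans _ _ (\sum_(i < n) r ^+ 2)); last by rewrite sumr_const card_ord mulr_natl.
apply: ler_sum => i _; rewrite -expr2 -real_normK ?num_real//.
by rewrite lerXn2r ?nnegrE// (le_trans _ (xr i)).
Qed.

(** At the parabolic scale tau >= r^2 the exponent |v|^2 / (4 tau) is at most n, and tau <= 2 r^2
    bounds the normalising factor from below. *)
Lemma heat_ge_box (h tau r : R) v : 0 < r -> h = r ^+ 2 -> h <= tau <= 2 * h ->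
  (forall i, `|v ord0 i| <= 2 * r) ->
  (r^-1) ^+ n * (((Num.sqrt (8 * pi))^-1) ^+ n * expR (- n%:R)) <= heat tau v.
Proof.
move=> r0 -> /andP[t1 t2] vr; have p0 := pi_gt0 R.
have r20 : 0 < r ^+ 2 by rewrite exprn_gt0.
have t0 : 0 < tau by exact: lt_le_trans t1.
rewrite /heat mulrA -exprMn; apply: ler_pM.
- by rewrite exprn_ge0// mulr_ge0// invr_ge0 ?sqrtr_ge0// ltW.
- exact: expR_ge0.
- rewrite lerXn2r ?nnegrE ?invr_ge0 ?sqrtr_ge0//.
    by rewrite mulr_ge0// invr_ge0 ?sqrtr_ge0// ltW.
  have -> : r^-1 / Num.sqrt (8 * pi) = (Num.sqrt (8 * pi * r ^+ 2))^-1.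
    have p8 : 0 <= 8 * pi :> R by rewrite mulr_ge0// ltW.
    by rewrite (sqrtrM (r ^+ 2) p8) sqrtr_sqr gtr0_norm// invfM mulrC.
  rewrite lef_pV2 ?posrE ?sqrtr_gt0 ?mulr_gt0// ler_wsqrtr//.
  have -> : 8 * pi * r ^+ 2 = 4 * pi * (2 * r ^+ 2) by ring.
  by rewrite ler_pM2l// mulr_gt0.
- rewrite /gaussn /gaussian ler_expR lerN2.
  have := sqr_euclid_norm_box vr; rewrite exprMn => h1.
  rewrite mulrC ler_pdivrMr ?mulr_gt0//.
  by apply: (le_trans h1); apply: ler_wpM2l => //; lra.
Qed.

(** Only heat times in [r^2, 2 r^2] and points y of the cube are kept. The heat kernel is of order
    r^(-n) on a volume (2 r)^n, and the Gamma weight of order r^(t-2) on an interval of length r^2,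
    whence r^t; what is discarded is nonnegative. *)
Lemma bessel_potential_box_ge t : 0 <= t -> exists2 c : R, 0 < c &
  forall e r, schwartz (fun x => ((e x)%:C)%C) -> (forall x, 0 <= e x) -> 0 < r -> r <= 1 ->
  (forall x, (forall i, `|x ord0 i| <= r) -> e x = 1) ->
  let P := fourier (fun xi => bessel_weight (- t) xi * inv_fourier (fun x => ((e x)%:C)%C) xi) in
  (forall x, 0 <= complex.Re (P x)) /\
  (forall x, (forall i, `|x ord0 i| <= r) -> c * r `^ t <= complex.Re (P x)).
Proof.
move=> t0; have [t00|tn0] := eqVneq t 0.
  exists 1 => // e r se e0 r0 r1 e1 P.
  have PE x : P x = ((e x)%:C)%C by rewrite /P t00 oppr0 bessel_potential0.
  by split => x; rewrite PE //= t00 powRr0 mulr1 => xr; rewrite e1.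
have {}t0 : 0 < t by rewrite lt_neqAle eq_sym tn0.
have a0 : 0 < t / 2 by rewrite divr_gt0.
have G0 := gamma_cst_gt0 a0; have p0 := pi_gt0 R.
pose c0 : R := ((Num.sqrt (8 * pi))^-1) ^+ n * expR (- n%:R).
have c00 : 0 < c0 by rewrite mulr_gt0 ?expR_gt0// exprn_gt0// invr_gt0 sqrtr_gt0 mulr_gt0.
have c0E : c0 = ((Num.sqrt (8 * pi))^-1) ^+ n * expR (- n%:R) by [].
clearbody c0.
exists ((gamma_cst (t / 2))^-1 * (2^-1 * expR (- 2) * (c0 * 2 ^+ n))).
  apply: mulr_gt0; first by rewrite invr_gt0.
  apply: mulr_gt0; first by apply: mulr_gt0; rewrite ?invr_gt0// expR_gt0.
  by apply: mulr_gt0 => //; exact: exprn_gt0.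
move=> e r se e0 r0 r1 e1 P.
have [k hk] := schwartz_bounded se.
have [me _] := schwartz_cmeasurable se.
have ek x : e x <= k by have := hk x; rewrite normc_real ger0_norm.
pose q x (tau : R) := gamma_kernel (t / 2) tau *
  Rintegral mu setT (fun y => heat tau (x - y) * e y).
have PE x : P x = (((gamma_cst (t / 2))^-1 * Rintegral leb setT (q x))%:C)%C.
  rewrite /P bessel_potential_heat// rmorphM /=; congr (_ * _).
  rewrite -cint_real; apply: eq_cint => tau; rewrite /q rmorphM /=; congr (_ * _).
  rewrite -(cint_real mu (fun y => heat tau (x - y) * e y)); apply: eq_cint => y.
  by rewrite [RHS]rmorphM.
have Q0 x tau : 0 <= Rintegral mu setT (fun y => heat tau (x - y) * e y).
  by apply: Rintegral_ge0 => y _; rewrite mulr_ge0// heat_ge0.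
have q0 x tau : 0 <= q x tau by rewrite mulr_ge0 ?gamma_kernel_ge0.
split=> x.
  rewrite PE /= mulr_ge0 ?invr_ge0 ?(ltW G0)//.
  by apply: Rintegral_ge0 => tau _; exact: q0.
move=> xr; rewrite PE /= -!mulrA; apply: ler_wpM2l; first by rewrite invr_ge0 ltW.
have se' : cintegrable mu (fun y => ((e y)%:C)%C) by exact: schwartz_cintegrable.
have ih tau : 0 < tau -> mu.-integrable setT (fun y => (heat tau (x - y) * e y)%:E).
  move=> t1; have [+ _] := (cintegrableP _ _).1 (cintegrable_heatM x t1 se').
  by apply: eq_integrable => // y _; rewrite cReM /= mulr0 subr0.
pose f2 (z : measurableTypeR R * E) : R := gamma_kernel (t / 2) z.1 * heat z.1 (x - z.2) * e z.2.
have f20 z : 0 <= f2 z by rewrite mulr_ge0 ?gamma_heat_ge0.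
have mf2 : measurable_fun setT f2.
  apply: measurable_funM; first exact: measurable_gamma_heat_shift.
  exact: (measurableT_comp me measurable_snd).
have if2 : (leb \x mu)%E.-integrable setT (EFin \o f2).
  apply: (le_integrable measurableT _ _ (integrableZl measurableT k (integrable_gamma_heat_shift x a0))).
    by apply/measurable_EFinP.
  move=> z _ /=; rewrite lee_fin ger0_norm// ger0_norm; last first.
    by rewrite mulr_ge0 ?gamma_heat_ge0// (le_trans _ (ek 0)).
  by rewrite /f2 mulrC ler_wpM2r ?gamma_heat_ge0.
have qE tau : q x tau = Rintegral mu setT (fun y => f2 (tau, y)).
  have [t1|t1] := leP tau 0.
    have g0 : gamma_kernel (t / 2) tau = 0 by rewrite /gamma_kernel ltNge t1.
    rewrite /q g0 mul0r /Rintegral integral0_eq// => y _.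
    by rewrite /f2 /= g0 !mul0r.
  rewrite /q -RintegralZl//; last exact: ih.
  by apply: eq_Rintegral => y _; rewrite /f2 /= mulrA.
have mq : measurable_fun [set: measurableTypeR R] (q x).
  apply: eq_measurable_fun (measurable_Rintegral_fubini1 if2) => tau _.
  by rewrite qE.
(* Finiteness matters for a lower bound: [Rintegral] of a divergent integral would be 0. *)
have qy : (\int[leb]_tau (q x tau)%:E < +oo)%E.
  have /integrableP[_] := if2.
  rewrite (_ : (\int[(leb \x mu)%E]_z _ = \int[(leb \x mu)%E]_z (f2 z)%:E)%E); last first.
    by apply: eq_integral => z _ /=; rewrite ger0_norm.
  rewrite fubini_tonelli1; first last.
  - by move=> z; rewrite lee_fin.
  - by apply/measurable_EFinP.
  apply: le_lt_trans; apply: ge0_le_integral => //.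
  - by move=> tau _; rewrite lee_fin.
  - by apply/measurable_EFinP.
  - apply: (@measurable_fun_fubini_tonelli_F _ _ _ _ _ mu (fun z => (f2 z)%:E)).
      by apply/measurable_EFinP.
    by move=> z; rewrite lee_fin.
  - move=> tau _; rewrite qE /Rintegral /fubini_F.
    have : (0 <= \int[mu]_y (f2 (tau, y))%:E)%E by apply: integral_ge0 => y _; rewrite lee_fin.
    by case: (integral _ _ _) => //= _; exact: leey.
have r20 : 0 < r ^+ 2 by rewrite exprn_gt0.
pose b := (r ^+ 2) `^ (t / 2) / (2 * r ^+ 2) * expR (- (2 * r ^+ 2)) * (c0 * 2 ^+ n).
have b1 : 0 <= (r ^+ 2) `^ (t / 2) / (2 * r ^+ 2) * expR (- (2 * r ^+ 2)).
  by rewrite mulr_ge0 ?expR_ge0// divr_ge0 ?powR_ge0// mulr_ge0// ltW.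
have b2 : 0 <= c0 * 2 ^+ n by rewrite mulr_ge0 ?exprn_ge0// ltW.
have qb tau : r ^+ 2 <= tau <= 2 * r ^+ 2 -> b <= q x tau.
  move=> ht; have t1 : 0 < tau by have /andP[h1 _] := ht; exact: lt_le_trans h1.
  apply: ler_pM.
  - exact: b1.
  - exact: b2.
  - exact: gamma_kernel_ge.
  rewrite -lee_fin /Rintegral fineK; last exact: integrable_fin_num (ih tau t1).
  (* The factor r^(-n) of the heat kernel cancels against the volume (2 r)^n of the cube. *)
  have -> : c0 * 2 ^+ n = (r^-1) ^+ n * c0 * (2 * r) ^+ n.
    rewrite [r^-1 ^+ n * c0]mulrC -mulrA -exprMn; congr (_ * _ ^+ n).
    by rewrite mulrCA mulVf ?mulr1// gt_eqF.
  apply: ge0_integral_ge_box.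
  - exact: ltW.
  - by have := measurable_int _ (ih tau t1); move/measurable_EFinP.
  - by move=> y; rewrite mulr_ge0 ?heat_ge0.
  - by rewrite mulr_ge0 ?exprn_ge0 ?invr_ge0 ?(ltW r0)// ltW.
  - apply: nearW => y yr; rewrite e1// mulr1; rewrite c0E; apply: (heat_ge_box r0 erefl ht) => i.
    rewrite !mxE (le_trans (ler_normB _ _))//.
    by rewrite mulrDl mul1r lerD.
rewrite -lee_fin /Rintegral fineK; last first.
  by rewrite ge0_fin_numE//; apply: integral_ge0 => tau _; rewrite lee_fin.
apply: (@le_trans _ _ (b * (2 * r ^+ 2 - r ^+ 2))%:E); last first.
  apply: ge0_integral_ge_segment => //.
  - by rewrite ler_peMl ?(ltW r20)// ler1n.
  - by apply: mulr_ge0.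
rewrite lee_fin /b.
have -> : (r ^+ 2) `^ (t / 2) = r `^ t.
  rewrite -powR_mulrn ?(ltW r0)// -powRrM; by congr (_ `^ _); field.
have -> : r `^ t / (2 * r ^+ 2) * expR (- (2 * r ^+ 2)) * (c0 * 2 ^+ n) * (2 * r ^+ 2 - r ^+ 2) =
   2^-1 * (expR (- (2 * r ^+ 2)) * (c0 * (2 ^+ n * r `^ t))).
  by field; rewrite gt_eqF.
apply: ler_wpM2l; first by rewrite invr_ge0.
apply: ler_wpM2r.
  by rewrite mulr_ge0 ?(ltW c00)// mulr_ge0 ?exprn_ge0 ?powR_ge0.
rewrite ler_expR lerN2 ler_piMr// expr_le1// ltW//.
Qed.

Lemma Lp_norm2E g : Lp_norm 2 g = ((\int[mu]_x (normc (g x) ^+ 2)%:E) `^ 2^-1)%E.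
Proof.
rewrite /Lp_norm unlock; congr (_ `^ _)%E; apply: eq_integral => x _.
by rewrite /= ger0_norm ?normc_ge0// powR_mulrn// normc_ge0.
Qed.

Lemma Lp_norm2_le g (K D : R) : 0 <= K -> 0 <= D ->
  (\int[mu]_x (normc (g x) ^+ 2)%:E <= (K ^+ 2 * D)%:E)%E ->
  (Lp_norm 2 g <= (K * D `^ 2^-1)%:E)%E.
Proof.
move=> K0 D0 gKD; rewrite Lp_norm2E.
have -> : (K * D `^ 2^-1)%:E = ((K ^+ 2 * D)%:E `^ 2^-1)%E.
  rewrite poweR_EFin powRM ?exprn_ge0//; congr (_ * _)%:E.
  by rewrite -powR_mulrn// -powRrM mulfV// powRr1.
apply: gt0_ler_poweR => //.
- by rewrite in_itv/= leey andbT; apply: integral_ge0 => x _; rewrite lee_fin exprn_ge0// normc_ge0.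
- by rewrite in_itv/= leey andbT lee_fin mulr_ge0// exprn_ge0.
Qed.

Lemma normc_cintM_le f g : cmeasurable f -> cmeasurable g ->
  (Lp_norm 2 f < +oo)%E -> (Lp_norm 2 g < +oo)%E ->
  ((normc (cint mu (fun x => f x * g x)))%:E <= Lp_norm 2 f * Lp_norm 2 g)%E.
Proof.
move=> mf mg fy gy.
have mnf := cmeasurable_normc mf; have mng := cmeasurable_normc mg.
have h2 : (2:R)^-1 + 2^-1 = 1 by lra.
have := @hoelder _ _ _ mu (fun x => normc (f x)) (fun x => normc (g x)) 2 2 mnf mng (ltr0n _ 2) (ltr0n _ 2) h2.
rewrite Lnorm1 (_ : (\int[mu]_x _ = \int[mu]_x (normc (f x * g x))%:E)%E); last first.
  by apply: eq_integral => x _ /=; rewrite normcM ger0_norm// mulr_ge0// normc_ge0.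
move=> H; apply: (le_trans _ H).
apply: le_normc_cint; split; first exact: cmeasurableM.
apply: (le_lt_trans H).
have fin h : (Lp_norm 2 h < +oo)%E -> Lp_norm 2 h \is a fin_num.
  by move=> hy; rewrite ge0_fin_numE// Lnorm_ge0.
by rewrite ltey_eq fin_numM// fin.
Qed.

Lemma ft_scale sg phi xi (k : R) : 0 < k -> cintegrable mu phi ->
  ft sg (fun x => phi (k *: x)) xi = (((k^-1) ^+ n)%:C)%C * ft sg phi (k^-1 *: xi).
Proof.
move=> k0 iphi; rewrite /ft mulrCA; congr (_ * _).
have kn0 : k != 0 by rewrite gt_eqF.
have := cint_rV_affine 0 kn0 (cintegrable_expiM sg (k^-1 *: xi) iphi).
rewrite gtr0_norm// => <-; apply: eq_cint => x; rewrite addr0; congr (expi (_ * _) * _).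
by rewrite dotprodZl [dotprod x (_ *: _)]dotprodC dotprodZl mulVKf// dotprodC.
Qed.

Lemma bweight_scale s x (k : R) : 0 <= s -> 1 <= k ->
  bweight s (k *: x) <= k `^ s * bweight s x.
Proof.
move=> s0 k1; have k0 : 0 <= k := le_trans ler01 k1.
have -> : k `^ s = (k ^+ 2) `^ (s / 2).
  by rewrite -powR_mulrn// -powRrM; congr (_ `^ _); field.
rewrite /bweight -powRM ?exprn_ge0 ?addr_ge0 ?exprn_ge0//; last exact: euclid_norm_ge0.
apply: ge0_ler_powR.
- by rewrite divr_ge0.
- by rewrite nnegrE addr_ge0// sqr_ge0.
- by rewrite nnegrE mulr_ge0 ?exprn_ge0// addr_ge0// sqr_ge0.
- rewrite !sqr_euclid_norm dotprodZl dotprodC dotprodZl mulrDr mulr1 mulrA -expr2 lerD2r.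
  by rewrite expr_ge1.
Qed.

Lemma integral_sqr_bweight_ft s sg phi : sg * sg = 1 -> schwartz phi ->
  (\int[mu]_xi (normc (bessel_weight s xi * ft sg phi xi) ^+ 2)%:E < +oo)%E.
Proof.
move=> sg1 sphi; have [c hc] := bweight_ft_decay s sg1 sphi.
have [mw wi] := cintegrable_bweight_ft s sg1 sphi.
have c0 : 0 <= c.
  have := le_trans (normc_ge0 _) (hc 0); by rewrite pmulr_lge0// prodweight_gt0.
have pw1 (x : E) : prodweight x <= 1.
  apply: (@le_trans _ _ (\prod_(i < n) 1)); last by rewrite big1.
  apply: ler_prod => i _; rewrite invr_ge0 addr_ge0 ?sqr_ge0//=.
  by rewrite invf_le1 ?ltr_pwDl ?sqr_ge0// lerDl sqr_ge0.
apply: (@le_lt_trans _ _ (\int[mu]_xi (c%:E * (normc (bessel_weight s xi * ft sg phi xi))%:E))%E).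
  have mn : measurable_fun setT (fun xi => normc (bessel_weight s xi * ft sg phi xi)).
    exact: cmeasurable_normc.
  apply: ge0_le_integral => //.
  - by move=> x _; rewrite lee_fin exprn_ge0// normc_ge0.
  - by apply/measurable_EFinP; exact: measurable_funX.
  - by apply: measurable_funeM; apply/measurable_EFinP.
  - move=> x _; rewrite -EFinM lee_fin expr2; apply: ler_wpM2r; first exact: normc_ge0.
    by rewrite (le_trans (hc x))// ler_piMr.
rewrite ge0_integralZl//; first last.
- by move=> x _; rewrite lee_fin normc_ge0.
- by apply/measurable_EFinP; exact: cmeasurable_normc.
by rewrite lte_mul_pinfty ?lee_fin.
Qed.

(** The transform of the dilate is k^(-n) times the transform at xi / k, the weight at xi is at most
    k^s times the weight at xi / k, and the change of variables returns k^n. The square integral is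
    thus of order k^(2s - n). *)
Lemma integral_bweight_ft_scale s phi : 0 <= s -> schwartz phi ->
  exists2 D : R, 0 <= D & forall k : R, 1 <= k ->
  (\int[mu]_xi (normc (bessel_weight s xi * ft (-1) (fun x => phi (k *: x)) xi) ^+ 2)%:E <=
    ((k `^ s * k `^ (- (n%:R / 2))) ^+ 2 * D)%:E)%E.
Proof.
move=> s0 sphi.
have N1 : -1 * -1 = 1 :> R by rewrite mulrNN mulr1.
have := integral_sqr_bweight_ft s N1 sphi; set I := (\int[mu]_xi _)%E => Iy.
have I0 : (0 <= I)%E by apply: integral_ge0 => x _; rewrite lee_fin exprn_ge0// normc_ge0.
exists (fine I); first exact: fine_ge0.
move=> k k1; have k0 : 0 < k by exact: lt_le_trans k1.
have iphi : cintegrable mu phi by exact: schwartz_cintegrable.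
have [mw _] := cintegrable_bweight_ft s N1 sphi.
have mn : measurable_fun setT (fun xi => (normc (bessel_weight s xi * ft (-1) phi xi) ^+ 2)%:E).
  by apply/measurable_EFinP; apply: measurable_funX; exact: cmeasurable_normc.
pose c := ((k^-1) ^+ n * k `^ s) ^+ 2.
apply: (@le_trans _ _ (\int[mu]_xi (fun xi => (c%:E * (normc (bessel_weight s xi * ft (-1) phi xi) ^+ 2)%:E)) (k^-1 *: xi + 0)%R)%E).
  apply: ge0_le_integral => //.
  - by move=> x _; rewrite lee_fin exprn_ge0// normc_ge0.
  - apply/measurable_EFinP; apply: measurable_funX; apply: cmeasurable_normc.
    apply: cmeasurableM; first exact: cmeasurable_bessel_weight.
    apply: cmeasurable_ft.
    have := cintegrable_rV_affine 0 (lt0r_neq0 k0) iphi.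
    by under eq_fun do rewrite addr0.
  - by apply: measurable_funeM; exact: (measurable_comp_rV_affine k^-1 0 mn).
  - move=> x _; rewrite addr0 -EFinM lee_fin /c ft_scale// -exprMn.
    move: (ft (-1) phi (k^-1 *: x)) => w.
    rewrite lerXn2r ?nnegrE ?normc_ge0//.
      by rewrite !mulr_ge0 ?exprn_ge0 ?invr_ge0 ?(ltW k0) ?powR_ge0 ?normc_ge0.
    rewrite !normcM !bessel_weightE !normc_real !ger0_norm ?bweight_ge0 ?exprn_ge0 ?invr_ge0 ?(ltW k0)//.
    have := bweight_scale (k^-1 *: x) s0 k1.
    rewrite scalerA mulfV ?gt_eqF// scale1r => h.
    rewrite mulrCA -[leRHS]mulrA; apply: ler_wpM2l; first by rewrite exprn_ge0// invr_ge0 ltW.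
    by rewrite mulrA ler_wpM2r ?normc_ge0.
rewrite (ge0_integral_rV_affine 0 _ (f := fun xi => (c%:E * (normc (bessel_weight s xi * ft (-1) phi xi) ^+ 2)%:E)%E)).
- rewrite ge0_integralZl//; first last.
  + by rewrite lee_fin exprn_ge0// mulr_ge0 ?exprn_ge0 ?invr_ge0 ?(ltW k0)// powR_ge0.
  + by move=> x _; rewrite lee_fin exprn_ge0// normc_ge0.
  rewrite gtr0_norm ?invr_gt0// invrK -/I -(fineK (x := I)) ?ge0_fin_numE// muleA -!EFinM lee_fin.
  rewrite ler_wpM2r ?fine_ge0// le_eqVlt; apply/orP; left; apply/eqP.
  have e : (k `^ (- (n%:R / 2))) ^+ 2 = (k ^+ n)^-1.
    by rewrite -powR_mulrn ?powR_ge0// -powRrM mulNr divfK// powR_invn// ltW.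
  rewrite /c [RHS]exprMn e [((k^-1) ^+ n * _) ^+ 2]exprMn exprVn.
  have q0 : k ^+ n != 0 by rewrite expf_neq0// gt_eqF.
  by field.
- by rewrite invr_neq0// gt_eqF.
- exact: measurable_funeM.
- by move=> x; rewrite mule_ge0// lee_fin ?exprn_ge0 ?normc_ge0// mulr_ge0 ?exprn_ge0 ?invr_ge0 ?(ltW k0)// powR_ge0.
Qed.

(** The function J_s phi, with the potential applied to the function rather than transposed to a
    test function. *)
Definition bessel_lift s phi : E -> C :=
  ft 1 (fun xi => bessel_weight s xi * ft (-1) phi xi).

(** Two applications of [ft_mul] transpose both transforms from [psi] back onto [phi]. *)
Lemma bessel_density_schwartz s phi : schwartz phi ->
  (Lp_norm 2 (bessel_lift s phi) < +oo)%E ->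
  bessel_density s 2 (regular_functional phi) (bessel_lift s phi).
Proof.
move=> sphi hy; have N1 : -1 * -1 = 1 :> R by rewrite mulrNN mulr1.
have iw := cintegrable_bweight_ft s N1 sphi.
have [g1 g2] := cmeasurable_ft 1 iw.
split; first by split.
move=> psi spsi.
have iphi := schwartz_cintegrable sphi; have ipsi := schwartz_cintegrable spsi.
have iv := cintegrable_bweight_ft s (mulr1 (1:R)) spsi.
transitivity (cint mu (fun x => phi x * ft (-1) (fun xi => bessel_weight s xi * ft 1 psi xi) x)).
  by rewrite -inv_fourierE -fourierE.
rewrite (ft_mul (-1) iphi iv).
transitivity (cint mu (fun x => (bessel_weight s x * ft (-1) phi x) * ft 1 psi x)).
  by apply: eq_cint => x; rewrite mulrCA mulrA.
by rewrite (ft_mul 1 iw ipsi).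
Qed.

Lemma bessel_norm_scale s phi : 0 <= s -> test_function phi ->
  exists2 A : R, 0 <= A & forall k : R, 1 <= k ->
  (bessel_norm s 2 (regular_functional (fun x => phi (k *: x))) <=
    (k `^ s * k `^ (- (n%:R / 2)) * A)%:E)%E.
Proof.
move=> s0 tphi; have sphi := test_schwartz tphi.
have [D D0 hD] := integral_bweight_ft_scale s0 sphi.
exists (D `^ 2^-1); first exact: powR_ge0.
move=> k k1; have k0 : 0 < k by exact: lt_le_trans k1.
have N1 : -1 * -1 = 1 :> R by rewrite mulrNN mulr1.
have sk := test_schwartz (test_function_scale (lt0r_neq0 k0) tphi).
set phik := fun x => phi (k *: x) in sk *.
have iw := cintegrable_bweight_ft s N1 sk.
have le : (Lp_norm 2 (bessel_lift s phik) <=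
    (k `^ s * k `^ (- (n%:R / 2)) * D `^ 2^-1)%:E)%E.
  apply: Lp_norm2_le => //; first by rewrite mulr_ge0 ?powR_ge0.
  apply: le_trans (hD k k1); apply: plancherel_le => //; exact: mulr1.
apply: (le_trans _ le); apply: ereal_inf_lbound.
exists (bessel_lift s phik) => //.
apply: bessel_density_schwartz => //.
by apply: (le_lt_trans le); rewrite ltry.
Qed.

Lemma Lp_norm2_scale phi : schwartz phi ->
  exists2 N : R, 0 <= N & forall k : R, 0 < k ->
  (Lp_norm 2 (fun x => phi (k *: x)) <= (k `^ (- (n%:R / 2)) * N)%:E)%E.
Proof.
move=> sphi; have [K hK] := schwartz_bounded sphi.
have [mphi iphi] := schwartz_cintegrable sphi.
have K0 : 0 <= K := le_trans (normc_ge0 _) (hK 0).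
set I := (\int[mu]_x (normc (phi x) ^+ 2)%:E)%E.
have mn : measurable_fun setT (fun x => (normc (phi x) ^+ 2)%:E).
  by apply/measurable_EFinP; apply: measurable_funX; exact: cmeasurable_normc.
have I0 : (0 <= I)%E by apply: integral_ge0 => x _; rewrite lee_fin exprn_ge0// normc_ge0.
have Iy : (I < +oo)%E.
  apply: (@le_lt_trans _ _ (\int[mu]_x (K%:E * (normc (phi x))%:E))%E).
    apply: ge0_le_integral => //.
    - by move=> x _; rewrite lee_fin exprn_ge0// normc_ge0.
    - by apply: measurable_funeM; apply/measurable_EFinP; exact: cmeasurable_normc.
    - by move=> x _; rewrite -EFinM lee_fin expr2 ler_wpM2r ?normc_ge0.
  rewrite ge0_integralZl//; first last.
  - by move=> x _; rewrite lee_fin normc_ge0.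
  - by apply/measurable_EFinP; exact: cmeasurable_normc.
  by rewrite lte_mul_pinfty ?lee_fin.
exists (fine I `^ 2^-1); first exact: powR_ge0.
move=> k k0; apply: Lp_norm2_le; rewrite ?powR_ge0 ?fine_ge0//.
have := ge0_integral_rV_affine (0 : E) (lt0r_neq0 k0) mn (fun x => _).
under eq_integral do rewrite addr0.
move=> ->; last by move=> x; rewrite lee_fin exprn_ge0// normc_ge0.
rewrite -/I -{1}(fineK (x := I)) ?ge0_fin_numE// -EFinM lee_fin ler_wpM2r ?fine_ge0//.
rewrite gtr0_norm// -powR_mulrn ?powR_ge0// -powRrM mulNr divfK// powR_invn ?(ltW k0)//.
by rewrite exprVn.
Qed.

Lemma inverse_power_not_multiplier (eta : E -> R) s t alpha : cutoff eta ->
  0 < n%:R :> R -> 0 <= s -> 0 <= t -> s + t < alpha -> alpha < n%:R ->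
  ~ multiplier s t (regular_functional (@inverse_power R n alpha)).
Proof.
move=> [teta eta01 eta1 eta0] n0 s0 t0 sta aln [_ [c c0 hc]].
have ReW (w : C) : complex.Re w <= normc w := le_trans (ler_norm _) (Re_le_normc w).
have al0 : 0 < alpha by apply: le_lt_trans sta; rewrite addr_ge0.
set h := @inverse_power R n alpha in hc *.
have seta := test_schwartz teta.
have [A A0 hA] := bessel_norm_scale s0 teta.
have [N N0 hN] := Lp_norm2_scale seta.
have [c2 c20 hc2] := @bessel_potential_box_ge t t0.
(* In the cube of half-side 1 / n one has |x|^2 <= n rho^2 = rho <= 1, so the cutoff equals 1
   there. *)
pose rho : R := n%:R^-1.
have rho0 : 0 < rho by rewrite invr_gt0.
have n1 : 1 <= n%:R :> R by rewrite ler1n; rewrite ltr0n in n0.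
have rho1 : rho <= 1 by rewrite invf_le1.
pose c' := c2 * rho `^ t * (2 * rho) ^+ n.
have c'0 : 0 < c'.
  apply: mulr_gt0; first by rewrite mulr_gt0// powR_gt0.
  by rewrite exprn_gt0// mulr_gt0.
pose d := alpha - (s + t).
have d0 : 0 < d by rewrite subr_gt0.
suff main (k : R) : 1 <= k -> c' * k `^ d <= (c * A + 1) * N.
  (* Taking k = X^(1/d) turns k^d into X, and the summand 1 makes the left-hand side exceed the
     bound by c'. *)
  pose X := (c * A + 1) * N / c' + 1.
  have X1 : 1 <= X.
    by rewrite lerDr divr_ge0 ?(ltW c'0)// mulr_ge0// addr_ge0// mulr_ge0// ltW.
  have X0 : 0 < X by exact: lt_le_trans X1.
  have k1 : 1 <= X `^ d^-1.
    by rewrite -[leLHS](powRr0 X) ler_powR// invr_ge0 ltW.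
  have := main _ k1; rewrite -powRrM mulVf ?gt_eqF// powRr1 ?(ltW X0)//.
  rewrite /X mulrDr mulr1 mulrC divfK ?gt_eqF// => H.
  by have : c' <= 0; [rewrite -(lerD2l ((c * A + 1) * N)) addr0|rewrite leNgt c'0].
move=> k1; have k0 : 0 < k by exact: lt_le_trans k1.
have kn0 := lt0r_neq0 k0.
pose e x := eta (k *: x).
have te : test_function (fun x => ((e x)%:C)%C) := test_function_scale kn0 teta.
have se := test_schwartz te.
have e0 x : 0 <= e x by have /andP[] := eta01 (k *: x).
have ele1 x : e x <= 1 by have /andP[] := eta01 (k *: x).
pose r := rho / k.
have r0 : 0 < r by rewrite divr_gt0.
have r1 : r <= 1 by rewrite ler_pdivrMr// mul1r (le_trans rho1).
have normbox x : (forall i, `|x ord0 i| <= r) -> euclid_norm x <= k^-1.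
  move=> xr; rewrite -(@ler_pXn2r _ 2) ?nnegrE ?euclid_norm_ge0 ?invr_ge0 ?(ltW k0)//.
  apply: (le_trans (sqr_euclid_norm_box xr)); rewrite /r exprMn mulrA.
  have -> : n%:R * rho ^+ 2 = rho by rewrite expr2 mulrA mulfV ?mul1r// gt_eqF.
  by rewrite ler_piMl// exprn_ge0// invr_ge0 ltW.
have e1 x : (forall i, `|x ord0 i| <= r) -> e x = 1.
  move=> /normbox xk; apply: eta1.
  rewrite -(@ler_pXn2r _ 2) ?nnegrE ?euclid_norm_ge0// sqr_euclid_normZ -exprMn.
  rewrite lerXn2r ?nnegrE ?mulr_ge0 ?euclid_norm_ge0 ?(ltW k0)//.
  by rewrite mulrC -ler_pdivlMr// mul1r.
set P := fourier (fun xi => bessel_weight (- t) xi * inv_fourier (fun x => ((e x)%:C)%C) xi).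
have [P0 Pr] := hc2 e r se e0 r0 r1 e1; rewrite -/P in P0 Pr.
have [g [[[mg1 mg2 gy] hg] gn]] : exists g,
    bessel_density (- t) 2 (fmul (fun x => ((e x)%:C)%C) (regular_functional h)) g /\
    (Lp_norm 2 g <= ((c * A + 1) * (k `^ s * k `^ (- (n%:R / 2))))%:E)%E.
  (* The norm is an infimum over densities; the extra 1 makes the estimate strict, so some density
     stays below it. *)
  have lt : (bessel_norm (- t) 2 (fmul (fun x => ((e x)%:C)%C) (regular_functional h)) <
      ((c * A + 1) * (k `^ s * k `^ (- (n%:R / 2))))%:E)%E.
    apply: (le_lt_trans (hc _ te)).
    apply: (@le_lt_trans _ _ (c%:E * (k `^ s * k `^ (- (n%:R / 2)) * A)%:E)%E).
      by apply: lee_wpmul2l; [rewrite lee_fin ltW|exact: hA].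
    have kk : 0 < k `^ s * k `^ (- (n%:R / 2)) by rewrite mulr_gt0 ?powR_gt0.
    by rewrite -EFinM lte_fin mulrCA [ltRHS]mulrC ltr_pM2l// ltrDl.
  have [_ [g dg <-] gn] := ereal_inf_lt lt.
  by exists g; split => //; exact: ltW.
(* The pairing of J_{-t}(e h) with e itself, the potential being transposed onto the cutoff as [P].
   It equals the pairing of g with e, to which Cauchy-Schwarz applies. *)
pose V := cint mu (fun x => h x * (((e x)%:C)%C * P x)).
have VE : V = cint mu (fun x => g x * ((e x)%:C)%C) by exact: hg se.
have iw := cintegrable_bweight_ft (- t) (mulr1 (1:R)) se.
have PE : P = ft (-1) (fun xi => bessel_weight (- t) xi * ft 1 (fun x => ((e x)%:C)%C) xi).
  by rewrite -inv_fourierE -fourierE.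
have mP : cmeasurable P by rewrite PE; exact: cmeasurable_ft.
have [k2 hk2] : exists k2, forall x, normc (P x) <= k2 by rewrite PE; exact: ft_bounded.
clear PE hg iw; clearbody P.
have Vle : ((normc V)%:E <= ((c * A + 1) * (k `^ s * k `^ (- (n%:R / 2))) * (k `^ (- (n%:R / 2)) * N))%:E)%E.
  rewrite VE EFinM.
  have ey : (Lp_norm 2 (fun x => ((e x)%:C)%C) < +oo)%E.
    by apply: (le_lt_trans (hN k k0)); rewrite ltry.
  have me := schwartz_cmeasurable se.
  apply: (le_trans (normc_cintM_le (conj mg1 mg2) me gy ey)).
  by apply: lee_pmul; [exact: Lnorm_ge0|exact: Lnorm_ge0|exact: gn|exact: hN].
(* On the cube of half-side r one has |x| <= 1/k, so h >= k^alpha off the coordinate hyperplanes,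
   while e = 1 and P >= c2 r^t; the volume is (2 r)^n. *)
have Vge : ((k `^ alpha * (c2 * r `^ t) * (2 * r) ^+ n)%:E <= (normc V)%:E)%E.
  pose hr x : R := if x == 0 then 0 else euclid_norm x `^ (- alpha).
  have hE x : h x = ((hr x)%:C)%C by [].
  have hr0 x : 0 <= hr x by rewrite /hr; case: ifP => // _; exact: powR_ge0.
  have [b1 [b2 [b11 b20 eb eb0]]] := test_function_box te.
  have me := schwartz_cmeasurable se.
  have iF : cintegrable mu (fun x => h x * (((e x)%:C)%C * P x)).
    have ihe : cintegrable mu (fun x => h x * ((e x)%:C)%C).
      have b10 : 0 <= b1 := le_trans ler01 b11.
      have eb0' x : ~ (forall i, `|x ord0 i - (0 : E) ord0 i| <= b1) -> ((e x)%:C)%C = 0.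
        by move=> H; apply: eb0 => H'; apply: H => i; rewrite mxE subr0.
      exact: (cintegrable_inverse_powerM n0 al0 aln b10 b20 me eb eb0').
    rewrite (_ : (fun x => _) = fun x => P x * (h x * ((e x)%:C)%C)).
      exact: cintegrable_bounded hk2 ihe.
    by apply/funext => x; rewrite [RHS]mulrC mulrA.
  have ReF x : complex.Re (h x * (((e x)%:C)%C * P x)) = hr x * (e x * complex.Re (P x)).
    by rewrite hE !cReM /= !mul0r !subr0.
  have [iRe _] := (cintegrableP _ _).1 iF.
  have RV : (complex.Re V)%:E = (\int[mu]_x (hr x * (e x * complex.Re (P x)))%:E)%E.
    rewrite /V /= /Rintegral fineK; last exact: integrable_fin_num iRe.
    by apply: eq_integral => x _; rewrite -ReF.
  apply: (@le_trans _ _ (complex.Re V)%:E); last first.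
    rewrite lee_fin; exact: ReW.
  rewrite RV; apply: ge0_integral_ge_box.
  - exact: ltW.
  - have := measurable_int _ iRe; move/measurable_EFinP.
    by apply: eq_measurable_fun => x _; rewrite -ReF.
  - by move=> x; rewrite mulr_ge0// mulr_ge0// P0.
  - by rewrite mulr_ge0 ?powR_ge0// mulr_ge0 ?powR_ge0// ltW.
  - apply: filterS (rV_coord_neq0_ae R n) => x x0 xr.
    rewrite e1// mul1r; apply: ler_pM; last exact: Pr.
    + exact: powR_ge0.
    + by rewrite mulr_ge0 ?powR_ge0// ltW.
    have n0' : (0 < n)%N by rewrite ltr0n in n0.
    have xn0 : x != 0.
      apply/eqP => xE; have := x0 (Ordinal n0'); by rewrite xE mxE eqxx.
    have xe0 : 0 < euclid_norm x.
      apply: lt_le_trans (normr_coord_le x (Ordinal n0')).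
      by rewrite normr_gt0.
    rewrite /hr (negbTE xn0).
    rewrite powRN -[leLHS]invrK lef_pV2 ?posrE ?invr_gt0 ?powR_gt0// -powRN.
    have -> : k `^ (- alpha) = (k^-1) `^ alpha.
      by rewrite -powR_inv1 ?(ltW k0)// -powRrM mulN1r.
    by apply: ge0_ler_powR; rewrite ?nnegrE ?invr_ge0 ?(ltW al0) ?(ltW xe0) ?(ltW k0)//; exact: normbox.
(* Both bounds carry the factor k^(s - n); cancelling it leaves c' k^d against a constant. *)
have := le_trans Vge Vle; rewrite lee_fin.
have -> : r `^ t = rho `^ t * k `^ (- t).
  rewrite /r powRM ?(ltW rho0) ?invr_ge0 ?(ltW k0)//; congr (_ * _).
  by rewrite -powR_inv1 ?(ltW k0)// -powRrM mulN1r.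
have -> : (2 * r) ^+ n = (2 * rho) ^+ n * (k ^+ n)^-1.
  by rewrite /r mulrA exprMn exprVn.
have kk : k `^ alpha * k `^ (- t) = k `^ d * k `^ s.
  by rewrite -!powRD ?kn0 ?implybT//; congr (_ `^ _); rewrite /d; ring.
have nn : k `^ (- (n%:R / 2)) * k `^ (- (n%:R / 2)) = (k ^+ n)^-1.
  by rewrite -powRD ?kn0 ?implybT// -(powR_invn _ (ltW k0)); congr (_ `^ _); field.
have -> : k `^ alpha * (c2 * (rho `^ t * k `^ (- t))) * ((2 * rho) ^+ n * (k ^+ n)^-1) =
    (c' * k `^ d) * (k `^ s * (k ^+ n)^-1).
  rewrite /c' (_ : c2 * rho `^ t * (2 * rho) ^+ n * k `^ d * (k `^ s / k ^+ n) =
    c2 * rho `^ t * (2 * rho) ^+ n * (k `^ d * k `^ s) / k ^+ n); last by ring.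
  by rewrite -kk; ring.
have -> : (c * A + 1) * (k `^ s * k `^ (- (n%:R / 2))) * (k `^ (- (n%:R / 2)) * N) =
    ((c * A + 1) * N) * (k `^ s * (k ^+ n)^-1).
  by rewrite -nn; ring.
by rewrite ler_pM2r// mulr_gt0 ?powR_gt0 ?invr_gt0 ?exprn_gt0.
Qed.

End non_multiplier.

(** * Choice of the exponents and conclusion *)

Theorem theorem3 (R : realType) (n : nat) (s t : R) (eta : 'rV[R]_n -> R) :
  0 <= s -> 0 <= t ->
  0 < Num.max s t -> Num.max s t < n%:R / 2 ->
  cutoff eta ->
  forall epsilon : R, 0 < epsilon -> epsilon < n%:R / Num.max s t - 2 ->
  exists delta : R,
    [/\ 0 < delta, delta < n%:R / 2 - Num.max s t &
        (bessel_unif eta (- Num.min s t) (n%:R / Num.max s t - epsilon)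
          `\` multiplier s t) (regular_functional (inverse_power (s + t + delta)))].
Proof.
move=> s0 t0; rewrite -(addr_min_max s t).
have m0 : 0 <= Num.min s t by rewrite le_min s0.
have mM : Num.min s t <= Num.max s t by rewrite ge_min le_max lexx.
have stE := addr_min_max s t.
move: (Num.min s t) (Num.max s t) m0 mM stE => m M m0 mM stE M0 Mn ceta eps eps0 epsn.
set p := n%:R / M - eps.
have p2 : 2 < p by rewrite /p; lra.
have p0 : 0 < p by lra.
have Mp : M * p < n%:R.
  by rewrite /p mulrBr mulrCA mulfV ?mulr1 ?gt_eqF// gtrBl mulr_gt0.
have n0 : 0 < n%:R :> R by lra.
(* The requirement (alpha - m) p < n reads M + delta < q. Since p < n / M gives M < q and p > 2
   gives q < n / 2, half the gap between M and q serves as delta. *)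
pose q := n%:R / p; have qp : q * p = n%:R by rewrite /q divfK// gt_eqF.
have Mq : M < q by rewrite /q ltr_pdivlMr.
have qn : q < n%:R / 2 by rewrite /q ltr_pM2l// ltf_pV2 ?posrE.
exists ((q - M) / 2); split; [lra|lra|].
set alpha := m + M + (q - M) / 2.
have al0 : 0 < alpha by rewrite /alpha; lra.
have aln : alpha < n%:R by rewrite /alpha; lra.
split.
  apply: inverse_power_bessel_unif => //.
  - lra.
  - by rewrite /alpha; lra.
  - rewrite /alpha -[ltRHS]qp ltr_pM2r//; lra.
by apply: (inverse_power_not_multiplier ceta n0 s0 t0) => //; rewrite -stE /alpha; lra.
Qed.
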